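(* For every $\phi\in\mathbf{Q}[P]$ and every $\psi\in\mathbf{Q}[Q]$, $$\zeta(\phi)=L_{\square(\phi)}(1/2)\qquad\text{and}\qquad\zeta^{\pm}(\psi)=L_{\nabla(\psi)}(\rho^{\pm1}),$$ where $\rho=e^{i\pi/3}$ (the second identity being one for each choice of sign).
   Context: **Shuffle algebra.** Let $\mathcal W$ be the set of all words in the letters $a,b$ (including the empty word $\emptyset$), and let $\mathcal H=\mathbf{Q}\mathcal W$ be the $\mathbf{Q}$-vector space with basis $\mathcal W$. The shuffle product $*$ is the bilinear product given on words by the sum over all shuffles of the two words (all interleavings preserving the order of letters in each word, counted with multiplicity). $(\mathcal H,* )$ is a commutative associative algebra with unit $\emptyset$. Let $\mathcal W^+$ be the set of words whose first letter is not $b$ (including $\emptyset$), $\mathcal W^{++}$ the set of words whose first letter is not $b$ and whose last letter is not $a$ (including $\emptyset$), $\mathcal H^+=\mathbf{Q}\mathcal W^+$, $\mathcal H^{++}=\mathbf{Q}\mathcal W^{++}$. These are subalgebras and $\mathcal H=\mathcal H^+[b]=\mathcal H^{++}[a,b]$ are polynomial algebras (for $*$). **Polylogarithms and polyzeta values.** A nonempty $w\in\mathcal W^+$ is uniquely $w=ab^{t_1}\cdots ab^{t_k}$ with $t_i\ge0$; put $r_i=1+t_i$ and $L_w(z)=\sum_{0<n_1<\dots<n_k}n_1^{-r_1}\cdots n_k^{-r_k}z^{n_k}$ for $|z|<1$; $L_\emptyset=1$; $L_w$ extends continuously to $\{|z|\le1\}\setminus\{1\}$. Let $\Omega=\{|z|<1\}\setminus\,]-1,0]$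 and $\log z$ the holomorphic logarithm on $\Omega$ real on $]0,1[$. For $h\in\mathcal H$, $L_h(z)$ is the image of $h$ under the unique algebra morphism $(\mathcal H,* )\to\mathrm{Hol}(\Omega)$ sending $w\in\mathcal W^+$ to $L_w(z)$ and $b$ to $\log z$; $L_h(\rho^{\pm1})$ denotes the value of the continuous extension (with $\log\rho^{\pm1}=\pm i\pi/3$). For nonempty $w\in\mathcal W^{++}$, $\zeta(w)=\sum_{0<n_1<\dots<n_k}n_1^{-r_1}\cdots n_k^{-r_k}$; $\zeta(\emptyset)=1$. The maps $\zeta,\zeta^+,\zeta^-:\mathcal H\to\mathbf{C}$ are the unique algebra morphisms (for $*$) sending each $w\in\mathcal W^{++}$ to $\zeta(w)$, sending $b$ to $0$, and with $\zeta(a)=0$, $\zeta^{+}(a)=i\pi$, $\zeta^-(a)=-i\pi$. **The group $\Gamma$.** Let $F$ be the free Lie algebra over $\mathbf{Q}$ on $\alpha,\beta$, $C^nF$ its descending central series, $\mathfrak g=\varprojlim F/C^nF$, and $\Gamma=\varprojlim\Gamma_n$ the pro-algebraic group over $\mathbf{Q}$, where $\Gamma_n$ is $F/C^nF$ with the Campbell–Hausdorff group law; $\exp:\mathfrak g\to\Gamma$ is the resulting isomorphism of pro-algebraic varieties. $\mathcal H$ is a Hopf algebra with product $*$ and coproduct $\Delta(c_1\cdots c_n)=\sum_{0\le i\le n}c_1\cdots c_i\otimes c_{i+1}\cdots c_n$, and $\mathbf{Q}[\Gamma]$ is identified with $\mathcal H$ via the group isomorphism $\Gamma\simeq\mathrm{Spec}\,\mathcal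 H$ such that for $t\in\mathbf{Q}$ and a word $w$: $w(\exp t\alpha)=t^n/n!$ if $w=a^n$ and $0$ if $b$ occurs in $w$; $w(\exp t\beta)=t^n/n!$ if $w=b^n$ and $0$ if $a$ occurs in $w$. Thus $L_\Phi$, $\zeta(\Phi)$, $\zeta^\pm(\Phi)$ are defined for $\Phi\in\mathbf{Q}[\Gamma]$. **The anti-automorphisms $\sigma,\tau$.** On $\mathcal H$, let $\sigma(a)=b$, $\sigma(b)=a$, $\tau(a)=a+b$, $\tau(b)=-a$, extended linearly by $\sigma(c_1\cdots c_n)=\sigma(c_n)\cdots\sigma(c_1)$ and $\tau(c_1\cdots c_n)=\tau(c_n)\cdots\tau(c_1)$ (concatenation). They are algebra morphisms for $*$ and reverse the coproduct, so they induce group anti-automorphisms $\sigma,\tau$ of $\Gamma$, characterized by $\phi(\sigma(g))=(\sigma\phi)(g)$ and $\phi(\tau(g))=(\tau\phi)(g)$ for $\phi\in\mathbf{Q}[\Gamma]=\mathcal H$, $g\in\Gamma$. Explicitly $\sigma$ exchanges $\exp t\alpha$ and $\exp t\beta$, and $\tau(\exp t\alpha)=\exp t(\alpha-\beta)$, $\tau(\exp t\beta)=\exp t\alpha$. One has $\sigma^2(g)=g$ and $\tau^3(g)=g^{-1}$. **The spaces $P$ and $Q$.** Let $K=\{g\in\Gamma\mid\sigma(g)=g^{-1}\}$, $P=\{g\in\Gamma\mid\sigma(g)=g\}$, $L=\{g\in\Gamma\mid\tau(g)=g^{-1}\}$, and let $Q$ be the image of $g\in\Gamma\mapsto g\,\tau(g)$.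 $K,L$ are subgroups, $P,Q$ are closed subvarieties, and multiplication gives isomorphisms of pro-algebraic varieties $P\times K\to\Gamma$ and $Q\times L\to\Gamma$. For $\phi\in\mathbf{Q}[P]$: $\zeta(\phi):=\zeta(\hat\phi)$ for any $\hat\phi\in\mathbf{Q}[\Gamma]$ extending $\phi$; $L_\phi:=L_\Phi$ with $\Phi$ the right $K$-invariant extension of $\phi$ to $\Gamma$; $\square\phi(p)=\phi(p^2)$ for $p\in P$. For $\psi\in\mathbf{Q}[Q]$: $\zeta^\pm(\psi):=\zeta^\pm(\hat\psi)$ for any $\hat\psi\in\mathbf{Q}[\Gamma]$ extending $\psi$; $L_\psi:=L_\Psi$ with $\Psi$ the right $L$-invariant extension of $\psi$ to $\Gamma$; $\nabla\psi(q)=\psi(q\tau(q))$ for $q\in Q$. (The values $\zeta(\phi)$, $\zeta^\pm(\psi)$ do not depend on the chosen extensions.) *)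

(* Defs.v *)
From HB Require Import structures.
From mathcomp Require Import all_boot all_order all_algebra.
From mathcomp Require Import complex finmap monalg.
From mathcomp Require Import all_classical all_reals all_analysis.

Set Implicit Arguments.
Unset Strict Implicit.
Unset Printing Implicit Defensive.

Import Order.TTheory GRing.Theory Num.Theory.
Import numFieldNormedType.Exports.

Local Open Scope classical_set_scope.
Local Open Scope ring_scope.

(** * The shuffle algebra *)

(* The letters a and b are encoded as [true] and [false]. *)
Definition letter := bool.
Notation la := (true : letter) (only parsing).
Notation lb := (false : letter) (only parsing).

Definition word := seq letter.

Definition shalg := {malg rat[word]}.

HB.instance Definition _ := GRing.Lmodule.on shalg.

(* Locked, as [shmul] and [concat] below, so that unification does not unfold
   [{malg _}]. *)
HB.lock Definition wd (w : word) : shalg := << w >>.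

(* The Q-linear extension to [shalg] of a map defined on words. *)
Definition lext (V : lmodType rat) (f : word -> V) (h : shalg) : V :=
  \sum_(w <- msupp h) h@_w *: f w.

(* All interleavings of u and v, with multiplicity. *)
Fixpoint shuffles (u : word) : word -> seq word :=
  if u is x :: u' then
    fix shuffles_u (v : word) : seq word :=
      if v is y :: v' then
        [seq x :: w | w <- shuffles u' v] ++ [seq y :: w | w <- shuffles_u v']
      else [:: u]
  else fun v => [:: v].

Definition shw (u v : word) : shalg := \sum_(w <- shuffles u v) wd w.

HB.lock Definition shmul (p q : shalg) : shalg :=
  lext (fun u => lext (fun v => shw u v) q) p.

(* Concatenation of words, extended bilinearly. *)
HB.lock Definition concat (p q : shalg) : shalg :=
  lext (fun u => lext (fun v => wd (u ++ v)) q) p.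

Lemma linear0' (V W : lmodType rat) (k : V -> W) : linear k -> k 0 = 0.
Proof. by move=> lk; have := lk (-1) 0 0; rewrite scaler0 add0r scaleN1r addNr. Qed.

Section LinearExtension.
Variable V : lmodType rat.
Implicit Type f : word -> V.

Lemma lextwE f (h : shalg) (D : {fset word}) : (msupp h `<=` D)%fset ->
  lext f h = \sum_(w <- D) h@_w *: f w.
Proof.
move=> hD; rewrite /lext; apply: big_fset_incl => //.
by move=> w _ /mcoeff_outdom ->; rewrite scale0r.
Qed.

Lemma lext_is_linear f : linear (lext f).
Proof.
move=> c p q; pose D := (msupp p `|` msupp q `|` msupp (c *: p + q))%fset.
rewrite (@lextwE f p D) ?(@lextwE f q D) ?(@lextwE f (c *: p + q) D).
- rewrite scaler_sumr -big_split; apply: eq_bigr => w _ /=.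
  by rewrite mcoeffD mcoeffZ scalerDl scalerA.
- by rewrite /D fsubsetUr.
- by rewrite /D -fsetUA fsetUCA fsubsetUl.
- by rewrite /D -fsetUA fsubsetUl.
Qed.

HB.instance Definition _ f :=
  GRing.isLinear.Build rat shalg V *:%R (lext f) (lext_is_linear f).

Lemma lext_wd f w : lext f (wd w) = f w.
Proof. rewrite wd.unlock (@lextwE _ _ [fset w]%fset) ?msuppU_le //.
by rewrite big_seq_fset1 mcoeffUU scale1r. Qed.

Lemma shalg_ind (P : shalg -> Prop) : (forall w, P (wd w)) -> P 0 ->
  (forall c p q, P p -> P q -> P (c *: p + q)) -> forall h, P h.
Proof.
move=> Pw P0 PD h; rewrite (monalgE h).
elim: (msupp h : seq _) => [|w s IH]; first by rewrite big_nil.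
rewrite big_cons; suff -> : << h@_w *g w >> = h@_w *: wd w by apply: PD.
by apply/malgP => v; rewrite mcoeffZ wd.unlock !mcoeffU mulrnAr mulr1.
Qed.

Lemma linear_eq_wd (f g : shalg -> V) : linear f -> linear g ->
  (forall w, f (wd w) = g (wd w)) -> f =1 g.
Proof.
move=> lf lg e; apply: shalg_ind => //.
  by rewrite !linear0'.
by move=> c p q ep eq; rewrite lf lg ep eq.
Qed.

Lemma eq_lext f g : f =1 g -> lext f =1 lext g.
Proof. by move=> e h; apply: eq_bigr => w _; rewrite e. Qed.

Lemma lextP f c (g : word -> V) h : lext (fun w => c *: f w + g w) h =
  c *: lext f h + lext g h.
Proof.
rewrite /lext scaler_sumr -big_split; apply: eq_bigr => w _ /=.
by rewrite scalerDr !scalerA mulrC.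
Qed.

End LinearExtension.

Section Bilinear.
Variables (V : lmodType rat) (b : word -> word -> V).

Definition blext (p q : shalg) : V := lext (fun u => lext (b u) q) p.

Lemma blext_linearl q : linear (blext^~ q).
Proof. by move=> c p p'; rewrite /blext linearP. Qed.

Lemma blext_linearr p : linear (blext p).
Proof.
move=> c q q'; rewrite /blext -lextP; apply: eq_lext => u /=.
by rewrite linearP.
Qed.

Lemma blext_wd u v : blext (wd u) (wd v) = b u v.
Proof. by rewrite /blext !lext_wd. Qed.

End Bilinear.

Lemma bilinear_eq_wd (V : lmodType rat) (f g : shalg -> shalg -> V) :
  (forall q, linear (f^~ q)) -> (forall p, linear (f p)) ->
  (forall q, linear (g^~ q)) -> (forall p, linear (g p)) ->
  (forall u v, f (wd u) (wd v) = g (wd u) (wd v)) -> forall p q, f p q = g p q.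
Proof.
move=> fl fr gl gr e p q; apply: (linear_eq_wd (fl q) (gl q)) => u.
exact: (linear_eq_wd (fr _) (gr _)).
Qed.

Lemma shmul_linearl q : linear (shmul^~ q).
Proof. by rewrite shmul.unlock; exact: blext_linearl. Qed.
Lemma shmul_linearr p : linear (shmul p).
Proof. by rewrite shmul.unlock; exact: blext_linearr. Qed.
Lemma shmul_wd u v : shmul (wd u) (wd v) = shw u v.
Proof. by rewrite shmul.unlock; exact: blext_wd. Qed.

Lemma concat_linearl q : linear (concat^~ q).
Proof. by rewrite concat.unlock; exact: blext_linearl. Qed.
Lemma concat_linearr p : linear (concat p).
Proof. by rewrite concat.unlock; exact: blext_linearr. Qed.
Lemma concat_wd u v : concat (wd u) (wd v) = wd (u ++ v).
Proof. by rewrite concat.unlock; exact: (blext_wd (fun u v => wd (u ++ v))). Qed.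

Definition lcons (x : letter) : shalg -> shalg := lext (fun w => wd (x :: w)).
HB.instance Definition _ x := GRing.Linear.on (lcons x).

Lemma lcons_wd x w : lcons x (wd w) = wd (x :: w).
Proof. exact: lext_wd. Qed.

Lemma shw0l v : shw [::] v = wd v.
Proof. by rewrite /shw big_seq1. Qed.

Lemma shw0r u : shw u [::] = wd u.
Proof. by case: u => [|x u]; rewrite /shw big_seq1. Qed.

Lemma shw_cons x u y v :
  shw (x :: u) (y :: v) = lcons x (shw u (y :: v)) + lcons y (shw (x :: u) v).
Proof.
rewrite /shw /= big_cat !big_map /= !linear_sum /=.
by congr +%R; apply: eq_bigr => w _; rewrite lcons_wd.
Qed.

Lemma shwC u v : shw u v = shw v u.
Proof.
elim: u v => [|x u IHu] v; first by rewrite shw0l shw0r.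
elim: v => [|y v IHv]; first by rewrite shw0l shw0r.
by rewrite !shw_cons IHv -IHu addrC.
Qed.

Lemma shmulC : commutative shmul.
Proof.
apply: (@bilinear_eq_wd _ shmul (fun p q => shmul q p)).
- exact: shmul_linearl.
- exact: shmul_linearr.
- exact: shmul_linearr.
- exact: shmul_linearl.
by move=> u v; rewrite !shmul_wd shwC.
Qed.

Lemma scalerDDA (V : lmodType rat) (c : rat) (p p' q q' : V) :
  (c *: p + p') + (c *: q + q') = c *: (p + q) + (p' + q').
Proof. by rewrite scalerDr addrACA. Qed.

Lemma shmul_cons x y p q : shmul (lcons x p) (lcons y q) =
  lcons x (shmul p (lcons y q)) + lcons y (shmul (lcons x p) q).
Proof.
move: p q; apply: (@bilinear_eq_wd _
  (fun p q => shmul (lcons x p) (lcons y q))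
  (fun p q => lcons x (shmul p (lcons y q)) + lcons y (shmul (lcons x p) q))).
- by move=> q c p p'; rewrite linearP shmul_linearl.
- by move=> p c q q'; rewrite linearP shmul_linearr.
- by move=> q c p p'; rewrite linearP !shmul_linearl !linearP /= scalerDDA.
- by move=> p c q q'; rewrite linearP !shmul_linearr !linearP /= scalerDDA.
by move=> u v; rewrite !lcons_wd !shmul_wd shw_cons.
Qed.

Lemma shmul1p : left_id (wd [::]) shmul.
Proof.
apply: (linear_eq_wd (shmul_linearr _)) => [c p q //|v].
by rewrite shmul_wd shw0l.
Qed.

Lemma shmulDl p q r : shmul (p + q) r = shmul p r + shmul q r.
Proof. by have := shmul_linearl r 1 p q; rewrite !scale1r. Qed.

Lemma shmulDr r p q : shmul r (p + q) = shmul r p + shmul r q.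
Proof. by have := shmul_linearr r 1 p q; rewrite !scale1r. Qed.

Lemma shmulZl c p q : shmul (c *: p) q = c *: shmul p q.
Proof.
have := shmul_linearl q c p 0.
by rewrite addr0 (linear0' (shmul_linearl q)) addr0.
Qed.

Lemma shmulp1 : right_id (wd [::]) shmul.
Proof. by move=> p; rewrite shmulC shmul1p. Qed.

Lemma shmulA_wd u v w :
  shmul (wd u) (shmul (wd v) (wd w)) = shmul (shmul (wd u) (wd v)) (wd w).
Proof.
have [n] := ubnP (size u + size v + size w)%N.
elim: n u v w => // n IH [|x u] [|y v] [|z w] /=;
  rewrite ?(shmul1p, shmulp1) //.
rewrite !(addSn, addnS) !ltnS => le_n.
have IH1 := IH u (y :: v) (z :: w); have IH2 := IH (x :: u) v (z :: w).
have IH3 := IH (x :: u) (y :: v) w; rewrite -!lcons_wd in IH1 IH2 IH3 *.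
set U := wd u in IH1 IH2 IH3 *; set V := wd v in IH1 IH2 IH3 *.
set W := wd w in IH1 IH2 IH3 *.
set U' := lcons x U in IH1 IH2 IH3 *; set V' := lcons y V in IH1 IH2 IH3 *.
set W' := lcons z W in IH1 IH2 IH3 *.
have -> : shmul U' (shmul V' W') = lcons x (shmul U (shmul V' W')) +
    lcons y (shmul U' (shmul V W')) + lcons z (shmul U' (shmul V' W)).
  rewrite [shmul V' W']shmul_cons 2!shmulDr !shmul_cons linearD /=.
  by rewrite addrACA addrA.
have -> : shmul (shmul U' V') W' = lcons x (shmul (shmul U V') W') +
    lcons y (shmul (shmul U' V) W') + lcons z (shmul (shmul U' V') W).
  rewrite [shmul U' V']shmul_cons 2!shmulDl !shmul_cons linearD /=.
  by rewrite addrACA addrA.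
by rewrite IH1 ?IH2 ?IH3 //= !(addSn, addnS).
Qed.

Lemma shmulA : associative shmul.
Proof.
move=> p q r; move: p q.
apply: (@bilinear_eq_wd _ (fun p q => shmul p (shmul q r))
  (fun p q => shmul (shmul p q) r)).
- by move=> q; exact: shmul_linearl.
- by move=> p c q q'; rewrite shmul_linearl shmul_linearr.
- by move=> q c p p'; rewrite 2!shmul_linearl.
- by move=> p c q q'; rewrite shmul_linearr shmul_linearl.
move=> u v; move: r; apply: (@linear_eq_wd _ 
  (fun r => shmul (wd u) (shmul (wd v) r)) (shmul (shmul (wd u) (wd v)))).
- by move=> c p p'; rewrite 2!shmul_linearr.
- exact: shmul_linearr.
by move=> w; exact: shmulA_wd.
Qed.

Lemma wd0_neq0 : wd [::] != 0.
Proof. by rewrite wd.unlock monalgU_eq0 oner_eq0. Qed.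

(* From here on, [p * q] in [shalg] is the shuffle product. *)
HB.instance Definition _ := GRing.Zmodule_isComNzRing.Build shalg
  shmulA shmulC shmul1p shmulDl wd0_neq0.
HB.instance Definition _ :=
  GRing.Lmodule_isLalgebra.Build rat shalg (fun c p q => esym (shmulZl c p q)).
HB.instance Definition _ := GRing.Lalgebra_isComAlgebra.Build rat shalg.


(** * Anti-multiplicative substitutions *)

Lemma concatDl p q r : concat (p + q) r = concat p r + concat q r.
Proof. by have := concat_linearl r 1 p q; rewrite !scale1r. Qed.

Lemma concat_lcons x p q : concat (lcons x p) q = lcons x (concat p q).
Proof.
move: p q; apply: (@bilinear_eq_wd _ (fun p q => concat (lcons x p) q)
  (fun p q => lcons x (concat p q))).
- by move=> q c p p'; rewrite linearP concat_linearl.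
- by move=> p; exact: concat_linearr.
- by move=> q c p p'; rewrite concat_linearl linearP.
- by move=> p c q q'; rewrite concat_linearr linearP.
by move=> u v; rewrite lcons_wd !concat_wd lcons_wd.
Qed.

Lemma shw_rcons0 x v y : shw [:: x] (rcons v y) =
  concat (wd (rcons v y)) (wd [:: x]) + concat (shw [:: x] v) (wd [:: y]).
Proof.
elim: v => [|z v IH].
  by rewrite shw_cons shw0l !shw0r !lcons_wd !concat_wd addrC.
rewrite rcons_cons !shw_cons IH !shw0l concatDl linearD /= !lcons_wd.
rewrite !concat_wd !lcons_wd concat_lcons /= -cats1 !addrA; congr +%R.
by rewrite addrC.
Qed.

Lemma shw_rcons u x v y : shw (rcons u x) (rcons v y) =
  concat (shw u (rcons v y)) (wd [:: x]) +
  concat (shw (rcons u x) v) (wd [:: y]).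
Proof.
elim: u v => [|z u IHu] v; first by rewrite shw0l shw_rcons0.
elim: v => [|t v IHv].
  by rewrite shwC shw_rcons0 shw0r addrC ![shw [:: y] _]shwC.
rewrite !rcons_cons !shw_cons -!rcons_cons IHu IHv !concatDl !concat_lcons.
by rewrite !linearD /= addrACA.
Qed.

Lemma shmul_rcons p x q y :
  shmul (concat p (wd [:: x])) (concat q (wd [:: y])) =
  concat (shmul p (concat q (wd [:: y]))) (wd [:: x]) +
  concat (shmul (concat p (wd [:: x])) q) (wd [:: y]).
Proof.
move: p q; apply: (@bilinear_eq_wd _
  (fun p q => shmul (concat p (wd [:: x])) (concat q (wd [:: y])))
  (fun p q => concat (shmul p (concat q (wd [:: y]))) (wd [:: x]) +
              concat (shmul (concat p (wd [:: x])) q) (wd [:: y]))).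
- by move=> q c p p'; rewrite !(concat_linearl, shmul_linearl).
- by move=> p c q q'; rewrite !(concat_linearl, shmul_linearr).
- move=> q c p p'.
  by rewrite !(concat_linearl, shmul_linearl) scalerDDA.
- move=> p c q q'.
  by rewrite !(concat_linearl, shmul_linearr) scalerDDA.
by move=> u v; rewrite !(concat_wd, shmul_wd) !cats1 shw_rcons.
Qed.

Definition lspan (p : shalg) : Prop :=
  exists c d : rat, p = c *: wd [:: la] + d *: wd [:: lb].

Lemma lspan_eq (V : lmodType rat) (f g : shalg -> V) p : lspan p ->
  linear f -> linear g -> (forall x, f (wd [:: x]) = g (wd [:: x])) ->
  f p = g p.
Proof.
move=> [c [d ->]] lf lg e; rewrite lf lg e.
have Z k : linear k -> k (d *: wd [:: lb]) = d *: k (wd [:: lb]) :> V.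
  by move=> lk; have := lk d (wd [:: lb]) 0; rewrite addr0 (linear0' lk) addr0.
by rewrite !Z ?e.
Qed.

Lemma shmul_concat p q s t : lspan s -> lspan t ->
  shmul (concat p s) (concat q t) =
  concat (shmul p (concat q t)) s + concat (shmul (concat p s) q) t.
Proof.
move=> ls lt.
apply: (@lspan_eq _ (fun s => shmul (concat p s) (concat q t))
  (fun s => concat (shmul p (concat q t)) s +
            concat (shmul (concat p s) q) t) _ ls).
- by move=> c r r'; rewrite concat_linearr shmul_linearl.
- move=> c r r'; rewrite !concat_linearr shmul_linearl concat_linearl.
  by rewrite scalerDDA.
move=> x; apply: (@lspan_eq _
  (fun t => shmul (concat p (wd [:: x])) (concat q t))
  (fun t => concat (shmul p (concat q t)) (wd [:: x]) +
            concat (shmul (concat p (wd [:: x])) q) t) _ lt).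
- by move=> c r r'; rewrite concat_linearr shmul_linearr.
- move=> c r r'; rewrite !concat_linearr shmul_linearr concat_linearl.
  by rewrite scalerDDA.
by move=> y; rewrite shmul_rcons.
Qed.

(* [antiw s (c_1 ... c_n)] is the concatenation [s c_n ... s c_1]. *)
Fixpoint antiw (s : letter -> shalg) (w : word) : shalg :=
  if w is c :: w' then concat (antiw s w') (s c) else wd [::].

Definition antiext (s : letter -> shalg) : shalg -> shalg := lext (antiw s).
HB.instance Definition _ s := GRing.Linear.on (antiext s).

Lemma antiext_wd s w : antiext s (wd w) = antiw s w.
Proof. exact: lext_wd. Qed.

Lemma antiext_lcons s x p : antiext s (lcons x p) = concat (antiext s p) (s x).
Proof.
move: p; apply: (@linear_eq_wd _ (fun p => antiext s (lcons x p))
  (fun p => concat (antiext s p) (s x))).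
- by move=> c p p'; rewrite 2!linearP.
- by move=> c p p'; rewrite linearP concat_linearl.
by move=> w; rewrite lcons_wd !antiext_wd.
Qed.

Lemma antiext_mul s : (forall x, lspan (s x)) ->
  {morph antiext s : p q / p * q}.
Proof.
move=> ls; apply: (@bilinear_eq_wd _ (fun p q => antiext s (shmul p q))
  (fun p q => shmul (antiext s p) (antiext s q))).
- by move=> q c p p'; rewrite shmul_linearl linearP.
- by move=> p c q q'; rewrite shmul_linearr linearP.
- by move=> q c p p'; rewrite linearP shmul_linearl.
- by move=> p c q q'; rewrite linearP shmul_linearr.
move=> u v; rewrite shmul_wd !antiext_wd.
elim: u v => [|x u IHu] v; first by rewrite shw0l antiext_wd shmul1p.
elim: v => [|y v IHv]; first by rewrite shw0r antiext_wd shmulp1.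
by rewrite shw_cons linearD /= !antiext_lcons IHu IHv /= shmul_concat.
Qed.

Lemma antiext1 s : antiext s 1 = 1.
Proof. exact: antiext_wd. Qed.

Lemma lspan_letter x : lspan (wd [:: x]).
Proof.
case: x; first by exists 1, 0; rewrite scale1r scale0r addr0.
by exists 0, 1; rewrite scale1r scale0r add0r.
Qed.

Lemma lspanN p : lspan p -> lspan (- p).
Proof. by move=> [c [d ->]]; exists (- c), (- d); rewrite !scaleNr opprD. Qed.

Lemma lspanD p q : lspan p -> lspan q -> lspan (p + q).
Proof.
move=> [c [d ->]] [c' [d' ->]]; exists (c + c'), (d + d').
by rewrite !scalerDl addrACA.
Qed.

Definition sigma_letter (x : letter) : shalg := wd [:: ~~ x].
Definition tau_letter (x : letter) : shalg :=
  if x == la then wd [:: la] + wd [:: lb] else - wd [:: la].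
Definition antipode_letter (x : letter) : shalg := - wd [:: x].

Definition sigmaH := antiext sigma_letter.
Definition tauH := antiext tau_letter.
Definition antipode := antiext antipode_letter.

Lemma sigma_lspan x : lspan (sigma_letter x).
Proof. exact: lspan_letter. Qed.
Lemma tau_lspan x : lspan (tau_letter x).
Proof.
rewrite /tau_letter; case: ifP => _; last exact/lspanN/lspan_letter.
by apply: lspanD; exact: lspan_letter.
Qed.
Lemma antipode_lspan x : lspan (antipode_letter x).
Proof. exact/lspanN/lspan_letter. Qed.

HB.instance Definition _ := GRing.Linear.on sigmaH.
HB.instance Definition _ := GRing.Linear.on tauH.
HB.instance Definition _ := GRing.Linear.on antipode.
HB.instance Definition _ := GRing.isMonoidMorphism.Build shalg shalg sigmaH
  (antiext1 sigma_letter, antiext_mul sigma_lspan).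
HB.instance Definition _ := GRing.isMonoidMorphism.Build shalg shalg tauH
  (antiext1 tau_letter, antiext_mul tau_lspan).
HB.instance Definition _ := GRing.isMonoidMorphism.Build shalg shalg antipode
  (antiext1 antipode_letter, antiext_mul antipode_lspan).

(** * The group scheme *)

(* [dec B w] is the sum of [B u v] over all factorisations [w = u ++ v]. *)
Definition dec (V : lmodType rat) (B : word -> word -> V) (w : word) : V :=
  \sum_(i < (size w).+1) B (take i w) (drop i w).

(* [convol f g] is the composite of the coproduct with [p \otimes q |-> f p * g q]. *)
Definition convol (A : comAlgType rat) (f g : shalg -> A) : shalg -> A :=
  lext (dec (fun u v => f (wd u) * g (wd v))).

Section Convolution.

Lemma dec0 (V : lmodType rat) (B : word -> word -> V) :
  dec B [::] = B [::] [::].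
Proof. by rewrite /dec big_ord1. Qed.

Lemma dec_cons (V : lmodType rat) (B : word -> word -> V) x w :
  dec B (x :: w) = B [::] (x :: w) + dec (fun u v => B (x :: u) v) w.
Proof. by rewrite /dec big_ord_recl. Qed.

Lemma decD (V : lmodType rat) (B B' : word -> word -> V) w :
  dec (fun u v => B u v + B' u v) w = dec B w + dec B' w.
Proof. exact: big_split. Qed.

Lemma eq_dec (V : lmodType rat) (B B' : word -> word -> V) :
  (forall u v, B u v = B' u v) -> dec B =1 dec B'.
Proof. by move=> e w; apply: eq_bigr => i _. Qed.

Lemma decA (V : lmodType rat) (B : word -> word -> word -> V) w :
  dec (fun u v => dec (B u) v) w =
  dec (fun u v => dec (fun u1 u2 => B u1 u2 v) u) w.
Proof.
elim: w B => [|x w IH] B; first by rewrite !dec0.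
rewrite !dec_cons IH dec0 -addrA; congr +%R; rewrite -decD.
by apply: eq_dec => u v; rewrite dec_cons.
Qed.

Variable A : comAlgType rat.
Implicit Types (f g : {linear shalg -> A}) (B : word -> word -> A).

HB.instance Definition _ (f g : shalg -> A) := GRing.Linear.on (convol f g).

Lemma dec_mull B a w : a * dec B w = dec (fun u v => a * B u v) w.
Proof. exact: mulr_sumr. Qed.

Lemma dec_mulr B a w : dec B w * a = dec (fun u v => B u v * a) w.
Proof. exact: mulr_suml. Qed.

Lemma convol_wd (f g : shalg -> A) w :
  convol f g (wd w) = dec (fun u v => f (wd u) * g (wd v)) w.
Proof. exact: lext_wd. Qed.

Lemma convol1 (f g : shalg -> A) : convol f g 1 = f 1 * g 1.
Proof. by rewrite [LHS]convol_wd dec0. Qed.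

Lemma convol_lcons f g x p : convol f g (lcons x p) =
  f 1 * g (lcons x p) + convol (f \o lcons x) g p.
Proof.
apply: (@linear_eq_wd _ (fun p => convol f g (lcons x p))
  (fun p => f 1 * g (lcons x p) + convol (f \o lcons x) g p)).
- by move=> c q q'; rewrite 2!linearP.
- by move=> c q q'; rewrite !linearP /= mulrDr -scalerAr scalerDDA.
move=> w; rewrite lcons_wd !convol_wd dec_cons; congr +%R.
by apply: eq_dec => u v /=; rewrite lcons_wd.
Qed.

Lemma convol_shw f g u v : convol f g (shw u v) =
  dec (fun u1 u2 => dec (fun v1 v2 => f (shw u1 v1) * g (shw u2 v2)) v) u.
Proof.
elim: u v f g => [|x u IHu] v f g.
  rewrite shw0l dec0 convol_wd; apply: eq_dec => v1 v2.
  by rewrite !shw0l.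
elim: v f g => [|y v IHv] f g.
  rewrite shw0r convol_wd; apply: eq_dec => u1 u2.
  by rewrite dec0 !shw0r.
rewrite shw_cons linearD /= !convol_lcons IHu IHv !dec_cons /=.
have -> : dec (fun u1 u2 => dec (fun v1 v2 =>
    f (shw (x :: u1) v1) * g (shw u2 v2)) (y :: v)) u =
  dec (fun u1 u2 => f (lcons x (shw u1 [::])) * g (shw u2 (y :: v)) +
    dec (fun v1 v2 => f (lcons x (shw u1 (y :: v1))) * g (shw u2 v2)) v) u +
  dec (fun u1 u2 => dec (fun v1 v2 =>
    f (lcons y (shw (x :: u1) v1)) * g (shw u2 v2)) v) u.
  rewrite -decD; apply: eq_dec => u1 u2.
  rewrite dec_cons !shw0r lcons_wd -addrA; congr +%R.
  rewrite -decD; apply: eq_dec => v1 v2.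
  by rewrite shw_cons linearD mulrDl.
have -> : dec (fun u1 u2 => dec (fun v1 v2 =>
    f (lcons x (shw u1 v1)) * g (shw u2 v2)) (y :: v)) u =
  dec (fun u1 u2 => f (lcons x (shw u1 [::])) * g (shw u2 (y :: v)) +
    dec (fun v1 v2 => f (lcons x (shw u1 (y :: v1))) * g (shw u2 v2)) v) u.
  by apply: eq_dec => u1 u2; rewrite dec_cons.
have -> : dec (fun v1 v2 => f (shw [::] (y :: v1)) * g (shw (x :: u) v2)) v =
    dec (fun v1 v2 => f (lcons y (shw [::] v1)) * g (shw (x :: u) v2)) v.
  by apply: eq_dec => v1 v2; rewrite !shw0l lcons_wd.
rewrite shw0l shw_cons linearD mulrDr /=.
rewrite addrACA -!addrA; congr +%R; congr +%R.
by rewrite addrCA.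
Qed.

Lemma convol_mul (f g : {lrmorphism shalg -> A}) :
  {morph convol f g : p q / p * q}.
Proof.
apply: (@bilinear_eq_wd _ (fun p q => convol f g (shmul p q))
  (fun p q => convol f g p * convol f g q)).
- by move=> q c p p'; rewrite shmul_linearl linearP.
- by move=> p c q q'; rewrite shmul_linearr linearP.
- by move=> q c p p'; rewrite linearP mulrDl scalerAl.
- by move=> p c q q'; rewrite linearP mulrDr scalerAr.
move=> u v; rewrite shmul_wd convol_shw !convol_wd dec_mulr.
apply: eq_dec => u1 u2; rewrite dec_mull; apply: eq_dec => v1 v2.
by rewrite -!shmul_wd !rmorphM mulrACA.
Qed.

Lemma convolA (f g h : shalg -> A) p :
  convol f (convol g h) p = convol (convol f g) h p.
Proof.
move: p; apply: linear_eq_wd; [exact: linearP|exact: linearP|move=> w].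
rewrite !convol_wd.
transitivity (dec (fun u v => dec (fun v1 v2 =>
    f (wd u) * g (wd v1) * h (wd v2)) v) w).
  apply: eq_dec => u v; rewrite convol_wd dec_mull.
  by apply: eq_dec => v1 v2; rewrite mulrA.
transitivity (dec (fun u v => dec (fun u1 u2 =>
    f (wd u1) * g (wd u2) * h (wd v)) u) w); last first.
  by apply: eq_dec => u v; rewrite convol_wd dec_mulr.
exact: (decA (fun a b c => f (wd a) * g (wd b) * h (wd c))).
Qed.

End Convolution.


Lemma antipode_wd w : antipode (wd w) = (-1) ^+ size w *: wd (rev w).
Proof.
rewrite [LHS]antiext_wd; elim: w => [|x w IH]; first by rewrite scale1r.
have cN p q : concat p (- q) = - concat p q.
  have := concat_linearr p (-1) q 0.
  by rewrite (linear0' (concat_linearr p)) !addr0 !scaleN1r.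
have cZ c p q : concat (c *: p) q = c *: concat p q.
  have := concat_linearl q c p 0.
  by rewrite (linear0' (concat_linearl q)) !addr0.
by rewrite /= IH cZ cN concat_wd exprS mulN1r scalerN scaleNr rev_cons cats1.
Qed.

Lemma antipodeK : involutive antipode.
Proof.
apply: (@linear_eq_wd _ (antipode \o antipode) id) => [||w /=];
  [exact: linearP|by []|].
rewrite antipode_wd linearZ /= antipode_wd size_rev revK scalerA -expr2.
by rewrite sqrr_sign scale1r.
Qed.

Lemma dec_antipode x u v :
  dec (fun v1 v2 => (-1) ^+ size v1 *: shw (rev v1 ++ x :: u) v2) v =
  lcons x (shw u v).
Proof.
elim: v x u => [|y v IH] x u; first by rewrite dec0 scale1r !shw0r lcons_wd.
rewrite dec_cons scale1r /= shw_cons -(IH y (x :: u)) -addrA.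
rewrite /dec -big_split big1 ?addr0 // => i _ /=.
by rewrite exprS mulN1r scaleNr rev_cons cat_rcons subrr.
Qed.

(* The group is the affine group scheme with coordinate ring [shalg], handled
   through its functor of points on commutative Q-algebras: the value of the
   regular function [h : shalg] at [g : Gamma A] is [g h]. The point
   exp (t alpha) is the morphism sending a^n to t^n / n! and the words containing
   b to 0, and similarly for exp (t beta). The group law below is dual to the
   deconcatenation coproduct. *)
Definition Gamma (A : comAlgType rat) := {lrmorphism shalg -> A}.

Section Group.
Variable A : comAlgType rat.
Implicit Types g h : Gamma A.

Lemma Gamma_ext g h : (forall w, g (wd w) = h (wd w)) -> g = h.
Proof.
move=> e; have : (g : shalg -> A) = h.
  by apply/funext; apply: linear_eq_wd => //; exact: linearP.
case: g h {e} => [g [m1 m2 m3]] [h [n1 n2 n3]] /= e; subst h.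
case: m1 n1 => p1 [q1]; case: m2 n2 => p2 [q2]; case: m3 n3 => p3 [q3].
by rewrite (Prop_irrelevance p1 q1) (Prop_irrelevance p2 q2)
  (Prop_irrelevance p3 q3).
Qed.

Definition counit : shalg -> A := lext (fun w => (w == [::])%:R).
HB.instance Definition _ := GRing.Linear.on counit.

Lemma counit_wd w : counit (wd w) = (w == [::])%:R.
Proof. exact: lext_wd. Qed.

Lemma counit_lcons x p : counit (lcons x p) = 0.
Proof.
move: p; apply: (@linear_eq_wd _ (fun p => counit (lcons x p)) (fun _ => 0)).
- by move=> c p p'; rewrite 2!linearP.
- by move=> c p p'; rewrite scaler0 addr0.
by move=> w; rewrite lcons_wd counit_wd.
Qed.

Lemma counit_mul : {morph counit : p q / p * q}.
Proof.
apply: (@bilinear_eq_wd _ (fun p q => counit (shmul p q))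
  (fun p q => counit p * counit q)).
- by move=> q c p p'; rewrite shmul_linearl linearP.
- by move=> p c q q'; rewrite shmul_linearr linearP.
- by move=> q c p p'; rewrite linearP mulrDl scalerAl.
- by move=> p c q q'; rewrite linearP mulrDr scalerAr.
move=> [|x u] v; rewrite shmul_wd.
  by rewrite shw0l [counit (wd [::])]counit_wd mul1r.
case: v => [|y v]; first by rewrite shw0r [counit (wd [::])]counit_wd mulr1.
by rewrite shw_cons linearD /= !counit_lcons !counit_wd addr0 mul0r.
Qed.

Lemma counit1 : counit 1 = 1.
Proof. exact: counit_wd. Qed.

HB.instance Definition _ := GRing.isMonoidMorphism.Build shalg A counit
  (counit1, counit_mul).

Definition gone : Gamma A := counit.

Lemma gone_wd w : gone (wd w) = (w == [::])%:R.
Proof. exact: counit_wd. Qed.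

Definition gmul_fun g h : shalg -> A := convol g h.

Lemma gmul_fun1 g h : gmul_fun g h 1 = 1.
Proof. by rewrite /gmul_fun convol1 !rmorph1 mulr1. Qed.

HB.instance Definition _ g h := GRing.Linear.on (gmul_fun g h).
HB.instance Definition _ g h := GRing.isMonoidMorphism.Build shalg A
  (gmul_fun g h) (gmul_fun1 g h, convol_mul g h).

Definition gmul g h : Gamma A := gmul_fun g h.
Definition ginv g : Gamma A := g \o antipode.

Lemma gmulA : associative gmul.
Proof. by move=> f g h; apply: Gamma_ext => w; exact: convolA. Qed.

Lemma gmul1g : left_id gone gmul.
Proof.
move=> g; apply: Gamma_ext => w; rewrite [LHS]convol_wd.
case: w => [|x w]; first by rewrite dec0 gone_wd mul1r.
rewrite dec_cons gone_wd mul1r /dec big1 ?addr0 // => i _ /=.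
by rewrite gone_wd mul0r.
Qed.

Lemma gmulg1 : right_id gone gmul.
Proof.
move=> g; apply: Gamma_ext => w; rewrite [LHS]convol_wd.
rewrite /dec big_ord_recr /= take_size drop_size gone_wd mulr1.
rewrite big1 ?add0r // => i _; rewrite gone_wd -size_eq0 size_drop.
by rewrite subn_eq0 leqNgt ltn_ord mulr0.
Qed.

Lemma gmulVg : left_inverse gone ginv gmul.
Proof.
move=> g; apply: Gamma_ext => w; rewrite [LHS]convol_wd [RHS]gone_wd.
transitivity (g (dec (fun u v => (-1) ^+ size u *: shw (rev u) v) w)).
  rewrite /dec linear_sum; apply: eq_bigr => i _ /=.
  by rewrite antipode_wd -shmul_wd -shmulZl -rmorphM.
case: w => [|x w]; first by rewrite dec0 scale1r shw0l rmorph1.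
rewrite dec_cons scale1r shw0l.
suff -> : dec (fun u v => (-1) ^+ size (x :: u) *: shw (rev (x :: u)) v) w =
    - wd (x :: w) by rewrite subrr linear0.
rewrite -lcons_wd -(shw0l w) -dec_antipode /dec -sumrN.
apply: eq_bigr => i _ /=.
by rewrite exprS mulN1r scaleNr rev_cons -cats1.
Qed.

Lemma ginvK : involutive ginv.
Proof. by move=> g; apply: Gamma_ext => w /=; rewrite antipodeK. Qed.

Lemma gmulgV : right_inverse gone ginv gmul.
Proof. by move=> g; rewrite -{1}[g]ginvK gmulVg. Qed.

HB.instance Definition _ := gen_eqMixin (Gamma A).
HB.instance Definition _ := gen_choiceMixin (Gamma A).
HB.instance Definition _ := isGroup.Build (Gamma A)
  gmulA gmul1g gmulg1 gmulVg gmulgV.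

End Group.

Lemma dec_rcons (V : lmodType rat) (B : word -> word -> V) w x :
  dec B (rcons w x) = B (rcons w x) [::] + dec (fun u v => B u (rcons v x)) w.
Proof.
rewrite /dec size_rcons big_ord_recr /= take_oversize ?size_rcons //.
rewrite drop_oversize ?size_rcons // addrC; congr +%R.
apply: eq_bigr => i _ /=; have le_i : (i <= size w)%N by rewrite -ltnS.
by rewrite drop_rcons // -cats1 takel_cat.
Qed.

Section AntiAutomorphisms.
Variable A : comAlgType rat.
Implicit Types g h : Gamma A.

Lemma convol_concat (f g : shalg -> A) p t : lspan t -> linear f -> linear g ->
  convol f g (concat p t) =
  f (concat p t) * g 1 + convol f (fun q => g (concat q t)) p.
Proof.
move=> lt lf lg.
move: p; apply: (@linear_eq_wd _ (fun p => convol f g (concat p t))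
  (fun p => f (concat p t) * g 1 + convol f (fun q => g (concat q t)) p)).
- by move=> c p p'; rewrite concat_linearl linearP.
- by move=> c p p'; rewrite concat_linearl lf linearP mulrDl -scalerAl scalerDDA.
move=> w; rewrite convol_wd; apply: (@lspan_eq _
  (fun t => convol f g (concat (wd w) t))
  (fun t => f (concat (wd w) t) * g 1 +
    dec (fun u v => f (wd u) * g (concat (wd v) t)) w) _ lt).
- by move=> c p p'; rewrite concat_linearr linearP.
- move=> c p p'; rewrite concat_linearr lf mulrDl -scalerAl -scalerDDA.
  congr +%R; rewrite /dec scaler_sumr -big_split; apply: eq_bigr => i _ /=.
  by rewrite concat_linearr lg mulrDr -scalerAr.
move=> x; rewrite concat_wd cats1 convol_wd dec_rcons; congr +%R.
by apply: eq_dec => u v; rewrite concat_wd cats1.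
Qed.

Lemma convol_antiext s (f g : shalg -> A) w : (forall x, lspan (s x)) ->
  linear f -> linear g ->
  convol f g (antiext s (wd w)) =
  convol (fun p => g (antiext s p)) (fun p => f (antiext s p)) (wd w).
Proof.
move=> ls; rewrite convol_wd antiext_wd.
elim: w f g => [|x w IH] f g lf lg.
  by rewrite convol_wd !dec0 antiext_wd mulrC.
rewrite /= convol_concat // IH //; last first.
  by move=> c p p'; rewrite concat_linearl lg.
rewrite dec_cons antiext1 !antiext_wd mulrC; congr +%R.
by apply: eq_dec => u v; rewrite !antiext_wd.
Qed.

Definition gsigma g : Gamma A := g \o sigmaH.
Definition gtau g : Gamma A := g \o tauH.

Lemma gsigmaM g h : gsigma (g * h)%g = (gsigma h * gsigma g)%g.
Proof.
apply: Gamma_ext => w.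
by apply: convol_antiext; [exact: sigma_lspan|exact: linearP|exact: linearP].
Qed.

Lemma gtauM g h : gtau (g * h)%g = (gtau h * gtau g)%g.
Proof.
apply: Gamma_ext => w.
by apply: convol_antiext; [exact: tau_lspan|exact: linearP|exact: linearP].
Qed.

Lemma Gamma_convol (g : Gamma A) (f f' : shalg -> shalg) p :
  g (convol f f' p) = convol (g \o f) (g \o f') p.
Proof.
move: p; apply: (@linear_eq_wd _ (g \o convol f f')) => [||w /=];
  [exact: linearP|exact: linearP|].
rewrite !convol_wd /dec linear_sum; apply: eq_bigr => i _ /=.
by rewrite rmorphM.
Qed.

End AntiAutomorphisms.

(** * The subvarieties of the group and their regular functions *)

(* A subvariety is given by its functor of points. *)
Definition subvar := forall A : comAlgType rat, set (Gamma A).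

Definition Kvar : subvar := fun A => [set g : Gamma A | gsigma g = (g^-1)%g].
Definition Pvar : subvar := fun A => [set g : Gamma A | gsigma g = g].
Definition Lvar : subvar := fun A => [set g : Gamma A | gtau g = (g^-1)%g].
Definition Qvar : subvar := fun A => [set (g * gtau g)%g | g in [set: Gamma A]].

Definition point_of (X : subvar) (A : comAlgType rat) := {g : Gamma A | X A g}.

(* The regular functions on a closed subvariety are the restrictions of the
   elements of [shalg], the coordinate ring of the whole group. *)
Record regfun (X : subvar) := Regfun {
  reg_fun :> forall A : comAlgType rat, point_of X A -> A;
  regularP : exists h : shalg,
    forall (A : comAlgType rat) (g : point_of X A), reg_fun g = sval g h
}.

Definition extends (X : subvar) (phi : regfun X) (h : shalg) : Prop :=
  forall (A : comAlgType rat) (g : point_of X A), phi A g = sval g h.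

Definition right_invariant (Y : subvar) (h : shalg) : Prop :=
  forall (A : comAlgType rat) (g k : Gamma A), Y A k -> (g * k)%g h = g h.

Lemma Pvar_sqr (A : comAlgType rat) (p : Gamma A) :
  Pvar p -> Pvar (p * p)%g.
Proof. by rewrite /Pvar /= => e; rewrite gsigmaM e. Qed.

Definition Psqr (A : comAlgType rat) (p : point_of Pvar A) : point_of Pvar A :=
  exist _ (sval p * sval p)%g (Pvar_sqr (svalP p)).

Lemma Qvar_nabla (A : comAlgType rat) (q : Gamma A) : Qvar (q * gtau q)%g.
Proof. by exists q. Qed.

Definition Qnabla (A : comAlgType rat) (q : point_of Qvar A) : point_of Qvar A :=
  exist _ (sval q * gtau (sval q))%g (Qvar_nabla (sval q)).

Lemma square_regular (phi : regfun Pvar) : exists h : shalg,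
  forall (A : comAlgType rat) (p : point_of Pvar A), phi A (Psqr p) = sval p h.
Proof.
have [h hE] := regularP phi; exists (convol idfun idfun h) => A p.
by rewrite hE Gamma_convol.
Qed.

Lemma nabla_regular (psi : regfun Qvar) : exists h : shalg,
  forall (A : comAlgType rat) (q : point_of Qvar A), psi A (Qnabla q) = sval q h.
Proof.
have [h hE] := regularP psi; exists (convol idfun tauH h) => A q.
by rewrite hE Gamma_convol.
Qed.

Definition square_reg (phi : regfun Pvar) : regfun Pvar :=
  Regfun (square_regular phi).
Definition nabla_reg (psi : regfun Qvar) : regfun Qvar :=
  Regfun (nabla_regular psi).

(** * Polylogarithms and polyzeta values *)

Section Polylogarithms.
Variable R : realType.

(* [R[i]] as a numerical field, which gives it its metric topology. *)
Definition Cplx : numClosedFieldType := R[i].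
Implicit Types (z : Cplx) (t : seq nat).

(* The word [a b^t_1 ... a b^t_k]; these are exactly the words whose first
   letter is not [b]. *)
Definition abword t : word := flatten [seq la :: nseq i lb | i <- t].

(* The partial sum over 0 < n_1 < ... < n_k < N of
   n_1^-(1+t_1) ... n_k^-(1+t_k) z^n_k; it is 1 if [t] is empty. *)
Definition polysum t z (N : nat) : Cplx :=
  \sum_(n : (size t).-tuple 'I_N | path ltn 0%N [seq val i | i <- n])
    (\prod_(j < size t) (tnth n j)%:R ^- (nth 0%N t j).+1) *
    z ^+ last 0%N [seq val i | i <- n].

Definition polyli t z : Cplx := lim (polysum t z @ \oo).

Definition Omega : set Cplx :=
  [set z : Cplx | `|z| < 1 /\ ~ (complex.Im z = 0 /\ complex.Re z <= 0)].

(* The principal argument and logarithm: on [Omega], the imaginary part lies in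
   ]-pi, pi[, and [clog] is real on ]0, 1[. *)
Definition cabs z : R := complex.Re `|z|.
Definition carg z : R :=
  let t := acos (complex.Re z / cabs z) in
  if 0 <= complex.Im z then t else - t.
Definition clog z : Cplx := (ln (cabs z) +i* carg z)%C.

Definition alg_morphism (f : shalg -> Cplx) : Prop :=
  [/\ forall (c : rat) (p q : shalg), f (c *: p + q) = ratr c * f p + f q,
      f 1 = 1 & {morph f : p q / p * q}].

Definition is_polylog (F : shalg -> Cplx -> Cplx) : Prop :=
  [/\ forall h z, Omega z -> derivable (F h) z 1,
      forall z, Omega z -> alg_morphism (F^~ z),
      forall t z, Omega z -> F (wd (abword t)) z = polyli t z &
      forall z, Omega z -> F (wd [:: lb]) z = clog z].

(* [is_polylog] determines F on [Omega], and only the values on [Omega] are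
   used below. *)
Definition polylog : shalg -> Cplx -> Cplx :=
  xget (fun _ _ => 0) [set F | is_polylog F].

(* The value at w of the continuous extension of f, defined on [Omega]. *)
Definition cext (f : Cplx -> Cplx) (w : Cplx) : Cplx :=
  lim (f z @[z --> within Omega (nbhs w)]).

(* The words whose first letter is not [b] and whose last letter is not [a]. *)
Definition admissible (w : word) : bool :=
  (head la w != lb) && (last lb w != la).

Definition is_zeta (c : Cplx) (f : shalg -> Cplx) : Prop :=
  [/\ alg_morphism f,
      forall t, admissible (abword t) -> f (wd (abword t)) = polyli t 1,
      f (wd [:: lb]) = 0 & f (wd [:: la]) = c].

(* The regularised polyzeta values with value [c] at the word [a]. *)
Definition zeta (c : Cplx) : shalg -> Cplx :=
  xget (fun _ => 0) [set f | is_zeta c f].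

(* By [regularP] there is an extension; all give the same value. *)
Definition zeta_on (X : subvar) (c : Cplx) (phi : regfun X) : Cplx :=
  zeta c (xget 0 [set h | extends phi h]).

(* The right [Y]-invariant extension of [phi] exists and is unique when the
   multiplication X * Y -> Gamma is an isomorphism, as for (P, K) and (Q, L). *)
Definition polylog_on (X Y : subvar) (phi : regfun X) : Cplx -> Cplx :=
  polylog (xget 0 [set h | extends phi h /\ right_invariant Y h]).

Definition rho : Cplx := (cos (pi / 3) +i* sin (pi / 3))%C.
Definition ipi : Cplx := (0 +i* pi)%C.

End Polylogarithms.

(* Main.v *)
(** Write L(z) for the point of Gamma over C whose coordinates are the L_w(z).
   Both L(1 - z) sigma(L(z)) on ]0,1[ and L((1 - z)^-1) tau(L(z)) on the part of
   the disc where |1 - z| > 1 have zero derivative, because sigma and tau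
   transform the forms dz/(1 - z) and dz/z as z |-> 1 - z and z |-> (1 - z)^-1
   do.  As z tends to 0 the coordinates indexed by the words of W^++ tend to the
   polyzeta values, while at the fixed points 1/2 and rho^(+-1) the constants
   are g sigma(g) and g tau(g) with g = L(1/2) and g = L(rho^(+-1)).  Their
   coordinates at a and b are the prescribed ones, so they are zeta and
   zeta^(+-).  Finally g = k s(k) l with s(l) = l^-1, for s = sigma or tau, gives
   h(g) = h(k s(k)) = phi((k s(k))^2) = phi(g s(g)) for the invariant extension
   h of square phi (with q tau(q) instead of p^2 for tau). *)
Require Import Defs.
From HB Require Import structures.
From mathcomp Require Import all_boot all_order all_algebra.
From mathcomp Require Import complex ring lra zify.
From mathcomp Require Import all_classical all_reals all_analysis.

Set Implicit Arguments.
Unset Strict Implicit.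
Unset Printing Implicit Defensive.

Import Order.TTheory GRing.Theory Num.Theory.
Import numFieldNormedType.Exports.

Local Open Scope classical_set_scope.
Local Open Scope ring_scope.

(** The factorisation [g = k * s(k) * l] is solved for complex points degree by degree: since the
    shuffle product is graded by word length, dividing a leading term by 4 or by 3 is a dilation, at
    the price of n-th roots. On the analytic side the obstacle is the limit at 0, where the
    coordinates of L(m(z)) may blow up as m(z) tends to 1. For a word not ending in a, every
    nonempty right part of a cut ends in b, and both sigma(b) and tau(b) are multiples of a; the
    image of that part starts with a and is O(|z|), which outweighs the logarithmic growth of the
    left factor. The convergence of the nested sums comes out of the relation on ]0,1[: their terms
    are nonnegative, so the existence of the limit at 1 forces it. The values at rho^(+-1) then
    reuse it. Since rho^(+-1) lie on the circle of convergence, L is defined there as a limit, which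
    exists by Lipschitz bounds. The constant is carried from rho^(+-1) to 0 along a horizontal
    segment followed by a ray, both inside the domain |z| < 1 < |1 - z|. *)

(** * Decomposition of the points of Gamma *)

(* [K] as an algebra over [rat], the scalars acting through [ratr]. *)
Definition ratalg (K : numClosedFieldType) : Type := K.
HB.instance Definition _ K := GRing.Field.on (ratalg K).

Section RatAlgebra.
Variable K : numClosedFieldType.
Definition rscale (q : rat) (z : ratalg K) : ratalg K := (ratr q : K) * (z : K).
Fact rscaleA p q z : rscale p (rscale q z) = rscale (p * q) z.
Proof. by rewrite /rscale mulrA rmorphM. Qed.
Fact rscale1 : left_id 1 rscale.
Proof. by move=> z; rewrite /rscale rmorph1 mul1r. Qed.
Fact rscaleDr : right_distributive rscale +%R.
Proof. by move=> p y z; rewrite /rscale; exact: mulrDr. Qed.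
Fact rscaleDl z : {morph rscale^~ z : p q / p + q}.
Proof. by move=> p q; rewrite /rscale rmorphD; exact: mulrDl. Qed.
HB.instance Definition _ := GRing.Zmodule_isLmodule.Build rat (ratalg K)
  rscaleA rscale1 rscaleDr rscaleDl.
Fact rscaleAl q (y z : ratalg K) : q *: (y * z) = (q *: y) * z.
Proof. exact: mulrA. Qed.
HB.instance Definition _ :=
  GRing.Lmodule_isLalgebra.Build rat (ratalg K) rscaleAl.
HB.instance Definition _ := GRing.Lalgebra_isComAlgebra.Build rat (ratalg K).
End RatAlgebra.

Lemma ratalg_scaleE (K : numClosedFieldType) q (z : ratalg K) :
  q *: z = (ratr q : K) * (z : K).
Proof. by []. Qed.

Section GammaOf.
Variable A : comAlgType rat.
Section Build.
Variables (f : shalg -> A) (fl : linear f) (f1 : f 1 = 1) (fM : {morph f : p q / p * q}).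
Definition gamma_fun of linear f & f 1 = 1 & {morph f : p q / p * q} := f.
HB.instance Definition _ := GRing.isLinear.Build rat shalg A *:%R (gamma_fun fl f1 fM) fl.
HB.instance Definition _ :=
  GRing.isMonoidMorphism.Build shalg A (gamma_fun fl f1 fM) (f1, fM).
Definition gamma_of : Gamma A := gamma_fun fl f1 fM.
End Build.

(** Only the shuffle relations between words have to be checked. The points obtained by gluing,
    dilation, exponentials, power series and passage to the limit are all produced this way. *)
Lemma gamma_word (f : word -> A) : f [::] = 1 ->
  (forall u v, lext f (shw u v) = f u * f v) ->
  exists g : Gamma A, forall w, g (wd w) = f w.
Proof.
move=> f1 fM.
have l1 : lext f 1 = 1 by rewrite [LHS]lext_wd.
have lM : {morph lext f : p q / p * q}.
  apply: (@bilinear_eq_wd _ (fun p q => lext f (shmul p q))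
    (fun p q => lext f p * lext f q)).
  - by move=> q c p p'; rewrite shmul_linearl linearP.
  - by move=> p c q q'; rewrite shmul_linearr linearP.
  - by move=> q c p p'; rewrite linearP mulrDl scalerAl.
  - by move=> p c q q'; rewrite linearP mulrDr scalerAr.
  by move=> u v; rewrite shmul_wd fM !lext_wd.
exists (gamma_of (@lext_is_linear _ f) l1 lM) => w.
exact: lext_wd.
Qed.
End GammaOf.

Lemma size_shuffles u v w : w \in shuffles u v -> size w = (size u + size v)%N.
Proof.
elim: u v w => [|x u IHu] v w /=; first by rewrite inE => /eqP ->.
elim: v w => [|y v IHv] w /=; first by rewrite inE addn0 => /eqP ->.
by rewrite mem_cat => /orP[] /mapP[w' /[swap] -> /=] => [/IHu|/IHv] -> /=;
  rewrite ?addnS ?addSn.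
Qed.

Lemma lext_shw (V : lmodType rat) (f : word -> V) u v :
  lext f (shw u v) = \sum_(w <- shuffles u v) f w.
Proof.
by rewrite /shw linear_sum; apply: eq_bigr => w _; exact: lext_wd.
Qed.

(** * Congruence of points in low degree *)

Section Truncation.
Variable A : comAlgType rat.
Implicit Types (g h e : Gamma A) (p : shalg).

(** Congruence for the filtration of the group by word length; products, inverses and the
    anti-automorphisms respect it. *)
Definition agree n g h := forall w, (size w < n)%N -> g (wd w) = h (wd w).

(* [p] is a combination of words of size [n]. *)
Definition homog n p := forall f g : shalg -> A, linear f -> linear g ->
  (forall w, size w = n -> f (wd w) = g (wd w)) -> f p = g p.

Lemma homog_wd w : homog (size w) (wd w).
Proof. by move=> f g _ _; apply. Qed.

Lemma homog_concat n p t : lspan t -> homog n p -> homog n.+1 (concat p t).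
Proof.
move=> lt hp f g lf lg e.
apply: (hp (fun p => f (concat p t)) (fun p => g (concat p t))).
- by move=> c q q'; rewrite concat_linearl lf.
- by move=> c q q'; rewrite concat_linearl lg.
move=> w sw; apply: (lspan_eq (f := fun t => f (concat (wd w) t))
  (g := fun t => g (concat (wd w) t)) lt).
- by move=> c q q'; rewrite concat_linearr lf.
- by move=> c q q'; rewrite concat_linearr lg.
by move=> x; rewrite concat_wd; apply: e; rewrite size_cat sw addn1.
Qed.

Lemma homog_antiext s w : (forall x, lspan (s x)) ->
  homog (size w) (antiext s (wd w)).
Proof.
move=> ls; rewrite antiext_wd; elim: w => [|x w IH]; first exact: homog_wd.
exact: homog_concat.
Qed.

Lemma antiext_homog s n p : (forall x, lspan (s x)) -> homog n p ->
  homog n (antiext s p).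
Proof.
move=> ls hp f g lf lg e.
apply: (hp (fun p => f (antiext s p)) (fun p => g (antiext s p))).
- by move=> c q q'; rewrite linearP lf.
- by move=> c q q'; rewrite linearP lg.
by move=> w sw; apply: homog_antiext; rewrite ?sw.
Qed.

Lemma agree_homog n m g h p : agree n g h -> homog m p -> (m < n)%N -> g p = h p.
Proof.
move=> a hp lt; apply: hp; [exact: linearP|exact: linearP|].
by move=> w sw; apply: a; rewrite sw.
Qed.

Lemma agree_trans n g h e : agree n g h -> agree n h e -> agree n g e.
Proof. by move=> a b w sw; rewrite a ?b. Qed.

Lemma agreeW n m g h : (m <= n)%N -> agree n g h -> agree m g h.
Proof. by move=> mn a w sw; apply: a; apply: leq_trans mn. Qed.

Lemma agreeM n g h g' h' : agree n g g' -> agree n h h' ->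
  agree n (g * h)%g (g' * h')%g.
Proof.
move=> a b w sw.
rewrite [LHS]convol_wd [RHS]convol_wd /dec; apply: eq_bigr => i _.
by rewrite a ?b // ?size_drop ?size_take_min; lia.
Qed.

Lemma agreeV n g h : agree n g h -> agree n (g^-1)%g (h^-1)%g.
Proof.
move=> a w sw; rewrite -[LHS]/(g (antipode (wd w))) -[RHS]/(h (antipode (wd w))).
apply: (agree_homog a _ sw); apply: homog_antiext; exact: antipode_lspan.
Qed.

Lemma Gamma1 g : g (wd [::]) = 1. Proof. exact: (rmorph1 g). Qed.

Lemma one_wd w : (1%g : Gamma A) (wd w) = (w == [::])%:R.
Proof. exact: gone_wd. Qed.

(** In degree [n] the group law is additive in a factor trivial below degree [n]: every cut other
    than the two extreme ones leaves a nonempty right part of size less than [n], where [e]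
    vanishes. *)
Lemma agree1_mulr n g e p : (0 < n)%N -> agree n e 1%g -> homog n p ->
  (g * e)%g p = g p + e p.
Proof.
move=> n0 a hp; apply: (hp (g * e)%g (fun p => g p + e p)).
- exact: linearP.
- by move=> c q q'; rewrite !linearP /= scalerDDA.
move=> [|x w] sw; first by rewrite -sw in n0.
rewrite [LHS]convol_wd dec_cons Gamma1 mul1r addrC; congr (_ + _).
rewrite /dec big_ord_recr /= take_size drop_size Gamma1 mulr1.
rewrite big1 ?add0r // => i _; rewrite a ?one_wd; last first.
  by rewrite size_drop -sw /=; lia.
by rewrite -size_eq0 size_drop subn_eq0 leqNgt ltn_ord mulr0.
Qed.

Lemma agree1_mull n g e p : (0 < n)%N -> agree n e 1%g -> homog n p ->
  (e * g)%g p = e p + g p.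
Proof.
move=> n0 a hp; apply: (hp (e * g)%g (fun p => e p + g p)).
- exact: linearP.
- by move=> c q q'; rewrite !linearP /= scalerDDA.
move=> w sw.
have [w' [x ew]] : exists w' x, w = rcons w' x.
  by case/lastP: w sw n0 => [<- //|w' x] _ _; exists w', x.
rewrite ew in sw *; rewrite [LHS]convol_wd dec_rcons Gamma1 mulr1; congr (_ + _).
rewrite size_rcons in sw.
rewrite /dec big_ord_recl /= take0 drop0 Gamma1 mul1r.
rewrite big1 ?addr0 // => i _; rewrite a ?one_wd; last first.
  by rewrite size_take_min /= /bump /=; lia.
rewrite -size_eq0 size_take_min /bump /=.
have -> : (minn (1 + i) (size w') == 0)%N = false by case: i => i /=; lia.
by rewrite mul0r.
Qed.

Lemma agree1V n e p : (0 < n)%N -> agree n e 1%g -> homog n p ->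
  (e^-1)%g p = - e p.
Proof.
move=> n0 a hp; apply/eqP; rewrite -addr_eq0 addrC.
rewrite -(agree1_mull _ n0 a hp) mulgV; apply/eqP.
apply: (hp (1%g : Gamma A) (fun=> 0)); first exact: linearP.
  by move=> c q q'; rewrite scaler0 addr0.
move=> w sw; rewrite one_wd; case: w sw => // s; by rewrite -s in n0.
Qed.

(** The product [e * g] is also [g] times the conjugate of [e], and both readings are additive in
    degree [n]. *)
Lemma agree1_conj n g e p : (0 < n)%N -> agree n e 1%g -> homog n p ->
  (g^-1 * e * g)%g p = e p.
Proof.
move=> n0 a hp.
have a' : agree n (g^-1 * e * g)%g 1%g.
  have -> : (1 = g^-1 * 1 * g :> Gamma A)%g by rewrite mulg1 mulVg.
  by apply: agreeM => //; apply: agreeM.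
have := agree1_mull g n0 a hp; rewrite addrC.
have -> : (e * g = g * (g^-1 * e * g))%g by rewrite !mulgA mulgV mul1g.
by rewrite (agree1_mulr _ n0 a' hp) => /addrI.
Qed.

(** Completeness for the length filtration. The coordinate at [w] is read off at stage [size w + 1];
    a shuffle relation involves words of bounded size, so it can be checked at a common stage. *)
Lemma Gamma_glue (k : nat -> Gamma A) :
  (forall n, agree n (k n.+1) (k n)) -> exists g, forall n, agree n g (k n).
Proof.
move=> a.
have a' n m : (n <= m)%N -> agree n (k m) (k n).
  move=> /subnKC <-; elim: (m - n)%N => [|d IH]; first by rewrite addn0.
  rewrite addnS; apply: agree_trans IH; apply: agreeW (a _); exact: leq_addr.
have [|u v|g hg] := @gamma_word A (fun w => k (size w).+1 (wd w)).
- exact: Gamma1.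
- rewrite lext_shw.
  pose N := (size u + size v).+1.
  rewrite -(a' _ N _ u) ?ltnS ?leq_addr // -(a' _ N _ v) ?ltnS ?leq_addl //.
  rewrite -rmorphM /= -[(wd u * wd v)]/(shmul (wd u) (wd v)) shmul_wd /shw.
  rewrite linear_sum /= !big_seq; apply: eq_bigr => w /size_shuffles sw.
  by rewrite sw.
exists g => n w sw; rewrite hg; symmetry; exact: a'.
Qed.

End Truncation.

(** * Factorisation by successive approximation *)

Section Decomposition.
Variables (A : comAlgType rat) (s : letter -> shalg).
Hypothesis ls : forall x, lspan (s x).
Variable ga : Gamma A -> Gamma A.
Hypothesis gaE : forall g p, ga g p = g (antiext s p).
Implicit Types (g k l e c : Gamma A).

Lemma gaM g h : ga (g * h)%g = (ga h * ga g)%g.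
Proof.
apply: Gamma_ext => w; rewrite gaE.
rewrite [LHS](convol_antiext _ ls); [|exact: linearP|exact: linearP].
rewrite convol_wd [RHS]convol_wd; apply: eq_dec => u v.
by rewrite !gaE.
Qed.

Lemma ga1 : ga 1%g = 1%g.
Proof.
have := gaM 1%g 1%g; rewrite mulg1 => /(congr1 (fun x => (ga 1)^-1 * x)%g).
by rewrite mulgA mulVg mul1g.
Qed.

Lemma agree_ga n g h : agree n g h -> agree n (ga g) (ga h).
Proof.
by move=> a w sw; rewrite !gaE; apply: (agree_homog a _ sw); exact: homog_antiext.
Qed.

(* In degree [n] the correction [c] of [k] changes [l * ga l] by -(1 + s)^2 c. *)
Hypothesis solve_lead : forall n g, (0 < n)%N -> agree n (g * ga g)%g 1%g ->
  exists c, agree n c 1%g /\ forall w, size w = n -> (g * ga g)%g (wd w) =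
    c (wd w) + ga c (wd w) *+ 2 + ga (ga c) (wd w).

Definition remainder g k := ((k * ga k)^-1 * g)%g.
(** Trivial exactly when [l = remainder g k] satisfies [ga l = l^-1], while [g = k * ga k * l] holds
    by construction. *)
Definition defect g k := (remainder g k * ga (remainder g k))%g.

(** A Newton step. Replacing [k] by [k * c] multiplies the remainder [l] on the left by a conjugate
    [x] of [(c * ga c)^-1], so the defect becomes [x * (l * ga l) * ga x]; [solve_lead] supplies the
    [c] that cancels the leading part. *)
Lemma improve n g k : agree n (defect g k) 1%g ->
  exists k', agree n k' k /\ agree n.+1 (defect g k') 1%g.
Proof.
case: n => [|n] a.
  (* Degree 0 is automatic, every point being 1 at the empty word. *)
  exists k; split=> // w; rewrite ltnS leqn0 size_eq0 => /eqP ->.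
  by rewrite !Gamma1.
have [c [ac hc]] := solve_lead (ltn0Sn n) a.
exists (k * c)%g; split.
  by rewrite -[k in agree _ _ k]mulg1; apply: agreeM.
set l := remainder g k in a hc.
pose z := ((c * ga c)^-1)%g; pose y := ga k; pose x := (y^-1 * z * y)%g.
have rE : remainder g (k * c)%g = (x * l)%g.
  rewrite /remainder /l /x /z /y /remainder gaM !invgM !mulgA.
  by rewrite mulgK.
have -> : defect g (k * c)%g = (x * (l * ga l) * ga x)%g.
  by rewrite /defect rE gaM !mulgA.
have agac : agree n.+1 (ga c) 1%g by rewrite -ga1; exact: agree_ga.
have acc : agree n.+1 (c * ga c)%g 1%g.
  by rewrite -[X in agree _ _ X]mulg1; apply: agreeM.
have inv1 : (1^-1 = 1 :> Gamma A)%g by rewrite -[LHS]mulg1 mulVg.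
have az : agree n.+1 z 1%g by rewrite -inv1; exact: agreeV.
have ax : agree n.+1 x 1%g.
  have -> : (1 = y^-1 * 1 * y :> Gamma A)%g by rewrite mulg1 mulVg.
  by apply: agreeM => //; apply: agreeM.
have agax : agree n.+1 (ga x) 1%g by rewrite -ga1; exact: agree_ga.
have axe : agree n.+1 (x * (l * ga l))%g 1%g.
  by rewrite -[X in agree _ _ X]mulg1; apply: agreeM.
move=> w; rewrite ltnS leq_eqVlt => /orP[/eqP sw|sw]; last first.
  rewrite (agreeM axe agax) ?mulg1 //.
have hw := homog_wd (A := A) (w := w); rewrite sw in hw.
have hsw := antiext_homog ls hw.
rewrite (agree1_mull _ _ axe) // (agree1_mull _ _ ax) // hc // !gaE.
rewrite one_wd; have -> : (w == [::]) = false by case: w sw {hw hsw}.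
(* The conjugation by [ga k] disappears here, leading parts being conjugation invariant. *)
have xE p : homog A n.+1 p -> x p = - (c p + c (antiext s p)).
  move=> hp; rewrite /x (agree1_conj _ _ az) // /z (agree1V _ acc) //.
  by rewrite (agree1_mull _ _ ac) // gaE.
rewrite !xE // mulr2n.
set u := c (wd w); set v := c (antiext s _); set t := c (antiext s _).
have -> : - (u + v) + (u + (v + v) + t) + - (v + t) =
  - (u + v) + (u + v + (v + t)) + - (v + t) by rewrite !addrA.
by rewrite addKr subrr.
Qed.

(** Successive corrections agree in growing degree, so they glue to a point [K] whose defect is
    trivial in every degree. *)
Lemma anti_decomposition g : exists k l, g = (k * ga k * l)%g /\ ga l = (l^-1)%g.
Proof.
(* The hypothesis sits under the existential so that [choice] applies to all pairs; where it fails,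
   the value is arbitrary. *)
have step (nk : nat * Gamma A) : exists k', agree nk.1 (defect g nk.2) 1%g ->
    agree nk.1 k' nk.2 /\ agree nk.1.+1 (defect g k') 1%g.
  have [a|na] := pselect (agree nk.1 (defect g nk.2) 1%g).
    by have [k' h] := improve a; exists k'.
  by exists 1%g.
have [f hf] := choice step.
pose k := fix k n := if n is m.+1 then f (m, k m) else 1%g.
have dk n : agree n (defect g (k n)) 1%g.
  elim: n => [//|n IH]; exact: (hf (n, k n) IH).2.
have [K hK] : exists K, forall n, agree n K (k n).
  apply: Gamma_glue => n; exact: (hf (n, k n) (dk n)).1.
have aR n : agree n (remainder g K) (remainder g (k n)).
  by apply: agreeM => //; apply: agreeV; apply: agreeM => //; exact: agree_ga.
exists K, (remainder g K); split; first by rewrite mulgA mulgV mul1g.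
apply: (@mulgI _ (remainder g K)); rewrite mulgV.
apply: Gamma_ext => w; pose n := (size w).+1.
rewrite -(dk n w) //; apply: agreeM => //; exact: agree_ga.
Qed.

End Decomposition.

(** * The substitutions sigma and tau on words *)

Lemma concat1p p : concat (wd [::]) p = p.
Proof.
move: p; apply: (@linear_eq_wd _ (concat (wd [::])) id) => [||w] //.
  exact: concat_linearr.
by rewrite concat_wd.
Qed.

Lemma concatp1 p : concat p (wd [::]) = p.
Proof.
move: p; apply: (@linear_eq_wd _ (concat^~ (wd [::])) id) => [||w] //.
  exact: concat_linearl.
by rewrite concat_wd cats0.
Qed.

Lemma concatA p q r : concat p (concat q r) = concat (concat p q) r.
Proof.
move: p q; apply: (@bilinear_eq_wd _ (fun p q => concat p (concat q r))
  (fun p q => concat (concat p q) r)).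
- by move=> q; exact: concat_linearl.
- by move=> p c q q'; rewrite concat_linearl concat_linearr.
- by move=> q c p p'; rewrite !concat_linearl.
- by move=> p c q q'; rewrite concat_linearr concat_linearl.
move=> u v; move: r; apply: (@linear_eq_wd _
  (fun r => concat (wd u) (concat (wd v) r))
  (fun r => concat (concat (wd u) (wd v)) r)).
- by move=> c p p'; rewrite !concat_linearr.
- by move=> c p p'; rewrite concat_linearr.
by move=> w; rewrite !concat_wd catA.
Qed.

Lemma antiext_concat s p q :
  antiext s (concat p q) = concat (antiext s q) (antiext s p).
Proof.
move: p q; apply: (@bilinear_eq_wd _ (fun p q => antiext s (concat p q))
  (fun p q => concat (antiext s q) (antiext s p))).
- by move=> q c p p'; rewrite concat_linearl linearP.
- by move=> p c q q'; rewrite concat_linearr linearP.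
- by move=> q c p p'; rewrite linearP concat_linearr.
- by move=> p c q q'; rewrite linearP concat_linearl.
move=> u v; rewrite concat_wd !antiext_wd.
elim: u => [|x u IH]; last by rewrite /= IH concatA.
by rewrite /= concatp1.
Qed.

Lemma sigmaH_wd w : sigmaH (wd w) = wd (rev (map negb w)).
Proof.
rewrite [LHS]antiext_wd; elim: w => //= x w ->.
by rewrite concat_wd rev_cons cats1.
Qed.

Lemma sigmaHK : involutive sigmaH.
Proof.
apply: (@linear_eq_wd _ (sigmaH \o sigmaH) id) => [||w /=] //.
  exact: linearP.
by rewrite !sigmaH_wd -map_rev revK -map_comp map_id_in // => x _; exact: negbK.
Qed.

Lemma tauH_letter x : tauH (wd [:: x]) = tau_letter x.
Proof. by rewrite [LHS]antiext_wd /= concat1p. Qed.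

Lemma tauH3_letter x : tauH (tauH (tauH (wd [:: x]))) = - wd [:: x].
Proof.
rewrite tauH_letter; case: x; rewrite /tau_letter /=.
  rewrite linearD /= !tauH_letter /tau_letter /=.
  rewrite -[wd [:: la] + wd [:: lb] - wd [:: la]]addrAC subrr add0r.
  by rewrite tauH_letter.
rewrite linearN /= tauH_letter /tau_letter /= linearN linearD /= !tauH_letter.
by rewrite /tau_letter /= addrAC subrr add0r.
Qed.

(** Both sides reverse concatenations, the cube of an anti-morphism being one, so the letters
    decide. *)
Lemma tauH3 p : tauH (tauH (tauH p)) = antipode p.
Proof.
move: p; apply: (@linear_eq_wd _ (fun p => tauH (tauH (tauH p))) antipode).
- by move=> c p q; rewrite !linearP.
- exact: linearP.
have tauH1 : tauH (wd [::]) = wd [::] by exact: antiext_wd.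
have tauH_concat q r : tauH (concat q r) = concat (tauH r) (tauH q).
  exact: antiext_concat.
have antipode_concat q r : antipode (concat q r) = concat (antipode r) (antipode q).
  exact: antiext_concat.
elim=> [|x w IH]; first by rewrite antipode_wd scale1r !tauH1.
have -> : wd (x :: w) = concat (wd [:: x]) (wd w) by rewrite concat_wd.
rewrite antipode_concat.
rewrite tauH_concat.
rewrite [tauH (concat _ _)]tauH_concat.
rewrite [tauH (concat _ _)]tauH_concat.
apply: (congr2 concat); first exact: IH.
by rewrite tauH3_letter [antipode (wd [:: x])]antipode_wd expr1 scaleN1r.
Qed.

(** With [l = g], [x = gtau g], [y = gtau (gtau g)] and [gtau y = g^-1], this relates
    [e = g * gtau g] to its images under [gtau]. *)
Lemma group_norm (G : groupType) (x y l : G) :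
  (l * x * (y * x)^-1 * (y * l^-1) = 1)%g.
Proof. by rewrite invgM !mulgA mulgK mulgVK mulgV. Qed.

(** * The factorisations attached to sigma and tau *)

Section Decompositions.
Variable K : numClosedFieldType.
Notation A := (ratalg K).
Implicit Types (g k l e c : Gamma A).

Lemma dilation (lam : A) g :
  exists c, forall w, c (wd w) = lam ^+ size w * g (wd w).
Proof.
apply: gamma_word => [|u v]; first by rewrite expr0 mul1r; exact: rmorph1.
rewrite lext_shw mulrACA -exprD -rmorphM /=.
rewrite -[wd u * wd v]/(shmul (wd u) (wd v)) shmul_wd /shw linear_sum mulr_sumr /=.
rewrite !big_seq; apply: eq_bigr => w /size_shuffles ->; done.
Qed.

(** The group counterpart of a scalar multiple in the Lie algebra: dilating by an n-th root of [t],
    which exists in an algebraically closed field, scales the leading part by [t]. *)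
Lemma dilation_lead (t : A) n e : (0 < n)%N -> agree n e 1%g ->
  exists c, agree n c 1%g /\ forall p, homog A n p -> c p = t * e p.
Proof.
move=> n0 a; pose lam : A := (n.-root (t : K)).
have lamE : lam ^+ n = t by exact: rootCK.
have [c hc] := dilation lam e; exists c; split.
  move=> w sw; rewrite hc a // one_wd.
  by case: w sw => [|x w] _ /=; rewrite ?expr0 ?mulr1 ?mulr0.
move=> p hp; apply: (hp c (fun p => t * e p)); first exact: linearP.
  by move=> r q q'; rewrite linearP mulrDr scalerAr.
by move=> w sw; rewrite hc sw lamE.
Qed.

Lemma gsigmaE g p : gsigma g p = g (sigmaH p). Proof. by []. Qed.
Lemma gtauE g p : gtau g p = g (tauH p). Proof. by []. Qed.

Lemma gsigmaK g : gsigma (gsigma g) = g.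
Proof. by apply: Gamma_ext => w; rewrite !gsigmaE sigmaHK. Qed.

Lemma gtau3 g : gtau (gtau (gtau g)) = (g^-1)%g.
Proof. by apply: Gamma_ext => w; rewrite !gtauE tauH3. Qed.

Lemma sigma_decomposition g :
  exists k l, g = (k * gsigma k * l)%g /\ gsigma l = (l^-1)%g.
Proof.
apply: (anti_decomposition sigma_lspan gsigmaE) => n {}g n0.
set e := (g * gsigma g)%g => a.
have se : gsigma e = e by rewrite /e gsigmaM gsigmaK.
(* The leading part of [e] is fixed by sigma, so (1 + s)^2 acts on it as 4. *)
have [c [ac hc]] := dilation_lead (4^-1 : A) n0 a.
exists c; split=> // w sw.
have hw := homog_wd (A := A) (w := w); rewrite sw in hw.
have hsw := antiext_homog sigma_lspan hw.
have cE p : homog A n p -> gsigma c p = c p.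
  move=> hp; have hsp : homog A n (sigmaH p) by exact: antiext_homog sigma_lspan hp.
  by rewrite gsigmaE (hc _ hsp) (hc _ hp) -gsigmaE se.
have hsw' : homog A n (sigmaH (wd w)) by [].
rewrite (cE _ hw) gsigmaE (cE _ hsw') -gsigmaE (cE _ hw) (hc _ hw) mulr2n; set x := e _.
have n4 : (4 : A) != 0 by rewrite pnatr_eq0.
by field.
Qed.

Lemma tau_decomposition g :
  exists k l, g = (k * gtau k * l)%g /\ gtau l = (l^-1)%g.
Proof.
apply: (anti_decomposition tau_lspan gtauE) => n {}g n0.
set e := (g * gtau g)%g => a.
have ae2 : agree n (gtau (gtau e)) 1%g.
  rewrite -(ga1 tau_lspan gtauE); apply: (agree_ga tau_lspan gtauE).
  by rewrite -(ga1 tau_lspan gtauE); apply: (agree_ga tau_lspan gtauE).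
have ae1 : agree n (gtau e) 1%g.
  by rewrite -(ga1 tau_lspan gtauE); apply: (agree_ga tau_lspan gtauE).
have norm : (e * (gtau e)^-1 * gtau (gtau e) = 1)%g.
  by rewrite /e !gtauM gtau3; exact: group_norm.
have rel p : homog A n p -> e p - e (tauH p) + e (tauH (tauH p)) = 0.
  move=> hp.
  have i1 : (1^-1 = 1 :> Gamma A)%g by rewrite -[LHS]mulg1 mulVg.
  have aV : agree n ((gtau e)^-1)%g 1%g by rewrite -i1; exact: agreeV.
  have := agree1_mulr (e * (gtau e)^-1)%g n0 ae2 hp.
  rewrite norm (agree1_mulr _ n0 aV) // (agree1V n0 ae1) // => <-.
  apply: (hp (1%g : Gamma A) (fun=> 0)); first exact: linearP.
    by move=> c q q'; rewrite scaler0 addr0.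
  move=> w sw; rewrite one_wd; case: w sw => // s; by rewrite -s in n0.
(* On the leading part of [e], [rel] reads 1 - s + s^2 = 0. Hence s^3 = -1 and (1 + s)^2 = 3 s,
   whose inverse is - s^2 / 3. *)
have [c [ac hc]] := dilation_lead (- 3^-1 : A) n0 ae2.
exists c; split=> // w sw.
have hw := homog_wd (A := A) (w := w); rewrite sw in hw.
have hsw : homog A n (tauH (wd w)) by exact: antiext_homog tau_lspan hw.
have hssw : homog A n (tauH (tauH (wd w))) by exact: antiext_homog tau_lspan hsw.
rewrite !gtauE (hc _ hw) (hc _ hsw) (hc _ hssw).
rewrite !gtauE (tauH3 (tauH (wd w))) (tauH3 (wd w)).
have aE p : homog A n p -> e (antipode p) = - e p.
  by move=> hp; rewrite -(agree1V n0 a hp).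
rewrite (aE _ hw) (aE _ hsw); have := rel _ hw; rewrite -addrA => /eqP.
rewrite addr_eq0 opprD opprK => /eqP ->.
set y := e (tauH _); set z := e (tauH _).
have n3 : (3 : A) != 0 by rewrite pnatr_eq0.
rewrite -[LHS]mul1r -(mulfV n3) mulr2n.

by field.
Qed.

Lemma square_value (phi : regfun Pvar) hh h g : extends phi hh ->
  extends (square_reg phi) h -> right_invariant Kvar h ->
  g h = (g * gsigma g)%g hh.
Proof.
move=> ehh eh inv; have [k [l [-> sl]]] := sigma_decomposition g.
set q := (k * gsigma k)%g.
have sq : gsigma q = q by rewrite /q gsigmaM gsigmaK.
rewrite inv //; have -> : (q * l * gsigma (q * l) = q * q)%g.
  by rewrite gsigmaM sl sq mulgA mulgK.
have qP : Pvar q by [].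
rewrite -[q h](eh A (exist _ q qP)) /=.
exact: (ehh A (Psqr (exist _ q qP))).
Qed.

Lemma nabla_value (psi : regfun Qvar) hh h g : extends psi hh ->
  extends (nabla_reg psi) h -> right_invariant Lvar h ->
  g h = (g * gtau g)%g hh.
Proof.
move=> ehh eh inv; have [k [l [-> sl]]] := tau_decomposition g.
set q := (k * gtau k)%g.
rewrite inv //; have -> : (q * l * gtau (q * l) = q * gtau q)%g.
  by rewrite gtauM sl mulgA mulgK.
have qQ : Qvar q by exists k.
rewrite -[q h](eh A (exist _ q qQ)) /=.
exact: (ehh A (Qnabla (exist _ q qQ))).
Qed.

End Decompositions.

Lemma gmul_convol (B : comAlgType rat) (f f' : shalg -> shalg) (g : Gamma B)
    (k k' : Gamma B) : (forall p, k p = g (f p)) -> (forall p, k' p = g (f' p)) ->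
  forall p, g (convol f f' p) = (k * k')%g p.
Proof.
move=> kE kE' p; rewrite Gamma_convol; apply: eq_lext => w.
by apply: eq_dec => u v /=; rewrite kE kE'.
Qed.

(** The extension sends [g] to the value of [hh] at [g * gsigma g]: it is regular through the
    coproduct, right invariant because [k * gsigma k = 1] on K, and on P it is the value at [p * p].
    The same construction works for tau. *)
Lemma square_extension (phi : regfun Pvar) : exists h,
  extends (square_reg phi) h /\ right_invariant Kvar h.
Proof.
have [hh hhE] := regularP phi; exists (convol idfun sigmaH hh).
have E B (g : Gamma B) : g (convol idfun sigmaH hh) = (g * gsigma g)%g hh.
  exact: gmul_convol.
split=> [B p|B g k Kk]; rewrite !E; last first.
  by rewrite gsigmaM Kk mulgA mulgK.
by rewrite [LHS]hhE /=; have /= -> := svalP p.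
Qed.

Lemma nabla_extension (psi : regfun Qvar) : exists h,
  extends (nabla_reg psi) h /\ right_invariant Lvar h.
Proof.
have [hh hhE] := regularP psi; exists (convol idfun tauH hh).
have E B (g : Gamma B) : g (convol idfun tauH hh) = (g * gtau g)%g hh.
  exact: gmul_convol.
split=> [B q|B g k Lk]; rewrite !E; last first.
  by rewrite gtauM Lk mulgA mulgK.
exact: hhE.
Qed.

(** * Complex numbers and complex derivatives *)

(* The complex numbers over [R], kept abstract: [Cplx R] is transparent, and
   unification would unfold its topology. *)
Record complexes (R : realType) := Complexes {
  cfield :> numClosedFieldType;
  cof : {rmorphism R -> cfield};
  re : cfield -> R;
  im : cfield -> R;
  cof_le : forall r s, (cof r <= cof s) = (r <= s);
  re_cof : forall r s, re (cof r + 'i * cof s) = r;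
  im_cof : forall r s, im (cof r + 'i * cof s) = s;
  cofE : forall z, z = cof (re z) + 'i * cof (im z)
}.

Section ComplexNumbers.
Variables (R : realType) (C : complexes R).
Implicit Types (x y z w : C) (r : R).

Definition rC (r : R) : C := cof C r.
HB.instance Definition _ := GRing.RMorphism.on rC.
Definition ReC (z : C) : R := re z.
Definition ImC (z : C) : R := im z.
Definition nrm (z : C) : R := ReC `|z|.

Lemma ReC_rect r s : ReC (rC r + 'i * rC s) = r. Proof. exact: re_cof. Qed.
Lemma ImC_rect r s : ImC (rC r + 'i * rC s) = s. Proof. exact: im_cof. Qed.
Lemma C_split z : z = rC (ReC z) + 'i * rC (ImC z). Proof. exact: cofE. Qed.

Lemma rC_le r s : (rC r <= rC s) = (r <= s). Proof. exact: cof_le. Qed.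

Lemma rC_inj : injective rC. Proof. exact: fmorph_inj. Qed.

Lemma rC_lt r s : (rC r < rC s) = (r < s).
Proof. by rewrite !lt_def rC_le (inj_eq rC_inj). Qed.

Lemma rC_gt0 r : (0 < rC r) = (0 < r).
Proof. by rewrite -rC_lt rmorph0. Qed.

Lemma rC_real r : rC r \is Num.real.
Proof. by rewrite realE -(rmorph0 rC) !rC_le le_total. Qed.

Lemma ReC_is_additive : additive ReC.
Proof.
move=> z w; rewrite [z in LHS]C_split [w in LHS]C_split opprD addrACA -mulrBr.
by rewrite -!rmorphB ReC_rect.
Qed.
Lemma ImC_is_additive : additive ImC.
Proof.
move=> z w; rewrite [z in LHS]C_split [w in LHS]C_split opprD addrACA -mulrBr.
by rewrite -!rmorphB ImC_rect.
Qed.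
HB.instance Definition _ := GRing.isAdditive.Build C R ReC ReC_is_additive.
HB.instance Definition _ := GRing.isAdditive.Build C R ImC ImC_is_additive.

Lemma ReC_rC r : ReC (rC r) = r.
Proof. by rewrite -[rC r]addr0 -(mulr0 'i) -(rmorph0 rC) ReC_rect. Qed.
Lemma ImC_rC r : ImC (rC r) = 0.
Proof. by rewrite -[rC r]addr0 -(mulr0 'i) -(rmorph0 rC) ImC_rect. Qed.

Lemma nrm_sqrt z : `|z| = rC (Num.sqrt (ReC z ^+ 2 + ImC z ^+ 2)).
Proof.
set s := Num.sqrt _; have s0 : 0 <= s by exact: sqrtr_ge0.
apply/eqP; rewrite -(@eqrXn2 _ 2) //; last by rewrite -(rmorph0 rC) rC_le.
rewrite {1}[z]C_split normC2_rect ?rC_real // -!rmorphXn -rmorphD.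
by rewrite sqr_sqrtr // addr_ge0 ?sqr_ge0.
Qed.

Lemma nrmE z : `|z| = rC (nrm z).
Proof. by rewrite /nrm nrm_sqrt ReC_rC. Qed.

Lemma nrm_ge0 z : 0 <= nrm z.
Proof. by rewrite -rC_le -nrmE rmorph0 normr_ge0. Qed.

Lemma nrm_eq0 z : (nrm z == 0) = (z == 0).
Proof. by rewrite -(inj_eq rC_inj) -nrmE rmorph0 normr_eq0. Qed.

Lemma nrm_gt0 z : (0 < nrm z) = (z != 0).
Proof. by rewrite lt_def nrm_ge0 andbT nrm_eq0. Qed.

Lemma nrm0 : nrm 0 = 0. Proof. by apply/eqP; rewrite nrm_eq0. Qed.

Lemma nrmM x y : nrm (x * y) = nrm x * nrm y.
Proof. by apply: rC_inj; rewrite rmorphM /= -!nrmE normrM. Qed.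

Lemma nrm1 : nrm 1 = 1.
Proof. by apply: rC_inj; rewrite rmorph1 /= -nrmE normr1. Qed.

Lemma nrmX x n : nrm (x ^+ n) = nrm x ^+ n.
Proof. by apply: rC_inj; rewrite rmorphXn /= -!nrmE normrX. Qed.

Lemma nrmV x : nrm x^-1 = (nrm x)^-1.
Proof. by apply: rC_inj; rewrite fmorphV /= -!nrmE normfV. Qed.

Lemma nrmN x : nrm (- x) = nrm x.
Proof. by apply: rC_inj; rewrite -!nrmE normrN. Qed.

Lemma nrmB x y : nrm (x - y) = nrm (y - x).
Proof. by rewrite -nrmN opprB. Qed.

Lemma nrmD x y : nrm (x + y) <= nrm x + nrm y.
Proof. by rewrite -rC_le rmorphD /= -!nrmE ler_normD. Qed.

Lemma nrm_sum (I : Type) (s : seq I) (P : pred I) (F : I -> C) :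
  nrm (\sum_(i <- s | P i) F i) <= \sum_(i <- s | P i) nrm (F i).
Proof.
elim/big_rec2: _ => [|i a b _ h]; first by rewrite nrm0.
by apply: le_trans (nrmD _ _) _; rewrite lerD2l.
Qed.

Lemma nrm_sqr z : nrm z ^+ 2 = ReC z ^+ 2 + ImC z ^+ 2.
Proof.
by rewrite /nrm nrm_sqrt ReC_rC sqr_sqrtr // addr_ge0 ?sqr_ge0.
Qed.

Lemma nrm_rC r : nrm (rC r) = `|r|.
Proof.
by rewrite /nrm nrm_sqrt ReC_rC ImC_rC expr0n /= addr0 sqrtr_sqr ReC_rC.
Qed.

Lemma ReC_le z : `|ReC z| <= nrm z.
Proof.
rewrite -(@ler_pXn2r _ 2) ?nnegrE ?nrm_ge0 // nrm_sqr real_normK ?num_real //.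
by rewrite lerDl sqr_ge0.
Qed.

Lemma ImC_le z : `|ImC z| <= nrm z.
Proof.
rewrite -(@ler_pXn2r _ 2) ?nnegrE ?nrm_ge0 // nrm_sqr real_normK ?num_real //.
by rewrite lerDr sqr_ge0.
Qed.

Lemma nrm_le_ReIm z : nrm z <= `|ReC z| + `|ImC z|.
Proof.
rewrite -(@ler_pXn2r _ 2) ?nnegrE ?nrm_ge0 ?addr_ge0 // nrm_sqr.
by rewrite sqrrD !real_normK ?num_real // lerD2r lerDl mulrn_wge0 ?mulr_ge0.
Qed.

Lemma rectM (a b c d : R) : (rC a + 'i * rC b) * (rC c + 'i * rC d) =
  rC (a * c - b * d) + 'i * rC (a * d + b * c).
Proof.
rewrite rmorphB rmorphD !rmorphM /=.
move: (rC a) (rC b) (rC c) (rC d) => x y z w.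
have -> : (x + 'i * y) * (z + 'i * w) =
    x * z + 'i ^+ 2 * (y * w) + 'i * (x * w + y * z) by ring.
by rewrite sqrCi mulN1r.
Qed.

Lemma ReCM z w : ReC (z * w) = ReC z * ReC w - ImC z * ImC w.
Proof. by rewrite {1}[z]C_split {1}[w]C_split rectM ReC_rect. Qed.
Lemma ImCM z w : ImC (z * w) = ReC z * ImC w + ImC z * ReC w.
Proof. by rewrite {1}[z]C_split {1}[w]C_split rectM ImC_rect. Qed.

Lemma ReCM_rC z r : ReC (z * rC r) = ReC z * r.
Proof. by rewrite ReCM ReC_rC ImC_rC mulr0 subr0. Qed.
Lemma ImCM_rC z r : ImC (z * rC r) = ImC z * r.
Proof. by rewrite ImCM ReC_rC ImC_rC mulr0 add0r. Qed.

Lemma posC (e : C) : 0 < e -> e = rC (nrm e) /\ 0 < nrm e.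
Proof.
by move=> e0; rewrite -nrmE gtr0_norm // nrm_gt0 gt_eqF.
Qed.

Lemma cvgCP (T : Type) (F : set_system T) {FF : Filter F} (f : T -> C) (l : C) :
  f @ F --> l <-> forall e : R, 0 < e -> \forall x \near F, nrm (f x - l) < e.
Proof.
split=> [/cvgrPdist_lt h e e0|h].
  have := h (rC e); rewrite rC_gt0 => /(_ e0).
  by apply: filterS => x; rewrite nrmE rC_lt nrmB.
apply/cvgrPdist_lt => e e0.
have [eE] := posC e0.
move=> /h; apply: filterS => x hx; by rewrite eE nrmE rC_lt nrmB.
Qed.

Lemma cvgRP (T : Type) (F : set_system T) {FF : Filter F} (f : T -> R) (l : R) :
  f @ F --> l <-> forall e : R, 0 < e -> \forall x \near F, `|f x - l| < e.
Proof.
by split=> [/cvgrPdist_lt h e e0|h]; [|apply/cvgrPdist_lt => e e0];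
  have := h _ e0; apply: filterS => x; rewrite distrC.
Qed.

Lemma nearCP z (P : C -> Prop) :
  (\forall w \near nbhs z, P w) <->
  exists2 e : R, 0 < e & forall w, nrm (w - z) < e -> P w.
Proof.
split=> [/nbhs_ballP[e /= e0 h]|[e e0 h]]; last first.
  apply/nbhs_ballP; exists (rC e); first by rewrite /= rC_gt0.
  by move=> w; rewrite -ball_normE /= nrmE rC_lt nrmB; exact: h.
have [eE ne0] := posC e0; exists (nrm e) => //.
move=> w wz; apply: h; rewrite -ball_normE /= nrmE eE rC_lt nrmB //.
Qed.

Lemma near_nrm z e : 0 < e -> \forall w \near nbhs z, nrm (w - z) < e.
Proof. by move=> e0; apply/nearCP; exists e. Qed.

Lemma near_abs (r e : R) : 0 < e -> \forall s \near r, `|s - r| < e.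
Proof.
move=> e0; apply/nbhs_ballP; exists e => //= s.
by rewrite -ball_normE /= distrC.
Qed.

Lemma ReC_cvg z : ReC @ nbhs z --> ReC z.
Proof.
apply/(@cvgRP _ (nbhs z)) => e e0; apply: filterS (near_nrm z e0) => x.
rewrite -raddfB; exact: le_lt_trans (ReC_le _).
Qed.

Lemma rC_cvg (r : R) : rC @ r --> rC r.
Proof.
apply/(@cvgCP _ (nbhs r)) => e e0; apply: filterS (near_abs r e0) => x.
by rewrite -raddfB nrm_rC.
Qed.

Section Limits.
Variables (T : Type) (F : set_system T).
Context {FF : Filter F}.
Implicit Types (f g : T -> C) (a b : C).

Lemma Ccvg_cst a : (fun=> a) @ F --> a. Proof. exact: cvg_cst. Qed.

Lemma CcvgD f g a b : f @ F --> a -> g @ F --> b ->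
  (fun t => f t + g t) @ F --> a + b.
Proof. exact: cvgD. Qed.

Lemma CcvgN f a : f @ F --> a -> (fun t => - f t) @ F --> - a.
Proof. exact: cvgN. Qed.

Lemma CcvgB f g a b : f @ F --> a -> g @ F --> b ->
  (fun t => f t - g t) @ F --> a - b.
Proof. exact: cvgB. Qed.

Lemma CcvgM f g a b : f @ F --> a -> g @ F --> b ->
  (fun t => f t * g t) @ F --> a * b.
Proof. exact: cvgM. Qed.

Lemma CcvgV f a : a != 0 -> f @ F --> a -> (fun t => (f t)^-1) @ F --> a^-1.
Proof. by move=> a0 fa; exact: cvgV. Qed.

Lemma Ccvg_comp f a (h : C -> C) b : f @ F --> a -> h @ nbhs a --> b ->
  (fun t => h (f t)) @ F --> b.
Proof. by move=> fa hb; exact: (cvg_comp _ _ fa hb). Qed.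

Lemma Ccvg_near f g a : f @ F --> a -> (\forall t \near F, f t = g t) ->
  g @ F --> a.
Proof. by move=> fa e; apply: cvg_trans fa; exact: near_eq_cvg. Qed.
End Limits.

Lemma Ccvg_id z : (fun w : C => w) @ nbhs z --> z.
Proof. exact: cvg_id. Qed.

(* Caratheodory's form of complex differentiability. *)
Definition hasd (f : C -> C) (z d : C) := exists phi : C -> C,
  phi @ nbhs z --> d /\ \forall w \near nbhs z, f w - f z = phi w * (w - z).

Lemma hasd_cst (c z : C) : hasd (fun=> c) z 0.
Proof.
exists (fun=> 0).
by split; [exact: Ccvg_cst|apply: nearW => w; rewrite subrr mul0r].
Qed.

Lemma hasd_id z : hasd id z 1.
Proof.
exists (fun=> 1).
by split; [exact: Ccvg_cst|apply: nearW => w; rewrite mul1r].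
Qed.

Lemma hasdD f g z d e : hasd f z d -> hasd g z e ->
  hasd (fun w => f w + g w) z (d + e).
Proof.
move=> [p [cp hp]] [q [cq hq]]; exists (fun w => p w + q w).
split.
  exact: CcvgD.
by apply: filterS2 hp hq => w; rewrite opprD addrACA mulrDl => -> ->.
Qed.

Lemma hasd_near f g z d : hasd f z d -> f z = g z ->
  (\forall w \near nbhs z, f w = g w) -> hasd g z d.
Proof.
move=> [p [cp hp]] e h; exists p; split=> //.
by apply: filterS2 hp h => w; rewrite -e => + <-.
Qed.

Lemma hasd_eq f g z d : hasd f z d -> f =1 g -> hasd g z d.
Proof. by move=> hf e; apply: hasd_near hf _ _ => //; apply: nearW. Qed.

Lemma hasd_cont f z d : hasd f z d -> f @ nbhs z --> f z.
Proof.
move=> [p [cp hp]].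
have : (fun w => f z + p w * (w - z)) @ nbhs z --> f z + d * (z - z).
  apply: CcvgD; first exact: Ccvg_cst.
  by apply: CcvgM => //; apply: CcvgB; [exact: Ccvg_id|exact: Ccvg_cst].
rewrite subrr mulr0 addr0 => h; apply: Ccvg_near h _.
by apply: filterS hp => w <-; rewrite addrC subrK.
Qed.

Lemma hasdM f g z d e : hasd f z d -> hasd g z e ->
  hasd (fun w => f w * g w) z (d * g z + f z * e).
Proof.
move=> hf hg; have cg := hasd_cont hg.
case: hf hg => [p [cp hp]] [q [cq hq]].
exists (fun w => p w * g w + f z * q w).
split.
  by apply: CcvgD; [exact: CcvgM|apply: CcvgM => //; exact: Ccvg_cst].
apply: filterS2 hp hq => w e1 e2.
have -> : f w * g w - f z * g z = (f w - f z) * g w + f z * (g w - g z).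
  by rewrite mulrBl mulrBr addrA subrK.
by rewrite e1 e2 mulrDl mulrAC !mulrA.
Qed.

Lemma hasdZ c f z d : hasd f z d -> hasd (fun w => c * f w) z (c * d).
Proof.
move=> hf; have := hasdM (hasd_cst c z) hf; by rewrite mul0r add0r.
Qed.

Lemma hasdN f z d : hasd f z d -> hasd (fun w => - f w) z (- d).
Proof.
move=> hf; have := hasdZ (-1) hf; rewrite mulN1r => h.
by apply: hasd_eq h _ => w; rewrite mulN1r.
Qed.

Lemma hasd_sum (I : Type) (s : seq I) (f : I -> C -> C) (d : I -> C) z :
  (forall i, hasd (f i) z (d i)) ->
  hasd (fun w => \sum_(i <- s) f i w) z (\sum_(i <- s) d i).
Proof.
move=> h; elim: s => [|i s IH].
  by rewrite big_nil; apply: hasd_eq (hasd_cst 0 z) _ => w; rewrite big_nil.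
by rewrite big_cons; apply: hasd_eq (hasdD (h i) IH) _ => w; rewrite big_cons.
Qed.

Lemma hasd_comp f g z d e : hasd g z e -> hasd f (g z) d ->
  hasd (fun w => f (g w)) z (d * e).
Proof.
move=> hg [p [cp hp]]; have cg := hasd_cont hg.
case: hg => [q [cq hq]].
exists (fun w => p (g w) * q w).
split.
  by apply: CcvgM => //; exact: (Ccvg_comp cg cp).
have hp' : \forall w \near nbhs z, f (g w) - f (g z) = p (g w) * (g w - g z).
  exact: cg _ hp.
by apply: filterS2 hp' hq => w e1 e2; rewrite e1 e2 mulrA.
Qed.

Lemma hasd_inv z : z != 0 -> hasd (fun w => w^-1) z (- (z ^- 2)).
Proof.
move=> z0; exists (fun w => - (w^-1 * z^-1)).
split.
  rewrite expr2 invfM; apply: CcvgN; apply: CcvgM; last exact: Ccvg_cst.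
  by apply: CcvgV => //; exact: Ccvg_id.
have : \forall w \near nbhs z, nrm (w - z) < nrm z.
  by apply: near_nrm; rewrite nrm_gt0.
apply: filterS => w h; have w0 : w != 0.
  by apply: contraTneq h => ->; rewrite sub0r nrmN ltxx.
by field; rewrite z0 w0.
Qed.

(** The form in which power series and the logarithm get differentiated: a quadratic remainder makes
    the difference quotient, completed by [d] at [z], continuous there. *)
Lemma hasd_quad f z d (K r : R) : 0 < r -> (forall w, nrm (w - z) < r ->
    nrm (f w - f z - d * (w - z)) <= K * nrm (w - z) ^+ 2) -> hasd f z d.
Proof.
move=> r0 h; exists (fun w => if w == z then d else (f w - f z) / (w - z)).
split.
  apply/cvgCP => e e0.
  have K0 : 0 < `|K| + 1 by rewrite ltr_wpDl.
  have m0 : 0 < Num.min r (e / (`|K| + 1)) by rewrite lt_min r0 divr_gt0.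
  apply: filterS (near_nrm z m0) => w; rewrite lt_min => /andP[wr we].
  case: eqP => [_|/eqP wz]; first by rewrite subrr nrm0.
  have wz0 : w - z != 0 by rewrite subr_eq0.
  have -> : (f w - f z) / (w - z) - d = (f w - f z - d * (w - z)) / (w - z).
    by rewrite [RHS]mulrBl mulfK.
  rewrite nrmM nrmV ltr_pdivrMr ?nrm_gt0 //.
  apply: le_lt_trans (h _ wr) _; rewrite expr2 mulrA ltr_pM2r ?nrm_gt0 //.
  rewrite ltr_pdivlMr // in we; apply: le_lt_trans we.
  rewrite mulrC ler_wpM2l ?nrm_ge0 //; apply: le_trans (ler_norm _) _.
  by rewrite lerDl.
apply: nearW => w; case: eqP => [->|/eqP wz]; first by rewrite !subrr mulr0.
by rewrite divfK // subr_eq0.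
Qed.

Lemma hasd_derivable f z d : hasd f z d -> derivable f z 1.
Proof.
move=> [p [cp hp]]; apply/cvg_ex; exists d.
have s0 : shift z @ nbhs (0 : C) --> z.
  have : (fun h => h + z) @ nbhs (0 : C) --> 0 + z.
    by apply: CcvgD; [exact: (@Ccvg_id 0)|exact: Ccvg_cst].
  by rewrite add0r.
apply: (@cvg_trans _ ((p \o shift z) @ (0:C)^')); last first.
  apply: cvg_trans; last exact: (cvg_comp _ _ s0 cp).
  by apply: cvg_app; exact: cvg_within.
apply: near_eq_cvg; rewrite near_withinE.
have H : \forall h \near nbhs (0 : C),
    f (h + z) - f z = p (h + z) * (h + z - z) := s0 _ hp.
apply: filterS H => h e h0.
have -> : (f \o shift z) (h *: 1) = f (h + z) by rewrite /= [h *: 1]mulr1.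
by rewrite e addrK /= -[RHS]/(_^-1 * _) mulrCA mulVf // mulr1.
Qed.

End ComplexNumbers.

(** * Mean value inequality along segments *)

Section MeanValue.
Variables (R : realType) (C : complexes R).

Lemma real_hasd (f phi : R -> R) (t d : R) : phi @ nbhs t --> d ->
  (\forall s \near nbhs t, f s - f t = phi s * (s - t)) -> is_derive t 1 f d.
Proof.
move=> cp hp.
have s0 : shift t @ nbhs (0 : R) --> t.
  have : (fun h => h + t) @ nbhs (0 : R) --> 0 + t.
    by apply: cvgD; [exact: cvg_id|exact: cvg_cst].
  by rewrite add0r.
have H : (fun h => h^-1 *: ((f \o shift t) (h *: 1) - f t)) @ (0 : R)^' --> d.
  apply: (@cvg_trans _ ((phi \o shift t) @ (0:R)^')); last first.
    apply: cvg_trans; last exact: (cvg_comp _ _ s0 cp).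
    by apply: cvg_app; exact: cvg_within.
  apply: near_eq_cvg; rewrite near_withinE.
  have H' : \forall h \near nbhs (0 : R),
      f (h + t) - f t = phi (h + t) * (h + t - t) := s0 _ hp.
  apply: filterS H' => h e h0.
  have -> : (f \o shift t) (h *: 1) = f (h + t) by rewrite /= [h *: 1]mulr1.
  by rewrite e addrK /= -[RHS]/(_^-1 * _) mulrCA mulVf // mulr1.
by split; [apply/cvg_ex; exists d|apply/cvg_lim].
Qed.

Definition seg (x y : C) (t : R) : C := x + rC C t * (y - x).

Lemma seg_cvg x y (t : R) : seg x y @ nbhs t --> seg x y t.
Proof.
apply: CcvgD; first exact: Ccvg_cst.
by apply: CcvgM; [exact: rC_cvg|exact: Ccvg_cst].
Qed.

(** The real mean value theorem is applied to the real part of [u * f] along the segment, where the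
    unit [u] rotates [f y - f x] onto the positive axis. *)
Lemma mean_value (f : C -> C) (x y : C) (M : R) :
  (forall t : R, 0 <= t <= 1 -> exists2 d, hasd f (seg x y t) d & nrm d <= M) ->
  nrm (f y - f x) <= M * nrm (y - x).
Proof.
move=> h; set w := f y - f x.
have [w0|w0] := eqVneq w 0.
  have i0 : 0 <= (0 : R) <= 1 by rewrite lexx ler01.
  have [d _ dM] := h 0 i0; rewrite w0 nrm0 mulr_ge0 ?nrm_ge0 //.
  exact: le_trans (nrm_ge0 d) dM.
have cw : 0 < nrm w by rewrite nrm_gt0.
have [u uw] : exists u, u * w = rC C (nrm w).
  exists (w^* * rC C (nrm w)^-1); rewrite mulrAC [X in X * _]mulrC -normCK nrmE.
  by rewrite -rmorphXn -rmorphM /= expr2 mulfK // gt_eqF.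
have cu : nrm u = 1.
  have := congr1 (@nrm R C) uw; rewrite nrmM nrm_rC ger0_norm ?nrm_ge0 //.
  by rewrite -[RHS]mul1r => /mulIf -> //; rewrite gt_eqF.
pose psi t := ReC (u * f (seg x y t)).
have dpsi (t : R) : 0 <= t <= 1 -> exists2 e, is_derive t 1 psi e & e <= M * nrm (y - x).
  move=> /h [d [phi [cphi hphi]] dM].
  exists (ReC (u * (d * (y - x)))); last first.
    apply: le_trans (ler_norm _) _; apply: le_trans (ReC_le _) _.
    by rewrite !nrmM cu mul1r ler_wpM2r ?nrm_ge0.
  apply: (@real_hasd _ (fun s => ReC (u * (phi (seg x y s) * (y - x))))).
    have cs := @seg_cvg x y t.
    have : (fun s => u * (phi (seg x y s) * (y - x))) @ nbhs t --> u * (d * (y - x)).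
      apply: CcvgM; first exact: Ccvg_cst.
      by apply: CcvgM; [exact: Ccvg_comp cs cphi|exact: Ccvg_cst].
    move=> c; have := @ReC_cvg _ C (u * (d * (y - x))).
    by move=> r; exact: (cvg_comp _ _ c r).
  have H : \forall s \near nbhs t, f (seg x y s) - f (seg x y t) =
      phi (seg x y s) * (seg x y s - seg x y t) := @seg_cvg x y t _ hphi.
  apply: filterS H => s e; rewrite /psi -raddfB -mulrBr e.
  have -> : seg x y s - seg x y t = (y - x) * rC C (s - t).
    by rewrite /seg rmorphB /=; ring.
  by rewrite -ReCM_rC !mulrA.
have [e he] : exists e : R -> R, forall t : R, 0 <= t <= 1 ->
    is_derive t 1 psi (e t) /\ e t <= M * nrm (y - x).
  have : forall t : R, exists e : R, 0 <= t <= 1 ->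
      is_derive t 1 psi e /\ e <= M * nrm (y - x).
    move=> t; have [|t1] := boolP (0 <= t <= 1); last by exists 0.
    by move=> /dpsi[e h1 h2]; exists e.
  by move=> /choice[e he]; exists e.
have [||c] := @MVT_segment R psi e 0 1 ler01.
- by move=> t; rewrite in_itv /= => /andP[t0 t1]; apply: (he t _).1; rewrite !ltW.
- apply: derivable_within_continuous => t; rewrite in_itv /= => /he[? _].
  exact: ex_derive.
rewrite in_itv /= => /he [_ ec] E.
have : psi 1 - psi 0 = nrm w.
  rewrite /psi -raddfB -mulrBr /seg rmorph1 mul1r rmorph0 mul0r addr0.
  by rewrite (addrC x) subrK uw /= ReC_rC.
by rewrite E subr0 mulr1 => <-.
Qed.

Lemma hasd0_const (f : C -> C) (x y : C) :
  (forall t : R, 0 <= t <= 1 -> hasd f (seg x y t) 0) -> f x = f y.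
Proof.
move=> h; apply/eqP; rewrite eq_sym -subr_eq0 -nrm_eq0 eq_le nrm_ge0 andbT.
rewrite -[X in _ <= X](mul0r (nrm (y - x))); apply: mean_value => t /h hd.
by exists 0; rewrite ?nrm0.
Qed.

End MeanValue.

(** * Power series *)

Section RealSeries.
Variable R : realType.
Implicit Types (a c d : nat -> R) (q r : R).

Lemma geometric_sum_le q N : 0 <= q < 1 -> \sum_(i < N) q ^+ i <= (1 - q)^-1.
Proof.
move=> /andP[q0 q1]; have d0 : 0 < 1 - q by rewrite subr_gt0.
rewrite -[X in _ <= X]mul1r ler_pdivlMr // mulrC.
have -> : (1 - q) * \sum_(i < N) q ^+ i = 1 - q ^+ N.
  by rewrite -[1 - q]opprB mulNr -subrX1 opprB.
by rewrite lerBlDr lerDl exprn_ge0.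
Qed.

Lemma mulrn_exp_le q n : 0 <= q < 1 -> n.+1%:R * q ^+ n <= (1 - q)^-1.
Proof.
move=> qq; apply: le_trans (geometric_sum_le n.+1 qq).
case/andP: qq => q0 q1; rewrite mulr_natl -[X in q ^+ n *+ X]card_ord -sumr_const.
by apply: ler_sum => i _; apply: (ler_wiXn2l q0 (ltW q1)); rewrite -ltnS.
Qed.

Lemma bounded_series_cvg a M : (forall n, 0 <= a n) ->
  (forall N, \sum_(i < N) a i <= M) -> cvgn (series a).
Proof.
move=> a0 aM; apply: nondecreasing_is_cvgn.
  by apply/nondecreasing_seqP => n; rewrite !seriesEnat /= big_nat_recr //= lerDl.
by exists M => _ [N _ <-]; rewrite seriesEord; exact: aM.
Qed.

Definition geometric_bound a := exists K q,
  0 <= q < 1 /\ forall n, `|a n| <= K * q ^+ n.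

Lemma geometric_bound_sum a : geometric_bound a ->
  exists M, forall N, \sum_(i < N) `|a i| <= M.
Proof.
move=> [K [q [qq h]]]; exists (K * (1 - q)^-1) => N.
have K0 : 0 <= K by have := le_trans (normr_ge0 _) (h 0%N); rewrite expr0 mulr1.
apply: le_trans (_ : \sum_(i < N) K * q ^+ i <= _); first exact: ler_sum.
by rewrite -mulr_sumr ler_wpM2l // geometric_sum_le.
Qed.

Lemma between1 r : 0 <= r < 1 -> exists s, [/\ 0 < s, s < 1 & r < s].
Proof. by move=> /andP[r0 r1]; exists ((1 + r) / 2); split; lra. Qed.

(* The power series with coefficients [c] converges on the open unit disc. *)
Definition radius1 c := forall r, 0 <= r < 1 ->
  exists K, forall n, `|c n| * r ^+ n <= K.

Lemma radius1_geometric c r : radius1 c -> 0 <= r < 1 ->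
  geometric_bound (fun n => `|c n| * r ^+ n).
Proof.
move=> hc /andP[r0 r1]; have [s [s0 s1 rs]] := between1 (introT andP (conj r0 r1)).
have [|K hK] := hc s; first by rewrite ltW.
exists K, (r / s); split.
  by rewrite divr_ge0 ?(ltW s0) //= ltr_pdivrMr // mul1r.
move=> n; rewrite ger0_norm ?mulr_ge0 ?exprn_ge0 //.
have -> : `|c n| * r ^+ n = `|c n| * s ^+ n * (r / s) ^+ n.
  have sn : s ^+ n != 0 by rewrite expf_neq0 // gt_eqF.
by rewrite expr_div_n; move: (s ^+ n) sn (r ^+ n) => x x0 y; field.
by rewrite ler_wpM2r ?exprn_ge0 ?divr_ge0 ?(ltW s0).
Qed.

Lemma radius1_le c d : radius1 d -> (forall n, `|c n| <= `|d n|) -> radius1 c.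
Proof.
move=> hd h r rr; have [K hK] := hd r rr; exists K => n.
by apply: le_trans (hK n); rewrite ler_wpM2r // exprn_ge0 //; case/andP: rr.
Qed.

Lemma radius1_mulS c : radius1 c -> radius1 (fun n => n.+1%:R * c n).
Proof.
move=> hc r rr; have [K [q [qq h]]] := radius1_geometric hc rr.
exists (K * (1 - q)^-1) => n; rewrite normrM normr_nat -mulrA.
have K0 : 0 <= K by have := le_trans (normr_ge0 _) (h 0%N); rewrite expr0 mulr1.
apply: le_trans (_ : n.+1%:R * (K * q ^+ n) <= _).
  by rewrite ler_wpM2l //; apply: le_trans (h n); exact: ler_norm.
by rewrite mulrCA ler_wpM2l // mulrn_exp_le.
Qed.

Lemma radius1_shift c : radius1 c -> radius1 (fun n => c n.+1).
Proof.
move=> hc r /andP[r0 r1]; have [s [s0 s1 rs]] := between1 (introT andP (conj r0 r1)).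
have [|K hK] := hc s; first by rewrite ltW.
exists (K / s) => n; rewrite ler_pdivlMr //; apply: le_trans (hK n.+1).
rewrite exprSr mulrA; apply: ler_wpM2r; first exact: ltW.
apply: ler_wpM2l => //; apply: lerXn2r; rewrite ?nnegrE ?(ltW s0) //.
exact: ltW.
Qed.

Lemma radius1_poly c k : (forall n, `|c n| <= n.+1%:R ^+ k) -> radius1 c.
Proof.
elim: k c => [|k IH] c h.
  move=> r /andP[r0 r1]; exists 1 => n.
  by rewrite -[X in _ <= X]mulr1 ler_pM ?exprn_ge0 // ?h // exprn_ile1 // ltW.
have h' : radius1 (fun n => n.+1%:R ^+ k : R).
  by apply: IH => n; rewrite ger0_norm // exprn_ge0.
apply: radius1_le (radius1_mulS h') _ => n.
by rewrite -exprS; apply: le_trans (h n) (ler_norm _).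
Qed.

End RealSeries.

(** * Absolutely convergent complex series *)

Section ComplexSeries.
Variables (R : realType) (C : complexes R).
Implicit Types (a b : nat -> C) (z w : C).

Definition summable a := exists M, forall N, \sum_(i < N) nrm (a i) <= M.

(** Built from real limits so as to be total; [csum_cvg] makes it the sum of a summable sequence. *)
Definition csum a : C := rC C (limn (series (fun n => ReC (a n)))) +
  'i * rC C (limn (series (fun n => ImC (a n)))).

Lemma Ccvg_unique (T : Type) (F : set_system T) {FF : ProperFilter F}
  (f : T -> C) (x y : C) : f @ F --> x -> f @ F --> y -> x = y.
Proof. by apply: cvg_unique; exact: norm_hausdorff. Qed.

Lemma csum_cvg a : summable a ->
  (fun N => \sum_(i < N) a i) @ \oo --> csum a.
Proof.
move=> [M hM].
have cvg_part (p : C -> R) : (forall z, `|p z| <= nrm z) ->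
    cvgn (series (fun n => p (a n))).
  move=> hp; apply: normed_cvg.
  apply: (@bounded_series_cvg _ _ M) => [n|N]; first exact: normr_ge0.
  by apply: le_trans (hM N); apply: ler_sum => i _; exact: hp.
have /cvgRP hRe : series (fun n => ReC (a n)) @ \oo --> limn (series (fun n => ReC (a n))).
  by apply: cvg_part; exact: ReC_le.
have /cvgRP hIm : series (fun n => ImC (a n)) @ \oo --> limn (series (fun n => ImC (a n))).
  by apply: cvg_part; exact: ImC_le.
apply/cvgCP => e e0; have e2 : 0 < e / 2 by rewrite divr_gt0.
apply: filterS2 (hRe _ e2) (hIm _ e2) => N h1 h2.
apply: le_lt_trans (nrm_le_ReIm _) _; rewrite !raddfB /=.
rewrite [e]splitr /csum ReC_rect ImC_rect; apply: ltrD.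
  by move: h1; rewrite seriesEord /= raddf_sum.
by move: h2; rewrite seriesEord /= raddf_sum.
Qed.

Lemma csum_eq a l : summable a -> (fun N => \sum_(i < N) a i) @ \oo --> l ->
  csum a = l.
Proof. move=> /csum_cvg; exact: Ccvg_unique. Qed.

Lemma eq_csum a b : a =1 b -> csum a = csum b.
Proof. by move=> /funext ->. Qed.

Lemma summableD a b : summable a -> summable b -> summable (fun n => a n + b n).
Proof.
move=> [M hM] [L hL]; exists (M + L) => N.
apply: le_trans (lerD (hM N) (hL N)); rewrite -big_split /=.
by apply: ler_sum => i _; exact: nrmD.
Qed.

Lemma summableZ c a : summable a -> summable (fun n => c * a n).
Proof.
move=> [M hM]; exists (nrm c * M) => N.
rewrite (eq_bigr (fun i : 'I_N => nrm c * nrm (a i))) => [|i _]; last exact: nrmM.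
by rewrite -mulr_sumr ler_wpM2l ?nrm_ge0 ?hM.
Qed.

Lemma summable_shift a : summable a -> summable (fun n => a n.+1).
Proof.
move=> [M hM]; exists M => N; apply: le_trans (hM N.+1).
by rewrite big_ord_recl /= lerDr nrm_ge0.
Qed.

Lemma summable_le a (b : nat -> R) : (exists M, forall N, \sum_(i < N) b i <= M) ->
  (forall n, nrm (a n) <= b n) -> summable a.
Proof.
move=> [M hM] h; exists M => N; apply: le_trans (hM N).
by apply: ler_sum => i _.
Qed.

Lemma summable_unshift a : summable (fun n => a n.+1) -> summable a.
Proof.
move=> [M hM]; exists (nrm (a 0%N) + M) => -[|N].
  rewrite big_ord0 addr_ge0 ?nrm_ge0 //.
  by apply: le_trans (hM 0%N); rewrite big_ord0.
by rewrite big_ord_recl lerD2l.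
Qed.

Lemma summable_ext a b : a =1 b -> summable a -> summable b.
Proof. by move=> /funext ->. Qed.

Lemma csumD a b : summable a -> summable b ->
  csum (fun n => a n + b n) = csum a + csum b.
Proof.
move=> ha hb; apply: csum_eq; first exact: summableD.
have -> : (fun N => \sum_(i < N) (a i + b i)) =
    (fun N => \sum_(i < N) a i + \sum_(i < N) b i).
  by apply/funext => N; rewrite big_split.
by apply: CcvgD; exact: csum_cvg.
Qed.

Lemma csumZ c a : summable a -> csum (fun n => c * a n) = c * csum a.
Proof.
move=> ha; apply: csum_eq; first exact: summableZ.
have -> : (fun N => \sum_(i < N) c * a i) = (fun N => c * \sum_(i < N) a i).
  by apply/funext => N; rewrite mulr_sumr.
by apply: CcvgM; [exact: Ccvg_cst|exact: csum_cvg].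
Qed.

Lemma csum_recl a : summable a -> csum a = a 0%N + csum (fun n => a n.+1).
Proof.
move=> ha; apply: csum_eq => //.
have h : (fun N => a 0%N + \sum_(i < N) a i.+1) @ \oo -->
    a 0%N + csum (fun n => a n.+1).
  apply: CcvgD; first exact: Ccvg_cst.
  by apply: csum_cvg; exact: summable_shift.
rewrite -cvg_shiftS.
have -> : [sequence \sum_(i < n.+1) a i]_n = (fun N => a 0%N + \sum_(i < N) a i.+1).
  by apply/funext => N /=; rewrite big_ord_recl.
exact: h.
Qed.

Lemma nrm_lim_le (u : nat -> C) l M : u @ \oo --> l ->
  (\forall n \near \oo, nrm (u n) <= M) -> nrm l <= M.
Proof.
move=> /cvgCP h hM; rewrite leNgt; apply/negP => Ml.
have e0 : 0 < nrm l - M by rewrite subr_gt0.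
have [n [h1 h2]] := @filter_ex _ _ _ _ (filterI (h _ e0) hM).
have := nrmD (l - u n) (u n); rewrite subrK nrmB; lra.
Qed.

Lemma csum_le a M : summable a -> (forall N, nrm (\sum_(i < N) a i) <= M) ->
  nrm (csum a) <= M.
Proof.
by move=> /csum_cvg ha h; apply: nrm_lim_le ha _; apply: nearW.
Qed.

Definition pterm (c : nat -> R) z n : C := rC C (c n) * z ^+ n.
Definition pser c z := csum (pterm c z).

Lemma nrm_pterm c z n : nrm (pterm c z n) = `|c n| * nrm z ^+ n.
Proof. by rewrite nrmM nrm_rC nrmX. Qed.

Lemma pterm_summable c z : radius1 c -> nrm z < 1 -> summable (pterm c z).
Proof.
move=> hc z1; have zz : 0 <= nrm z < 1 by rewrite nrm_ge0.
apply: summable_le (geometric_bound_sum (radius1_geometric hc zz)) _ => n.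
by rewrite nrm_pterm; exact: ler_norm.
Qed.

Lemma pser_cvg c z : radius1 c -> nrm z < 1 ->
  (fun N => \sum_(i < N) pterm c z i) @ \oo --> pser c z.
Proof. by move=> hc z1; apply: csum_cvg; exact: pterm_summable. Qed.

Lemma pser0 c : pser c 0 = rC C (c 0%N).
Proof.
have s0 : summable (pterm c 0).
  exists `|c 0%N| => -[|N]; first by rewrite big_ord0.
  rewrite big_ord_recl big1 => [|i _]; last by rewrite nrm_pterm nrm0 expr0n mulr0.
  by rewrite nrm_pterm expr0 mulr1 addr0.
rewrite /pser csum_recl // /pterm expr0 mulr1.
rewrite [csum _](_ : _ = 0) ?addr0 //.
apply: csum_eq.
  by exists 0 => N; rewrite big1 // => i _; rewrite expr0n mulr0 nrm0.
have -> : (fun N => \sum_(i < N) rC C (c i.+1) * 0 ^+ i.+1) = fun=> 0.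
  by apply/funext => N; rewrite big1 // => i _; rewrite expr0n mulr0.
exact: Ccvg_cst.
Qed.

Lemma eq_pser c d : c =1 d -> pser c =1 pser d.
Proof. by move=> /funext ->. Qed.

Lemma pserD c d z : radius1 c -> radius1 d -> nrm z < 1 ->
  pser (fun n => c n + d n) z = pser c z + pser d z.
Proof.
move=> hc hd z1; rewrite -csumD; [|exact: pterm_summable|exact: pterm_summable].
by apply: eq_csum => n; rewrite /pterm rmorphD mulrDl.
Qed.

Lemma pserN c z : radius1 c -> nrm z < 1 ->
  pser (fun n => - c n) z = - pser c z.
Proof.
move=> hc z1; rewrite -mulN1r -csumZ; last exact: pterm_summable.
by apply: eq_csum => n; rewrite /pterm rmorphN mulNr mulN1r.
Qed.

Lemma pser_recl c z : radius1 c -> nrm z < 1 ->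
  pser c z = rC C (c 0%N) + z * pser (fun n => c n.+1) z.
Proof.
move=> hc z1; rewrite /pser csum_recl; last exact: pterm_summable.
rewrite -csumZ; last by apply: pterm_summable => //; exact: radius1_shift.
rewrite {1}/pterm expr0 mulr1; congr (_ + _); apply: eq_csum => n.
by rewrite /pterm exprS mulrCA.
Qed.

Lemma pser_le c z M : radius1 c -> nrm z < 1 ->
  (forall N, \sum_(i < N) `|c i| * nrm z ^+ i <= M) -> nrm (pser c z) <= M.
Proof.
move=> hc z1 h; apply: csum_le; first exact: pterm_summable.
move=> N; apply: le_trans (h N); apply: le_trans (nrm_sum _ _ _) _.
by apply: ler_sum => i _; rewrite nrm_pterm.
Qed.

(** The factor [r ^+ 2] stands in for the exponent n - 2 of the usual bound. The remainders satisfy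
    T(n+1) = w T(n) + n z^(n-1) h^2 with h = w - z, and n^2 + n <= (n+1)^2 closes the induction. *)
Lemma expr_taylor2 (z w : C) (r : R) n : nrm z <= r -> nrm w <= r ->
  nrm (w ^+ n - z ^+ n - n%:R * z ^+ n.-1 * (w - z)) * r ^+ 2 <=
  (n * n)%:R * r ^+ n * nrm (w - z) ^+ 2.
Proof.
move=> zr wr; have r0 : 0 <= r := le_trans (nrm_ge0 z) zr.
elim: n => [|n IH]; first by rewrite !expr0 subrr !mul0r subrr nrm0 mul0r.
set h := w - z; have -> : w ^+ n.+1 - z ^+ n.+1 - n.+1%:R * z ^+ n.+1.-1 * h =
    w * (w ^+ n - z ^+ n - n%:R * z ^+ n.-1 * h) + n%:R * z ^+ n.-1 * h ^+ 2.
  rewrite /h; case: n {IH} => [|n]; rewrite /= ?expr1 ?expr0 ?exprS -?natr1; ring.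
apply: le_trans (_ : (nrm w * nrm (w ^+ n - z ^+ n - n%:R * z ^+ n.-1 * h) +
   n%:R * nrm z ^+ n.-1 * nrm h ^+ 2) * r ^+ 2 <= _).
  rewrite ler_wpM2r ?exprn_ge0 //; apply: le_trans (nrmD _ _) _.
  by rewrite !nrmM !nrmX -(rmorph_nat (rC C)) nrm_rC normr_nat.
rewrite mulrDl -mulrA.
apply: le_trans (_ : r * ((n * n)%:R * r ^+ n * nrm h ^+ 2) +
  n%:R * r ^+ n.+1 * nrm h ^+ 2 <= _).
  apply: lerD; first by apply: ler_pM => //; rewrite ?mulr_ge0 ?nrm_ge0 ?exprn_ge0.
  rewrite mulrAC; apply: ler_wpM2r; first by rewrite exprn_ge0 ?nrm_ge0.
  case: n {IH} => [|n /=]; first by rewrite !mul0r.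
  rewrite -mulrA; apply: ler_wpM2l => //.
  have -> : r ^+ n.+2 = r ^+ n * r ^+ 2 by rewrite -exprD addn2.
  apply: ler_wpM2r; first exact: exprn_ge0.
  by apply: lerXn2r; rewrite ?nnegrE ?nrm_ge0.
have E : r ^+ n.+1 = r * r ^+ n by rewrite exprS.
rewrite E; have -> : r * ((n * n)%:R * r ^+ n * nrm h ^+ 2) +
    n%:R * (r * r ^+ n) * nrm h ^+ 2 = (n * n + n)%:R * (r * r ^+ n) * nrm h ^+ 2.
  by rewrite natrD; ring.
apply: ler_wpM2r; first by rewrite exprn_ge0 ?nrm_ge0.
apply: ler_wpM2r; first by rewrite mulr_ge0 ?exprn_ge0.
by rewrite ler_nat; lia.
Qed.

Definition pdiff (c : nat -> R) n : R := n.+1%:R * c n.+1.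

Lemma radius1_pdiff c : radius1 c -> radius1 (pdiff c).
Proof. by move=> hc; apply: radius1_mulS; exact: radius1_shift. Qed.

(** The quadratic remainders of the monomials, bounded on a disc of radius [r] between |z| and 1,
    add up because n^2 |c n| r^n is summable. *)
Lemma pser_hasd c z : radius1 c -> nrm z < 1 -> hasd (pser c) z (pser (pdiff c) z).
Proof.
move=> hc z1; have hd := radius1_pdiff hc.
have zz : 0 <= nrm z < 1 by rewrite nrm_ge0.
have [r [r0 r1 zr]] := between1 zz.
have rr : 0 <= r < 1 by rewrite ltW.
have [K hK] := geometric_bound_sum
  (radius1_geometric (radius1_mulS (radius1_mulS hc)) rr).
have r20 : 0 < r ^+ 2 by rewrite exprn_gt0.
(* [K] bounds the sums of (i+1)^2 |c i| r^i, and the radius [r - nrm z] keeps [w] in the disc of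
   radius [r]. *)
apply: (@hasd_quad _ _ _ _ _ (K / r ^+ 2) (r - nrm z)); first by rewrite subr_gt0.
move=> w hw; have wr : nrm w <= r.
  by have := nrmD (w - z) z; rewrite subrK; lra.
have w1 : nrm w < 1 by apply: le_lt_trans r1.
pose e n : C := rC C (c n) * (n%:R * z ^+ n.-1).
have eS n : e n.+1 = pterm (pdiff c) z n.
  by rewrite /e /pterm /pdiff rmorphM rmorph_nat /= mulrCA mulrA.
have se : summable e.
  apply: summable_unshift.
  by apply: summable_ext (pterm_summable hd z1) => n; rewrite eS.
have ee : csum e = pser (pdiff c) z.
  by rewrite csum_recl // {1}/e mul0r mulr0 add0r; apply: eq_csum.
have sw := pterm_summable hc w1; have sz := pterm_summable hc z1.
have szN := summableZ (-1) sz; have seh := summableZ (- (w - z)) se.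
have swz := summableD sw szN.
have -> : pser c w - pser c z - pser (pdiff c) z * (w - z) =
    csum (fun n => rC C (c n) * (w ^+ n - z ^+ n - n%:R * z ^+ n.-1 * (w - z))).
  rewrite -ee /pser [csum e * _]mulrC -mulNr -[- (w - z) * _]csumZ //.
  rewrite -mulN1r -[-1 * _]csumZ // -!csumD //.
  by apply: eq_csum => n; rewrite /pterm /e; ring.
apply: csum_le => [|N].
  apply: (@summable_ext (fun n => pterm c w n + -1 * pterm c z n + - (w - z) * e n)).
    by move=> n; rewrite /pterm /e; ring.
  exact: summableD.
apply: le_trans (nrm_sum _ _ _) _.
rewrite mulrAC ler_pdivlMr // mulr_suml.
apply: le_trans (_ : \sum_(i < N)
   (Num.norm (`|i.+1%:R * (i.+1%:R * c i)| * r ^+ i) * nrm (w - z) ^+ 2) <= _); last first.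
  by rewrite -mulr_suml ler_wpM2r ?exprn_ge0 ?nrm_ge0.
apply: ler_sum => i _; rewrite nrmM nrm_rC -[leLHS]mulrA.
have h := ler_wpM2l (normr_ge0 (c i)) (expr_taylor2 i (ltW zr) wr).
apply: le_trans h _.
rewrite [leLHS]mulrA; apply: ler_wpM2r; first by rewrite exprn_ge0 ?nrm_ge0.
rewrite [leRHS]ger0_norm; last first.
  exact: mulr_ge0 (normr_ge0 _) (exprn_ge0 _ (ltW r0)).
rewrite !normrM !normr_nat !mulrA.
apply: ler_wpM2r; first by rewrite exprn_ge0 // ltW.
by rewrite [leLHS]mulrC ler_wpM2r // -natrM ler_nat; lia.
Qed.

End ComplexSeries.

(** * The principal logarithm *)

Section Logarithm.
Variables (R : realType) (C : complexes R).
Implicit Types (z w u k : C) (r s t x y : R).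

Definition arg z : R :=
  let t := acos (ReC z / nrm z) in if 0 <= ImC z then t else - t.
Definition logC z : C := rC C (ln (nrm z)) + 'i * rC C (arg z).
Definition pol r t : C := rC C (r * cos t) + 'i * rC C (r * sin t).
Definition slit z := ~ (ImC z = 0 /\ ReC z <= 0).

Lemma nrm_pol r t : 0 <= r -> nrm (pol r t) = r.
Proof.
move=> r0; apply/eqP; rewrite -(@eqrXn2 _ 2) ?nrm_ge0 // nrm_sqr ReC_rect ImC_rect.
by rewrite !exprMn -mulrDr cos2Dsin2 mulr1.
Qed.

Lemma ReC_pol r t : ReC (pol r t) = r * cos t. Proof. exact: ReC_rect. Qed.
Lemma ImC_pol r t : ImC (pol r t) = r * sin t. Proof. exact: ImC_rect. Qed.

Lemma polM r s t x : pol r t * pol s x = pol (r * s) (t + x).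
Proof. by rewrite /pol rectM cosD sinD; congr (rC C _ + 'i * rC C _); ring. Qed.

Lemma arg_pol r t : 0 < r -> - pi < t <= pi -> arg (pol r t) = t.
Proof.
move=> r0 /andP[t0 t1]; rewrite /arg (nrm_pol _ (ltW r0)) ReC_pol ImC_pol.
rewrite mulrAC mulfV ?gt_eqF // mul1r pmulr_rge0 //.
have [tp|tn] := leP 0 t.
  rewrite sin_ge0_pi ?tp // cosK // in_itv /= tp //.
have : 0 < sin (- t) by apply: sin_gt0_pi; apply/andP; split; lra.
rewrite sinN oppr_gt0 leNgt => -> /=.
by rewrite -cosN cosK ?opprK // in_itv /=; apply/andP; split; lra.
Qed.

Lemma polar z : z != 0 -> z = pol (nrm z) (arg z) /\ - pi < arg z <= pi.
Proof.
move=> z0; have n0 : 0 < nrm z by rewrite nrm_gt0.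
have := nrm_sqr z; rewrite /arg; set n := nrm z in n0 *.
set a := ReC z; set b := ImC z => nE.
have xb : -1 <= a / n <= 1.
  rewrite -ler_norml normrM normfV (gtr0_norm n0) ler_pdivrMr // mul1r.
  exact: ReC_le.
have ac : cos (acos (a / n)) = a / n by rewrite acosK.
have as' : sin (acos (a / n)) = `|b| / n.
  rewrite sin_acos //; apply/eqP; rewrite -(@eqrXn2 _ 2) ?sqrtr_ge0 //;
    last exact: divr_ge0 (normr_ge0 _) (ltW n0).
  rewrite sqr_sqrtr; last first.
    by rewrite subr_ge0 -real_normK ?num_real // exprn_ile1 // ler_norml.
  rewrite !exprMn real_normK ?num_real // exprVn nE; apply/eqP.
  have : a ^+ 2 + b ^+ 2 != 0 by rewrite -nE expf_neq0 // gt_eqF.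
  by move=> h; field.
have a0 := acos_ge0 xb; have a1 := acos_lepi xb.
have p0 := @pi_gt0 R.
have nn : n != 0 by rewrite gt_eqF.
case: (leP 0 b) => b0.
  split; last by rewrite a1 andbT; lra.
  rewrite /pol ac as' ger0_norm // ![n * _]mulrC !divfK //.
  exact: C_split.
split.
  rewrite /pol cosN sinN ac as' ltr0_norm // mulNr opprK ![n * _]mulrC !divfK //.
  exact: C_split.
have api : acos (a / n) != pi.
  apply: contraTneq b0 => e; rewrite -leNgt.
  have : `|b| / n = 0 by rewrite -as' e sinpi.
  by move=> /eqP; rewrite mulf_eq0 invr_eq0 (negbTE nn) orbF normr_eq0 => /eqP ->.
have : acos (a / n) < pi by rewrite lt_neqAle api.
by move=> ?; apply/andP; split; lra.
Qed.

Lemma slit_neq0 z : slit z -> z != 0.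
Proof. by move=> h; apply/eqP => e; apply: h; rewrite e !raddf0. Qed.

Lemma slit_arg z : slit z -> - pi < arg z < pi.
Proof.
move=> h; have z0 := slit_neq0 h; have [e /andP[a0 a1]] := polar z0.
rewrite a0 /= lt_neqAle a1 andbT; apply/eqP => ap; apply: h.
rewrite e ap /pol ReC_rect ImC_rect sinpi cospi mulr0 mulrN1.
by rewrite oppr_le0 nrm_ge0.
Qed.

Lemma logCM z u : z != 0 -> u != 0 -> - pi < arg z + arg u <= pi ->
  logC (z * u) = logC z + logC u.
Proof.
move=> z0 u0 h; have n0 : 0 < nrm z by rewrite nrm_gt0.
have m0 : 0 < nrm u by rewrite nrm_gt0.
have aE : arg (z * u) = arg z + arg u.
  rewrite {1}(polar z0).1 {1}(polar u0).1 polM arg_pol ?mulr_gt0 //.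
rewrite /logC aE nrmM lnM ?posrE // !rmorphD /= mulrDr; ring.
Qed.

Lemma logC_pol r t : 0 < r -> - pi < t <= pi ->
  logC (pol r t) = rC C (ln r) + 'i * rC C t.
Proof. by move=> r0 h; rewrite /logC arg_pol // nrm_pol // ltW. Qed.

Lemma sin_atan t : sin (atan t) = t / Num.sqrt (1 + t ^+ 2).
Proof.
have s0 : 0 < Num.sqrt (1 + t ^+ 2) by rewrite sqrtr_gt0 ltr_wpDr ?sqr_ge0.
rewrite -cos_atan -{2}[t]atanK /tan divfK // cos_atan invr_neq0 // gt_eqF //.
Qed.

Lemma right_pol z : 0 < ReC z -> z = pol (nrm z) (atan (ImC z / ReC z)).
Proof.
move=> a0; rewrite [LHS]C_split /pol cos_atan sin_atan.
set a := ReC z in a0 *; set b := ImC z; set t := b / a.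
have nE : nrm z = a * Num.sqrt (1 + t ^+ 2).
  apply/eqP; rewrite -(@eqrXn2 _ 2) ?nrm_ge0 ?mulr_ge0 ?sqrtr_ge0 ?ltW // nrm_sqr.
  rewrite exprMn sqr_sqrtr ?addr_ge0 ?sqr_ge0 // -/a -/b /t; apply/eqP.
  by have ? : a != 0 by [rewrite gt_eqF]; field.
have s0 : Num.sqrt (1 + t ^+ 2) != 0.
  by rewrite gt_eqF // sqrtr_gt0 ltr_wpDr ?sqr_ge0.
rewrite nE; congr (rC C _ + 'i * rC C _); first by rewrite mulfK.
have an : a != 0 by rewrite gt_eqF.
by move: (Num.sqrt _) s0 => s s0; rewrite /t; field; rewrite ?an ?s0.
Qed.

Lemma arg_right z : 0 < ReC z -> arg z = atan (ImC z / ReC z).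
Proof.
move=> a0; rewrite {1}[z]right_pol // arg_pol //.
  by rewrite nrm_gt0; apply: contraTneq a0 => ->; rewrite raddf0 ltxx.
have := atan_gtNpi2 (ImC z / ReC z); have := atan_ltpi2 (ImC z / ReC z).
by have := @pi_gt0 R => ? ? ?; apply/andP; split; lra.
Qed.

Lemma atan_sub_le t : `|atan t - t| <= t ^+ 2.
Proof.
have h (a b : R) : a <= b -> exists2 c, a <= c <= b &
    (atan b - b) - (atan a - a) = ((1 + c ^+ 2)^-1 - 1) * (b - a).
  move=> ab; have [|c cab e] := @MVT_segment R (fun x => atan x - x)
     (fun c => (1 + c ^+ 2)^-1 - 1) a b ab.
    by apply: derivable_within_continuous => x _; exact: ex_derive.
  by exists c.
have c01 (c : R) : `|(1 + c ^+ 2)^-1 - 1| <= `|c|.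
  have d0 : 0 < 1 + c ^+ 2 by rewrite ltr_wpDr ?sqr_ge0.
  have -> : (1 + c ^+ 2)^-1 - 1 = - (c ^+ 2 / (1 + c ^+ 2)).
    by have ? : 1 + c ^+ 2 != 0 by [rewrite gt_eqF]; field.
  rewrite normrN ger0_norm; last by rewrite divr_ge0 ?sqr_ge0 // ltW.
  rewrite ler_pdivrMr //.
  have := normr_ge0 c; rewrite -(real_normK (num_real c)); move: `|c| => d.
  move=> d1; nra.
rewrite -real_normK ?num_real // expr2.
have [t0|t0] := leP 0 t.
  have [c /andP[c0 ct] e] := h _ _ t0; move: e; rewrite atan0 !subr0 => ->.
  rewrite normrM ler_wpM2r //; apply: le_trans (c01 c) _.
  by rewrite !ger0_norm.
have [c /andP[ct c0] e] := h _ _ (ltW t0); move: e.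
rewrite atan0 !subr0 !sub0r => e; rewrite -normrN e normrM normrN ler_wpM2r //.
by apply: le_trans (c01 c) _; rewrite (ler0_norm c0) (ltr0_norm t0) lerN2.
Qed.

(** Both inequalities are instances of ln(1 + x) <= x, at [s] and at -s / (1 + s). *)
Lemma ln_sub_le s : - 1 < s -> `|ln (1 + s) - s| <= s ^+ 2 / (1 + s).
Proof.
move=> s1; have d0 : 0 < 1 + s by lra.
have u := le_ln1Dx s1.
have v : s - ln (1 + s) <= s ^+ 2 / (1 + s).
  have := @le_ln1Dx R (- (s / (1 + s))).
  have -> : 1 + - (s / (1 + s)) = (1 + s)^-1.
    by have ? : 1 + s != 0 by [rewrite gt_eqF]; field.
  rewrite lnV ?posrE // => h.
  have -> : s ^+ 2 / (1 + s) = s - s / (1 + s).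
    by have ? : 1 + s != 0 by [rewrite gt_eqF]; field.
  have : - ln (1 + s) <= - (s / (1 + s)).
    by apply: h; rewrite ltrN2 ltr_pdivrMr // mul1r; lra.
  by lra.
by rewrite ler0_norm; lra.
Qed.

(** Let k = x + iy and |1 + k|^2 = 1 + s with s = 2x + |k|^2. The modulus contributes ln(1 + s) / 2
    - x, at most 13 |k|^2, and the argument atan(y / (1 + x)) - y, at most 12 |k|^2. *)
Lemma logC1_quad k : nrm k <= 2^-1 -> nrm (logC (1 + k) - k) <= 25 * nrm k ^+ 2.
Proof.
move=> hk; set K := nrm k in hk *.
have K0 : 0 <= K by exact: nrm_ge0.
pose x := ReC k; pose y := ImC k.
have xK : `|x| <= K by exact: ReC_le.
have yK : `|y| <= K by exact: ImC_le.
have KE : K ^+ 2 = x ^+ 2 + y ^+ 2 by exact: nrm_sqr.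
have /andP[xl xr] : - K <= x <= K by rewrite -ler_norml.
have /andP[yl yr] : - K <= y <= K by rewrite -ler_norml.
have Re1 : ReC (1 + k) = 1 + x by rewrite raddfD /= -(rmorph1 (rC C)) ReC_rC.
have Im1 : ImC (1 + k) = y by rewrite raddfD /= -(rmorph1 (rC C)) ImC_rC add0r.
have x0 : 0 < 1 + x by lra.
have uE : nrm (1 + k) ^+ 2 = 1 + (2 * x + K ^+ 2).
  by rewrite nrm_sqr Re1 Im1 KE; ring.
have n0 : 0 < nrm (1 + k).
  by rewrite nrm_gt0; apply: contraTneq x0 => e; rewrite -Re1 e raddf0 ltxx.
rewrite {2}[k]C_split -/x -/y /logC arg_right ?Re1 // Im1.
set L := ln _; set A := atan _.
have -> : rC C L + 'i * rC C A - (rC C x + 'i * rC C y) =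
    rC C (L - x) + 'i * rC C (A - y) by rewrite !rmorphB /=; ring.
apply: le_trans (nrm_le_ReIm _) _; rewrite ReC_rect ImC_rect.
set s := 2 * x + K ^+ 2 in uE.
have K2 : K ^+ 2 <= 2^-1 * K by rewrite expr2 ler_wpM2r.
have sl : - (5 / 2 * K) <= s by rewrite /s; have := sqr_ge0 K; lra.
have sr : s <= 5 / 2 * K by rewrite /s; lra.
have u4 : 4^-1 <= 1 + s.
  rewrite -uE nrm_sqr Re1 Im1; have := sqr_ge0 y.
  have : 4^-1 <= (1 + x) ^+ 2; last by lra.
  by nra.
have LE : L = ln (1 + s) / 2.
  by rewrite -uE lnXn // mulr2n -/L; lra.
have h1 : `|ln (1 + s) - s| <= 25 * K ^+ 2.
  have s1 : - 1 < s by lra.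
  apply: le_trans (ln_sub_le s1) _; rewrite ler_pdivrMr; last by lra.
  have : s ^+ 2 <= 25 / 4 * K ^+ 2 by nra.
  have : 25 / 4 * K ^+ 2 <= 25 * K ^+ 2 * (1 + s); last by lra.
  have := sqr_ge0 K; nra.
have h2 : `|L - x| <= 13 * K ^+ 2.
  have -> : L - x = (ln (1 + s) - s) / 2 + K ^+ 2 / 2 by rewrite LE /s; field.
  apply: le_trans (ler_normD _ _) _.
  have e2 : Num.norm (2^-1 : R) = 2^-1 by rewrite ger0_norm.
  have K20 : 0 <= K ^+ 2 / 2 by rewrite divr_ge0 ?sqr_ge0.
  rewrite normrM e2 (ger0_norm K20).
  by have := sqr_ge0 K; lra.
have h3 : `|A - y| <= 12 * K ^+ 2; last by lra.
pose t := y / (1 + x).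
have tE : t - y = - (x * y) / (1 + x).
  by rewrite /t; have ? : 1 + x != 0 by [rewrite gt_eqF]; field.
have tK : `|t| <= 2 * K.
  rewrite /t normrM normfV (gtr0_norm x0) ler_pdivrMr //; nra.
have ty : `|t - y| <= 2 * K ^+ 2.
  rewrite tE normrM normfV (gtr0_norm x0) ler_pdivrMr // normrN normrM.
  have : `|x| * `|y| <= K * K by apply: ler_pM.
  have := sqr_ge0 K; rewrite expr2; nra.
have -> : A - y = (A - t) + (t - y) by rewrite addrA subrK.
apply: le_trans (ler_normD _ _) _.
have := atan_sub_le t; rewrite -/A => hA.
have : t ^+ 2 <= 4 * K ^+ 2.
  rewrite -(real_normK (num_real t)); have := normr_ge0 t; nra.
have := sqr_ge0 K; lra.
Qed.

Lemma logC1 : logC 1 = 0.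
Proof.
have -> : 1 = pol 1 0 by rewrite /pol cos0 sin0 !mulr1 mulr0 rmorph1 rmorph0 mulr0 addr0.
have p0 := @pi_gt0 R.
by rewrite logC_pol // ?ln1 ?rmorph0 ?mulr0 ?addr0 //; apply/andP; split; lra.
Qed.

Lemma logC1_hasd : hasd (fun k => logC (1 + k)) 0 1.
Proof.
apply: (@hasd_quad _ _ _ _ _ 25 2^-1) => [|w]; first by rewrite invr_gt0.
by rewrite subr0 addr0 mul1r logC1 subr0 => /ltW; exact: logC1_quad.
Qed.

(** Near [z] the logarithm is log z + log(1 + k) with k = (w - z) / z, which reduces to the
    derivative at 1, provided the sum of the arguments does not wrap around. *)
Lemma logC_hasd z : slit z -> hasd logC z z^-1.
Proof.
move=> hz; have z0 := slit_neq0 hz; have /andP[a0 a1] := slit_arg hz.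
pose g w := z^-1 * (w - z).
have hg : hasd g z z^-1.
  have := hasdZ z^-1 (hasdD (hasd_id z) (hasd_cst (- z) z)).
  by rewrite addr0 mulr1.
have gz : g z = 0 by rewrite /g subrr mulr0.
have h : hasd (fun w => logC z + logC (1 + g w)) z z^-1.
  have := hasdD (hasd_cst (logC z) z) (hasd_comp (f := fun k => logC (1 + k)) (d := 1) hg _).
  by rewrite add0r mul1r; apply; rewrite gz; exact: logC1_hasd.
apply: hasd_near h _ _; first by rewrite gz addr0 logC1 addr0.
have p0 := @pi_gt0 R.
have [d d0 [d1 d2]] : exists2 d, 0 < d & d <= pi - arg z /\ d <= pi + arg z.
  exists (Num.min (pi - arg z) (pi + arg z)).
    by rewrite lt_min; apply/andP; split; lra.
  by split; rewrite ge_min lexx ?orbT.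
(* By [logC1_quad], |arg(1 + k)| <= |k| + 25 |k|^2 <= 14 |k| for |k| <= 1/2; this stays below the
   distance [d] from arg z to the ends of the interval. *)
have e0 : 0 < nrm z * Num.min 2^-1 (d / 14).
  by rewrite mulr_gt0 ?nrm_gt0 // lt_min invr_gt0 ltr0n divr_gt0.
apply: filterS (near_nrm z e0) => w hw.
have [k1 k2] : nrm (g w) < 2^-1 /\ nrm (g w) < d / 14.
  apply/andP; rewrite -lt_min /g nrmM nrmV mulrC ltr_pdivrMr ?nrm_gt0 //.
  by rewrite mulrC.
set k := g w in k1 k2 *.
have wE : w = z * (1 + k) by rewrite /k /g mulrDr mulr1 mulVKf // addrC subrK.
have Re1 : ReC (1 + k) = 1 + ReC k by rewrite raddfD /= -(rmorph1 (rC C)) ReC_rC.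
have u0 : 1 + k != 0.
  apply/eqP => e; have : ReC (1 + k) = 0 by rewrite e raddf0.
  by rewrite Re1; have := ReC_le k; rewrite ler_norml => /andP[]; lra.
rewrite [in RHS]wE logCM //.
have : `|arg (1 + k)| <= 14 * nrm k.
  have -> : arg (1 + k) = ImC (logC (1 + k)) by rewrite /logC ImC_rect.
  apply: le_trans (ImC_le _) _; rewrite -(subrK k (logC (1 + k))).
  apply: le_trans (nrmD _ _) _; have := logC1_quad (ltW k1).
  have : nrm k ^+ 2 <= 2^-1 * nrm k by rewrite expr2 ler_wpM2r ?nrm_ge0 // ltW.
  by have := nrm_ge0 k; lra.
rewrite ler_norml => /andP[b1 b2]; apply/andP; split; lra.
Qed.

End Logarithm.

(** * Polylogarithms in the unit disc *)

Section Stripping.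
Implicit Types (u v w : word) (x y : letter) (p q : shalg).

Definition rstripw x w : shalg :=
  if rev w is y :: w' then (if y == x then wd (rev w') else 0) else 0.
Definition lstripw x w : shalg :=
  if w is y :: w' then (if y == x then wd w' else 0) else 0.
Definition rstrip x : shalg -> shalg := lext (rstripw x).
Definition lstrip x : shalg -> shalg := lext (lstripw x).
HB.instance Definition _ x := GRing.Linear.on (rstrip x).
HB.instance Definition _ x := GRing.Linear.on (lstrip x).

Lemma rstripw_rcons x w y : rstripw x (rcons w y) = if y == x then wd w else 0.
Proof. by rewrite /rstripw rev_rcons revK. Qed.

Lemma rstrip_wd x w : rstrip x (wd w) = rstripw x w. Proof. exact: lext_wd. Qed.
Lemma lstrip_wd x w : lstrip x (wd w) = lstripw x w. Proof. exact: lext_wd. Qed.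

Lemma rstrip_concat x p y :
  rstrip x (concat p (wd [:: y])) = if y == x then p else 0.
Proof.
move: p; apply: (@linear_eq_wd _ (fun p => rstrip x (concat p (wd [:: y])))
  (fun p => if y == x then p else 0)).
- by move=> c p q; rewrite concat_linearl linearP.
- by move=> c p q; case: eqP => _ //; rewrite scaler0 addr0.
by move=> w; rewrite concat_wd cats1 rstrip_wd rstripw_rcons.
Qed.

Lemma lstrip_lcons x p y : lstrip x (lcons y p) = if y == x then p else 0.
Proof.
move: p; apply: (@linear_eq_wd _ (fun p => lstrip x (lcons y p))
  (fun p => if y == x then p else 0)).
- by move=> c p q; rewrite !linearP.
- by move=> c p q; case: eqP => _ //; rewrite scaler0 addr0.
by move=> w; rewrite lcons_wd lstrip_wd.
Qed.

Lemma shmul0 p : shmul p 0 = 0. Proof. exact: (mulr0 p). Qed.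
Lemma sh0mul p : shmul 0 p = 0. Proof. exact: (mul0r p). Qed.

(** Deleting a given last letter is a derivation of the shuffle product, and so is deleting a given
    first letter. The differential equation of S is written with these operators, so that its
    multiplicativity reduces to the product rule. *)
Lemma rstrip_shw x u v : rstrip x (shw u v) =
  shmul (rstripw x u) (wd v) + shmul (wd u) (rstripw x v).
Proof.
case/lastP: u => [|u y].
  by rewrite shw0l rstrip_wd {1}/rstripw /= sh0mul add0r shmul1p.
case/lastP: v => [|v t].
  by rewrite shw0r rstrip_wd {2}/rstripw /= shmul0 addr0 shmulp1.
rewrite shw_rcons linearD /= !rstrip_concat !rstripw_rcons.
by congr (_ + _); case: ifP => _; rewrite ?shmul_wd ?shmul0 ?sh0mul.
Qed.

Lemma lstrip_shw x u v : lstrip x (shw u v) =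
  shmul (lstripw x u) (wd v) + shmul (wd u) (lstripw x v).
Proof.
case: u => [|y u].
  by rewrite shw0l lstrip_wd {1}/lstripw /= sh0mul add0r shmul1p.
case: v => [|t v].
  by rewrite shw0r lstrip_wd {2}/lstripw /= shmul0 addr0 shmulp1.
rewrite shw_cons linearD /= !lstrip_lcons /lstripw.
by congr (_ + _); case: ifP => _; rewrite ?shmul_wd ?shmul0 ?sh0mul.
Qed.

Lemma size_shuffles_bin u v :
  size (shuffles u v) = 'C(size u + size v, size u).
Proof.
elim: u v => [|x u IHu] v; first by rewrite bin0.
elim: v => [|y v IHv]; first by rewrite /= addn0 binn.
have -> : size (shuffles (x :: u) (y :: v)) =
    (size (shuffles u (y :: v)) + size (shuffles (x :: u) v))%N.
  by rewrite /= size_cat !size_map.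
by rewrite IHu IHv /= !addSn !addnS binS addnC.
Qed.

Lemma all_shuffles (P : pred letter) u v w :
  w \in shuffles u v -> all P w = all P u && all P v.
Proof.
elim: u v w => [|x u IHu] v w /=; first by rewrite inE => /eqP ->.
elim: v w => [|y v IHv] w /=; first by rewrite inE andbT => /eqP ->.
rewrite mem_cat => /orP[] /mapP[w' /[swap] -> /=] => [/IHu|/IHv] -> /=.
  by rewrite andbA.
by rewrite andbCA.
Qed.

(* The two ways of moving a letter across the cut of a factorisation. *)
Lemma dec_strip (A : comAlgType rat) (f g : {linear shalg -> A}) x w :
  dec (fun u v => f (rstripw x u) * g (wd v)) w =
  dec (fun u v => f (wd u) * g (lstripw x v)) w.
Proof.
rewrite /dec big_ord_recl big_ord_recr /= take0 drop_size.
rewrite {1}/rstripw /= linear0 mul0r add0r linear0 mulr0 addr0.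
apply: eq_bigr => i _; rewrite /bump add1n.
rewrite (take_nth la) // rstripw_rcons [drop i w](drop_nth la) //=.
by case: (_ == x); rewrite // !linear0 mulr0 mul0r.
Qed.

End Stripping.

(** * Taylor coefficients of the series S_w *)

Section Coefficients.
Variable R : realType.
Implicit Types (u v w : word) (x y : letter).

(* [pcoef w n] is the n-th Taylor coefficient s_w(n) of the series S_w with
   L = exp(log z b) S.  The differential equation of L reads, for w = u y,
   n s_w(n) = (if y = a then sum_(i < n) s_u(i) else s_u(n)) -
   (if w = b v then s_v(n) else 0), see [pcoef_euler]; the first argument of
   [pcoef_rec] is fuel. *)
Fixpoint pcoef_rec (m : nat) w (n : nat) : R :=
  if m is m'.+1 then
    if w is x :: w' then
      if n is 0%N then 0 else
      n%:R^-1 * ((if last x w' then \sum_(i < n) pcoef_rec m' (belast x w') i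
                  else pcoef_rec m' (belast x w') n) -
                 (if x then 0 else pcoef_rec m' w' n))
    else (n == 0%N)%:R
  else ((w == [::]) && (n == 0%N))%:R.

Definition pcoef w n := pcoef_rec (size w) w n.

Definition last_part u y n := if y then \sum_(i < n) pcoef u i else pcoef u n.
Definition head_part w n := if w is false :: w' then pcoef w' n else 0.

Lemma pcoef_nil n : pcoef [::] n = (n == 0%N)%:R. Proof. by []. Qed.

Lemma pcoef0 w : pcoef w 0 = (w == [::])%:R.
Proof. by case: w => [|[] w]. Qed.

Lemma pcoef_rcons u y n :
  pcoef (rcons u y) n.+1 = n.+1%:R^-1 *
    (last_part u y n.+1 - head_part (rcons u y) n.+1).
Proof.
rewrite /pcoef size_rcons /=; case E : (rcons u y) => [|x w'].
  by case: u E.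
have -> : last x w' = y by have := last_rcons x u y; rewrite E.
have bE : belast x w' = u.
  by case: u E => [|z u] /= [<- <-] //; rewrite belast_rcons.
rewrite bE; congr (_ * (_ - _)).
case: x E bE => // E bE; rewrite /pcoef; congr (pcoef_rec _ _ _).
by have := congr1 size E; rewrite size_rcons => -[].
Qed.

Lemma pcoef_euler u y n :
  n%:R * pcoef (rcons u y) n = last_part u y n - head_part (rcons u y) n.
Proof.
case: n => [|n]; last by rewrite pcoef_rcons mulVKf // pnatr_eq0.
have e0 u' y' : pcoef (rcons u' y') 0 = 0.
  by rewrite pcoef0 -size_eq0 size_rcons.
rewrite mul0r /last_part; case: y.
  by rewrite big_ord0 sub0r; case: u => [|[] u] /=; rewrite ?e0 oppr0.
by case: u => [|[] u] /=; rewrite ?e0 pcoef0 ?subrr.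
Qed.

End Coefficients.

Section PowerSeriesOfWords.
Variables (R : realType) (C : complexes R).
Implicit Types (u v w : word) (x y : letter) (z : C).

(** One factor per letter: in the recursion at index n+1 the numerator is at most ((n+1) + 1)
    (n+2)^k, where k is the size of the word without its last letter. *)
Lemma pcoef_bound w n : `|pcoef R w n| <= n.+1%:R ^+ size w.
Proof.
have [m] := ubnP (size w); elim: m w n => // m IH w n.
case/lastP: w => [|u y].
  by rewrite pcoef_nil expr0; case: n => [|n]; rewrite ?normr1 ?normr0.
rewrite size_rcons ltnS => um.
case: n => [|n].
  by rewrite pcoef0 -size_eq0 size_rcons normr0 exprn_ge0.
set k := size u in um *.
have p0 : 0 <= n.+2%:R ^+ k :> R by rewrite exprn_ge0.
have hl : `|last_part R u y n.+1| <= n.+1%:R * n.+2%:R ^+ k.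
  rewrite /last_part; case: y.
    apply: le_trans (ler_norm_sum _ _ _) _.
    rewrite mulr_natl -[X in _ *+ X]card_ord -sumr_const; apply: ler_sum => i _.
    apply: le_trans (IH _ _ _) _ => //.
    by apply: lerXn2r; rewrite ?nnegrE // ler_nat; case: i => i /= ; lia.
  apply: le_trans (IH _ _ _) _ => //.
  by rewrite ler_peMl // ler1n.
have hh : `|head_part R (rcons u y) n.+1| <= n.+2%:R ^+ k.
  case E : (rcons u y) => [|[] w'] /=; rewrite ?normr0 //.
  have sw' : size w' = k by have := congr1 size E; rewrite size_rcons => -[].
  by rewrite -sw'; apply: IH; rewrite sw'.
rewrite pcoef_rcons normrM normfV normr_nat.
rewrite -ler_pdivlMl ?invr_gt0 ?ltr0n // invrK.
apply: le_trans (ler_normB _ _) _.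
apply: le_trans (lerD hl hh) _.
rewrite exprS -[X in _ + X <= _]mul1r -mulrDl natr1 -[leLHS]mul1r.
by apply: ler_wpM2r; [rewrite mulr_ge0|rewrite ler1n].
Qed.

Lemma radius1_pcoef w : radius1 (pcoef R w).
Proof. by apply: (@radius1_poly _ _ (size w)) => n; exact: pcoef_bound. Qed.

Lemma radius1_sum_pcoef u : radius1 (fun n => \sum_(i < n) pcoef R u i).
Proof.
apply: (@radius1_poly _ _ (size u).+1) => n.
apply: le_trans (ler_norm_sum _ _ _) _.
apply: le_trans (_ : \sum_(i < n) n.+1%:R ^+ size u <= _).
  apply: ler_sum => i _; apply: le_trans (pcoef_bound _ _) _.
  by apply: lerXn2r; rewrite ?nnegrE // ler_nat; case: i => i /=; lia.
rewrite sumr_const card_ord exprS -[leLHS]mulr_natl.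
by apply: ler_wpM2r; [rewrite exprn_ge0|rewrite ler_nat].
Qed.

Definition Sw w z : C := pser (pcoef R w) z.
Definition omega x z : C := if x then (1 - z)^-1 else z^-1.
Definition head_Sw w z : C := if w is false :: w' then Sw w' z else 0.

Lemma pser_zero z : pser (fun=> 0) z = 0.
Proof.
rewrite /pser; apply: csum_eq.
  by exists 0 => N; rewrite big1 // => i _; rewrite nrm_pterm normr0 mul0r.
have -> : (fun N => \sum_(i < N) pterm (fun=> 0) z i) = fun=> 0.
  by apply/funext => N; rewrite big1 // => i _; rewrite /pterm rmorph0 mul0r.
exact: Ccvg_cst.
Qed.

Lemma lt1_neq1 z : nrm z < 1 -> 1 - z != 0.
Proof.
by apply: contraTneq => /eqP; rewrite subr_eq0 => /eqP <-; rewrite nrm1 ltxx.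
Qed.

(** The generating function [T] of the partial sums satisfies T = z (T + S_u). *)
Lemma pser_sum_pcoef u z : nrm z < 1 ->
  pser (fun n => \sum_(i < n) pcoef R u i) z = z * ((1 - z)^-1 * Sw u z).
Proof.
move=> z1; have n1 := lt1_neq1 z1.
set T := pser _ _.
have E : T = z * (T + Sw u z).
  rewrite {1}/T pser_recl //; last exact: radius1_sum_pcoef.
  rewrite big_ord0 rmorph0 add0r; congr (_ * _).
  rewrite -pserD //; [|exact: radius1_sum_pcoef|exact: radius1_pcoef].
  by apply: eq_pser => n; rewrite big_ord_recr.
have {}E : (1 - z) * T = z * Sw u z by rewrite mulrBl mul1r {1}E; ring.
by rewrite mulrCA -E mulKf.
Qed.

(** The operator z d/dz multiplies the n-th coefficient by n, so this is [pcoef_euler] divided by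
    z. *)
Lemma Sw_hasd u y z : nrm z < 1 -> z != 0 ->
  hasd (Sw (rcons u y)) z (omega y z * Sw u z - z^-1 * head_Sw (rcons u y) z).
Proof.
move=> z1 z0; have rw := radius1_pcoef (rcons u y).
have := pser_hasd rw z1; congr hasd.
have rh : radius1 (head_part R (rcons u y)).
  case: (rcons u y) => [|[] w']; last exact: radius1_pcoef;
  by move=> r _; exists 0 => n; rewrite normr0 mul0r.
have rl : radius1 (last_part R u y).
  by case: (y); [exact: radius1_sum_pcoef|exact: radius1_pcoef].
have E : z * pser (pdiff (pcoef R (rcons u y))) z =
    pser (last_part R u y) z - pser (head_part R (rcons u y)) z.
  transitivity (pser (fun n => n%:R * pcoef R (rcons u y) n) z).
    rewrite [RHS]pser_recl //; first by rewrite mul0r rmorph0 add0r.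
    apply: radius1_le (radius1_mulS rw) _ => n.
    by rewrite !normrM !normr_nat ler_wpM2r // ler_nat.
  rewrite -pserN // -pserD //; last first.
    by move=> r hr; have [K hK] := rh r hr; exists K => n; rewrite normrN.
  by apply: eq_pser => n; rewrite pcoef_euler.
rewrite -[LHS](mulKf z0) E mulrBr; congr (_ - _).
  rewrite /last_part /omega; case: (y); last by [].
  by rewrite pser_sum_pcoef // mulKf.
congr (_ * _); rewrite /head_part /head_Sw; case: (rcons u y) => [|[] w'] //;
exact: pser_zero.
Qed.

Lemma Sw_nil z : nrm z < 1 -> Sw [::] z = 1.
Proof.
move=> z1; rewrite /Sw pser_recl //; last exact: radius1_pcoef.
rewrite [X in _ * X](_ : _ = 0) ?mulr0 ?addr0 ?rmorph1 //.
exact: pser_zero.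
Qed.

Lemma Sw_cont w z : nrm z < 1 -> Sw w @ nbhs z --> Sw w z.
Proof. by move=> z1; apply: hasd_cont (pser_hasd (radius1_pcoef w) z1). Qed.

Lemma Sw0 w : Sw w 0 = (w == [::])%:R.
Proof. by rewrite /Sw pser0 pcoef0 rmorph_nat. Qed.

Definition Sh h z : C := lext (fun w => Sw w z : ratalg C) h.

Lemma Sh_wd z w : Sh (wd w) z = Sw w z.
Proof. exact: (@lext_wd (ratalg C)). Qed.

Lemma Sh_lin c p q z : Sh (c *: p + q) z = ratr c * Sh p z + Sh q z.
Proof. exact: (lext_is_linear (fun w => Sw w z : ratalg C) c p q). Qed.

Lemma Sh0 z : Sh 0 z = 0.
Proof. exact: (linear0' (lext_is_linear (fun w => Sw w z : ratalg C))). Qed.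

Lemma rstrip_lin x c p q : rstrip x (c *: p + q) = c *: rstrip x p + rstrip x q.
Proof. exact: (lext_is_linear (rstripw x)). Qed.
Lemma lstrip_lin x c p q : lstrip x (c *: p + q) = c *: lstrip x p + lstrip x q.
Proof. exact: (lext_is_linear (lstripw x)). Qed.

Lemma Sw_hasd2 w z : nrm z < 1 -> z != 0 -> hasd (Sw w) z
  (omega la z * Sh (rstripw la w) z + omega lb z * Sh (rstripw lb w) z -
   z^-1 * Sh (lstripw lb w) z).
Proof.
move=> z1 z0; case/lastP: w => [|u y].
  rewrite /rstripw /lstripw /= !Sh0 !mulr0 subr0 addr0.
  apply: hasd_near (hasd_cst 1 z) _ _; first by rewrite Sw_nil.
  have e0 : 0 < 1 - nrm z by rewrite subr_gt0.
  apply: filterS (near_nrm z e0) => t tz; rewrite Sw_nil //.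
  by have := nrmD (t - z) z; rewrite subrK; lra.
have := Sw_hasd u y z1 z0; congr hasd; congr (_ - _ * _).
  by rewrite !rstripw_rcons; case: y; rewrite /= Sh_wd Sh0 mulr0 ?addr0 ?add0r.
by rewrite /head_Sw /lstripw; case: (rcons u y) => [|[] w'] /=;
  rewrite ?Sh0 ?Sh_wd.
Qed.

Lemma Sh_hasd h z : nrm z < 1 -> z != 0 -> hasd (Sh h) z
  (omega la z * Sh (rstrip la h) z + omega lb z * Sh (rstrip lb h) z -
   z^-1 * Sh (lstrip lb h) z).
Proof.
move=> z1 z0; move: h; apply: shalg_ind => [w||c p q hp hq].
- rewrite !rstrip_wd lstrip_wd; apply: hasd_eq (Sw_hasd2 w z1 z0) _ => t.
  by rewrite Sh_wd.
- rewrite !linear0 !Sh0 !mulr0 subr0 addr0.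
  by apply: hasd_eq (hasd_cst 0 z) _ => t; rewrite Sh0.
have h := hasdD (hasdZ (ratr c) hp) hq.
have e x : Sh (rstrip x (c *: p + q)) z =
    ratr c * Sh (rstrip x p) z + Sh (rstrip x q) z.
  by rewrite rstrip_lin; exact: Sh_lin.
have e' : Sh (lstrip lb (c *: p + q)) z =
    ratr c * Sh (lstrip lb p) z + Sh (lstrip lb q) z.
  by rewrite lstrip_lin; exact: Sh_lin.
rewrite !e e'.
apply: (@hasd_eq _ _ (fun t => ratr c * Sh p t + Sh q t)) => [|t]; last first.
  by rewrite Sh_lin.
move: h; congr hasd.
move: (Sh (rstrip la p) z) (Sh (rstrip lb p) z) (Sh (lstrip lb p) z) => a b d.
move: (Sh (rstrip la q) z) (Sh (rstrip lb q) z) (Sh (lstrip lb q) z) => a' b' d'.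
move: (omega la z) (omega lb z) (ratr c : C) => o o' r; ring.
Qed.

Lemma Sh_cont h z : nrm z < 1 -> Sh h @ nbhs z --> Sh h z.
Proof.
move=> z1; move: h; apply: shalg_ind => [w||c p q hp hq].
- rewrite Sh_wd; have h := Sw_cont (w := w) z1; refine (Ccvg_near h _).
  by apply: nearW => t; rewrite Sh_wd.
- rewrite Sh0; have h : (fun _ : C => 0 : C) @ nbhs z --> (0 : C) by exact: Ccvg_cst.
  refine (Ccvg_near h _).
  by apply: nearW => t; rewrite Sh0.
rewrite Sh_lin.
have hc : (fun _ : C => ratr c : C) @ nbhs z --> (ratr c : C) by exact: Ccvg_cst.
refine (Ccvg_near (CcvgD (CcvgM hc hp) hq) _).
by apply: nearW => t; rewrite Sh_lin.
Qed.

(** The differential equations have a pole at 0, where continuity takes over: [f] is constant on the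
    segment from t z to z, and t tends to 0. *)
Lemma const_disc (f : C -> C) z : (forall w : C, nrm w < 1 -> w != 0 -> hasd f w 0) ->
  f @ nbhs (0 : C) --> f 0 -> nrm z < 1 -> f z = f 0.
Proof.
move=> hf cf z1; have [->//|z0] := eqVneq z 0.
have cst (t : R) : 0 < t <= 1 -> f (rC C t * z) = f z.
  move=> /andP[t0 t1]; apply: hasd0_const => s /andP[s0 s1].
  have -> : seg (rC C t * z) z s = rC C (t + s * (1 - t)) * z.
    by rewrite /seg rmorphD rmorphM rmorphB rmorph1 /=; ring.
  have c0 : 0 < t + s * (1 - t) by nra.
  apply: hf.
    rewrite nrmM nrm_rC gtr0_norm //; apply: le_lt_trans z1.
    by rewrite ler_piMl ?nrm_ge0 //; nra.
  by rewrite mulf_neq0 // -(rmorph0 (rC C)) (inj_eq (@rC_inj _ _)) gt_eqF.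
apply/eqP; rewrite -subr_eq0 -nrm_eq0 eq_le nrm_ge0 andbT leNgt; apply/negP => e0.
move/cvgCP: cf => /(_ _ e0) /nearCP[d d0 hd].
pose t : R := Num.min 1 (d / 2).
have t0 : 0 < t by rewrite lt_min ltr01 divr_gt0.
have td : t <= d / 2 by rewrite ge_min lexx orbT.
have hz : nrm (rC C t * z - 0) < d.
  by rewrite subr0 nrmM nrm_rC gtr0_norm //; have := nrm_ge0 z; nra.
by have := hd _ hz; rewrite cst ?ltxx // t0 ge_min lexx.
Qed.

(** By induction on the total size, the difference of the two sides has zero derivative, the
    stripping operators being derivations; for nonempty words it vanishes at 0. *)
Lemma Sh_mul_wd u v z : nrm z < 1 -> Sh (shw u v) z = Sw u z * Sw v z.
Proof.
have [n] := ubnP (size u + size v); elim: n u v z => // n IH u v z.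
rewrite ltnS => uv z1.
have [->|u0] := eqVneq u [::]; first by rewrite shw0l Sh_wd Sw_nil // mul1r.
have [->|v0] := eqVneq v [::]; first by rewrite shw0r Sh_wd Sw_nil // mulr1.
apply/eqP; rewrite -subr_eq0; apply/eqP.
pose f (t : C) := Sh (shw u v) t - Sw u t * Sw v t.
have rsize x (w : word) : w != [::] -> rstripw x w = 0 \/
    exists2 w', rstripw x w = wd w' & (size w' < size w)%N.
  case/lastP: w => // w y _; rewrite rstripw_rcons; case: eqP => _; last by left.
  by right; exists w; rewrite ?size_rcons.
have lsize x (w : word) : w != [::] -> lstripw x w = 0 \/
    exists2 w', lstripw x w = wd w' & (size w' < size w)%N.
  case: w => // y w _ /=; case: eqP => _; last by left.
  by right; exists w.
have IHl p (t : C) : nrm t < 1 ->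
      p = 0 \/ (exists2 u', p = wd u' & (size u' < size u)%N) ->
    Sh (shmul p (wd v)) t = Sh p t * Sw v t.
  move=> w1 [->|[u' -> su]]; first by rewrite sh0mul Sh0 mul0r.
  by rewrite shmul_wd Sh_wd IH //; apply: leq_trans uv; rewrite ltn_add2r.
have IHr p (t : C) : nrm t < 1 ->
      p = 0 \/ (exists2 v', p = wd v' & (size v' < size v)%N) ->
    Sh (shmul (wd u) p) t = Sw u t * Sh p t.
  move=> w1 [->|[v' -> sv]]; first by rewrite shmul0 Sh0 mulr0.
  by rewrite shmul_wd Sh_wd IH //; apply: leq_trans uv; rewrite ltn_add2l.
have ShD p q (t : C) : Sh (p + q) t = Sh p t + Sh q t.
  by rewrite -[p]scale1r Sh_lin rmorph1 mul1r scale1r.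
rewrite -/(f z) (const_disc (f := f) _ _ z1).
- rewrite /f !Sw0 (negbTE u0) mul0r subr0.
  rewrite /Sh [LHS]lext_shw big_seq big1 // => w /size_shuffles sw.
  rewrite Sw0 -size_eq0 sw addn_eq0 size_eq0 (negbTE u0); by [].
- move=> t w1 w0.
  have := hasdD (Sh_hasd (shw u v) w1 w0)
    (hasdN (hasdM (Sw_hasd2 u w1 w0) (Sw_hasd2 v w1 w0))).
  rewrite !rstrip_shw lstrip_shw !ShD.
  rewrite !(IHl _ _ w1 (rsize _ _ u0)) !(IHr _ _ w1 (rsize _ _ v0)).
  rewrite (IHl _ _ w1 (lsize _ _ u0)) (IHr _ _ w1 (lsize _ _ v0)).
  by congr hasd; ring.
have n01 : nrm (0 : C) < 1 by rewrite nrm0.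
apply: CcvgB; last by apply: CcvgM; exact: Sw_cont.
exact: Sh_cont.
Qed.

End PowerSeriesOfWords.

(** * The values L_w(z) and their differential equation *)

Section Polylog.
Variables (R : realType) (C : complexes R).
Implicit Types (u v w : word) (x y : letter) (z t : C).
Notation A := (ratalg C).

Lemma gammaS z : nrm z < 1 -> exists g : Gamma A, forall w, g (wd w) = Sw w z.
Proof.
move=> z1; apply: gamma_word => [|u v]; first exact: Sw_nil.
exact: Sh_mul_wd.
Qed.

(** Coordinates of the point exp(t beta). *)
Definition ew t w : C :=
  if all negb w then t ^+ size w / (size w)`!%:R else 0.

Lemma gammaE t : exists g : Gamma A, forall w, g (wd w) = ew t w.
Proof.
apply: gamma_word => [|u v]; first by rewrite /ew /= expr0 fact0 divr1.
rewrite lext_shw big_seq.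
rewrite (eq_bigr (fun=> if all negb u && all negb v then
   t ^+ (size u + size v) / (size u + size v)`!%:R else 0)); last first.
  by move=> w h; rewrite /ew (all_shuffles _ h) (size_shuffles h).
rewrite -big_seq big_const_seq count_predT size_shuffles_bin iter_addr_0 /ew.
case: (all negb u) => /=; last by rewrite mul0rn mul0r.
case: (all negb v) => /=; last by rewrite mul0rn mulr0.
have /(congr1 (fun n : nat => n%:R : C)) := bin_fact (leq_addr (size v) (size u)).
rewrite addKn !natrM => <-; rewrite exprD -[LHS]mulr_natr.
have f0 n : n`!%:R != 0 :> C by rewrite pnatr_eq0 -lt0n fact_gt0.
have b0 : 'C(size u + size v, size u)%:R != 0 :> C.
  by rewrite pnatr_eq0 -lt0n bin_gt0 leq_addr.
move: (f0 (size u)) (f0 (size v)) b0.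
move: (_`!%:R : C) (_`!%:R : C) ('C(_, _)%:R : C) (t ^+ _) (t ^+ _).
by move=> a b c d e a0 b0 c0; field; rewrite a0 b0 c0.
Qed.

(* The value L_w(z): the coefficient at [w] of exp(log z b) S(z). *)
Definition F w z : C :=
  dec (fun u v => (ew (logC z) u * Sw v z : C) : A) w.

Lemma gammaF z : nrm z < 1 -> exists g : Gamma A, forall w, g (wd w) = F w z.
Proof.
move=> z1; have [gs hs] := gammaS z1; have [ge he] := gammaE (logC z).
exists (ge * gs)%g => w; rewrite [LHS]convol_wd; apply: eq_dec => u v.
by rewrite he hs.
Qed.

Lemma F_nil z : nrm z < 1 -> F [::] z = 1.
Proof. by move=> /gammaF[g <-]; exact: rmorph1. Qed.

Lemma F_head_a w z : head la w != lb -> F w z = Sw w z.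
Proof.
case: w => [|[] w] // _.
  by rewrite /F dec0 /ew /= expr0 fact0 divr1 mul1r.
rewrite /F dec_cons {1}/ew /= expr0 fact0 divr1 mul1r.
by rewrite /dec big1 ?addr0 // => i _; rewrite /ew /= mul0r.
Qed.

Lemma Sw_b z : Sw [:: lb] z = 0.
Proof.
rewrite -[RHS](pser_zero z); apply: eq_pser => -[|n] //.
by rewrite -[[:: lb]]/(rcons [::] lb) pcoef_rcons /= subrr mulr0.
Qed.

Lemma F_b z : nrm z < 1 -> F [:: lb] z = logC z.
Proof.
move=> z1; rewrite /F dec_cons dec0 Sw_b mulr0 add0r Sw_nil // mulr1.
by rewrite /ew /= expr1 factS fact0 divr1.
Qed.

Lemma ew_hasd (ge : Gamma A) u z : slit z ->
  (forall w, ge (wd w) = ew (logC z) w) ->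
  hasd (fun z => ew (logC z) u) z (z^-1 * (ge (rstripw lb u) : C)).
Proof.
move=> sz he; case/lastP: u => [|u x].
  rewrite /rstripw /= linear0 mulr0; apply: hasd_eq (hasd_cst 1 z) _ => s.
  by rewrite /ew /= expr0 fact0 divr1.
rewrite rstripw_rcons; case: x => /=.
  rewrite linear0 mulr0; apply: hasd_eq (hasd_cst 0 z) _ => s.
  by rewrite /ew all_rcons.
rewrite he /ew; have [ub|ub] := boolP (all negb u); last first.
  rewrite mulr0; apply: hasd_eq (hasd_cst 0 z) _ => s.
  by rewrite all_rcons (negbTE ub) andbF.
have hX n : hasd (fun z => logC z ^+ n.+1) z (n.+1%:R * logC z ^+ n * z^-1).
  elim: n => [|n IH].
    by rewrite expr0 !mulr1 mul1r; apply: hasd_eq (logC_hasd sz) _ => s; rewrite expr1.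
  have := hasdM (logC_hasd sz) IH.
  have -> : z^-1 * logC z ^+ n.+1 + logC z * (n.+1%:R * logC z ^+ n * z^-1) =
      n.+2%:R * logC z ^+ n.+1 * z^-1 by rewrite exprS -natr1; ring.
  by move=> h; apply: hasd_eq h _ => s; rewrite -exprS.
have := hasdZ ((size u).+1`!%:R^-1) (hX (size u)).
have f0 n : n`!%:R != 0 :> C by rewrite pnatr_eq0 -lt0n fact_gt0.
have -> : (size u).+1`!%:R^-1 * ((size u).+1%:R * logC z ^+ size u * z^-1) =
    z^-1 * (logC z ^+ size u / (size u)`!%:R).
  rewrite factS natrM; have s0 : (size u).+1%:R != 0 :> C by rewrite pnatr_eq0.
  move: (f0 (size u)) s0 (z^-1) (logC z ^+ _); move: (_`!%:R : C) (_.+1%:R : C).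
  by move=> a b a0 b0 c d; field; rewrite a0 b0.
move=> h; apply: hasd_eq h _ => s.
by rewrite all_rcons /= ub size_rcons mulrC.
Qed.

(** Differentiating the logarithmic factor strips a final b from the left part of a cut, and
    differentiating S strips an initial b from the right part with the opposite sign. [dec_strip]
    cancels the two families, leaving only the last letter of the word. *)
Lemma F_hasd w x z : nrm z < 1 -> slit z ->
  hasd (F (rcons w x)) z (omega x z * F w z).
Proof.
move=> z1 sz; have z0 := slit_neq0 sz.
have [gs hs] := gammaS z1; have [ge he] := gammaE (logC z).
have hSh p : Sh p z = gs p.
  by rewrite /Sh -[RHS](linear_eq_wd (f := lext (fun w => Sw w z : A)) (g := gs))
     //; [exact: linearP|exact: linearP|move=> v; rewrite lext_wd hs].
pose d1 u v : C := z^-1 * (ge (rstripw lb u) : C) * (gs (wd v) : C).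
pose d2 u v : C := omega la z * (ge (wd u) * gs (rstripw la v) : C) +
  omega lb z * (ge (wd u) * gs (rstripw lb v) : C).
pose d3 u v : C := z^-1 * (ge (wd u) * gs (lstripw lb v) : C).
have H : hasd (F (rcons w x)) z
    (\sum_(i < (size (rcons w x)).+1)
      (d1 (take i (rcons w x)) (drop i (rcons w x)) +
       d2 (take i (rcons w x)) (drop i (rcons w x)) -
       d3 (take i (rcons w x)) (drop i (rcons w x)))).
  apply: hasd_sum => i; set u := take _ _; set v := drop _ _.
  have := hasdM (ew_hasd u sz he) (Sw_hasd2 v z1 z0).
  rewrite !hSh -he -hs /d1 /d2 /d3; congr hasd.
  move: (ge _ : C) (gs _ : C) (ge _ : C) (gs _ : C) (gs _ : C) (gs _ : C).
  move: (omega _ _) (omega _ _) (z^-1).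
  by move=> o1 o2 z' a b c d e f; ring.
move: H; congr hasd.
have -> : \sum_(i < (size (rcons w x)).+1)
      (d1 (take i (rcons w x)) (drop i (rcons w x)) +
       d2 (take i (rcons w x)) (drop i (rcons w x)) -
       d3 (take i (rcons w x)) (drop i (rcons w x))) =
    \sum_(i < (size (rcons w x)).+1) d1 (take i (rcons w x)) (drop i (rcons w x)) +
    \sum_(i < (size (rcons w x)).+1) d2 (take i (rcons w x)) (drop i (rcons w x)) -
    \sum_(i < (size (rcons w x)).+1) d3 (take i (rcons w x)) (drop i (rcons w x)).
  by rewrite sumrB big_split.
have -> : \sum_(i < (size (rcons w x)).+1)
    d1 (take i (rcons w x)) (drop i (rcons w x)) =
  \sum_(i < (size (rcons w x)).+1) d3 (take i (rcons w x)) (drop i (rcons w x)).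
  have := congr1 (fun s : A => z^-1 * (s : C)) (dec_strip ge gs lb (rcons w x)).
  rewrite /dec !mulr_sumr => e; rewrite /d1 /d3 -[RHS]e.
  by apply: eq_bigr => i _; rewrite mulrA.
rewrite addrAC subrr add0r.
rewrite -[LHS]/(dec (fun u v => d2 u v : A) (rcons w x)) dec_rcons.
have -> : d2 (rcons w x) [::] = 0.
  by rewrite /d2 /rstripw /= linear0 mulr0 !mulr0 addr0.
rewrite add0r /F /dec mulr_sumr; apply: eq_bigr => i _.
rewrite /d2 !rstripw_rcons he; case: x => /=;
  by rewrite linear0 !mulr0 ?addr0 ?add0r hs.
Qed.

End Polylog.

(** * Generators of the shuffle algebra *)

Section Generation.
Variable A : comAlgType rat.
Implicit Types (g h : Gamma A) (u v w : word).

Lemma shw_b_nseq n v p : shw [:: lb] v = wd (lb :: v) + p ->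
  shw [:: lb] (nseq n lb ++ v) =
    n.+1%:R *: wd (nseq n.+1 lb ++ v) + iter n (lcons lb) p.
Proof.
move=> e; elim: n => [|n IH]; first by rewrite e scale1r.
rewrite [nseq n.+1 _ ++ _]/= shw_cons shw0l IH lcons_wd linearD /= linearZ /=.
by rewrite !lcons_wd addrA -[X in X + _ + _ = _]scale1r -scalerDl nat1r.
Qed.

(** Shuffling b with b^n v expresses b^(n+1) v through a product and words with only n leading
    letters b, after division by n+1. The predicate [Q] on the rest of the word has to survive the
    insertion of b; it is either trivial or the condition of not ending in a. *)
Lemma generation_prefix (Q : pred word) g h :
  (forall v w, Q (la :: v) -> w \in shuffles [:: lb] v -> Q (la :: w)) ->
  (forall w, head la w != lb -> Q w -> g (wd w) = h (wd w)) ->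
  g (wd [:: lb]) = h (wd [:: lb]) ->
  forall n v, head la v != lb -> Q v ->
    g (wd (nseq n lb ++ v)) = h (wd (nseq n lb ++ v)).
Proof.
move=> HQ e eb; elim=> [|n IH] v hv Qv; first exact: e.
have [p [pE gp]] : exists p, shw [:: lb] v = wd (lb :: v) + p /\
    g (iter n (lcons lb) p) = h (iter n (lcons lb) p).
  case: v hv Qv => [|[] v] // _ Qv.
    exists 0; rewrite shw0r addr0; split=> //.
    have -> : iter n (lcons lb) 0 = 0 by elim: n {IH} => //= n ->; rewrite linear0.
    by rewrite !linear0.
  exists (lcons la (shw [:: lb] v)); rewrite shw_cons shw0l lcons_wd; split=> //.
  have -> : iter n (lcons lb) (lcons la (shw [:: lb] v)) =
      \sum_(w <- shuffles [:: lb] v) wd (nseq n lb ++ la :: w).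
    elim: n {IH} => [|n IHn] /=; last rewrite IHn.
      by rewrite /shw linear_sum; apply: eq_bigr => w _; exact: lcons_wd.
    by rewrite linear_sum; apply: eq_bigr => w _; exact: lcons_wd.
  rewrite 2!linear_sum !big_seq; apply: eq_bigr => w hw.
  exact: IH (la :: w) isT (HQ _ _ Qv hw).
have := shw_b_nseq n pE => /(congr1 (fun q => n.+1%:R^-1 *: q)).
rewrite scalerDr scalerA mulVf ?pnatr_eq0 // scale1r => /eqP.
rewrite -subr_eq => /eqP <-; rewrite !linearB !linearZ /= gp.
have -> // : g (shw [:: lb] (nseq n lb ++ v)) = h (shw [:: lb] (nseq n lb ++ v)).
by rewrite -shmul_wd !rmorphM /= eb IH.
Qed.

Lemma word_prefix w : exists n v, w = nseq n lb ++ v /\ head la v != lb.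
Proof.
elim: w => [|[] w [n [v [-> hv]]]]; first by exists 0%N, [::].
  by exists 0%N, (la :: (nseq n lb ++ v)).
by exists n.+1, v.
Qed.

Lemma generation_b g h : (forall w, head la w != lb -> g (wd w) = h (wd w)) ->
  g (wd [:: lb]) = h (wd [:: lb]) -> g = h.
Proof.
move=> e eb; apply: Gamma_ext => w; have [n [v [-> hv]]] := word_prefix w.
by apply: (generation_prefix (Q := predT)) => // w' hw' _; exact: e.
Qed.

Lemma last_shuffles1 x c v w : w \in shuffles [:: x] v ->
  last c w = x \/ (v <> [::] /\ last c w = last c v).
Proof.
elim: v c w => [|y v IH] c w /=; first by rewrite inE => /eqP ->; left.
rewrite inE => /orP[/eqP ->|/mapP[w' hw' ->]] /=; first by right.
by have [->|[_ ->]] := IH y w' hw'; [left|right].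
Qed.

(** Leading letters b are handled first, among words not ending in a; [gsigma] then turns trailing
    letters a into leading letters b, and the same argument finishes. *)
Lemma generation_ab g h :
  (forall w, admissible w -> g (wd w) = h (wd w)) ->
  g (wd [:: lb]) = h (wd [:: lb]) -> g (wd [:: la]) = h (wd [:: la]) -> g = h.
Proof.
move=> e eb ea.
have e1 w : last lb w != la -> g (wd w) = h (wd w).
  have [n [v [-> hv]]] := word_prefix w => lw.
  apply: (generation_prefix (Q := fun w => last lb w != la)) => //.
  - move=> v' w' /= lv' /(last_shuffles1 la)[->|[_ ->]] //.
  - by move=> w' hw' lw'; apply: e; rewrite /admissible hw'.
  - by move: lw; rewrite last_cat; case: (v) hv => //; case: n.
have gE (k : Gamma A) p : gsigma k p = k (sigmaH p) by [].
have : gsigma g = gsigma h.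
  apply: generation_b => [w hw|]; rewrite !gE sigmaH_wd //.
  by apply: e1; rewrite /= ; case: w hw => [|[] w] //= _; rewrite rev_cons last_rcons.
move=> /(congr1 (fun k => gsigma k)) E; apply: Gamma_ext => w.
have := congr1 (fun k : Gamma A => k (wd w)) E.
by rewrite !gE !sigmaHK.
Qed.

End Generation.

(** * The functional relations *)

Section Relation.
Variables (R : realType) (C : complexes R).
Implicit Types (u v w : word) (x y : letter) (z t : C) (p q : shalg).
Notation A := (ratalg C).

Definition Fh p z : C := lext (fun w => F w z : A) p.

Lemma Fh_wd w z : Fh (wd w) z = F w z.
Proof. exact: (@lext_wd A). Qed.

Lemma Fh_lin c p q z : Fh (c *: p + q) z = ratr c * Fh p z + Fh q z.
Proof. exact: (lext_is_linear (fun w => F w z : A) c p q). Qed.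

Lemma Fh0 z : Fh 0 z = 0.
Proof. exact: (linear0' (lext_is_linear (fun w => F w z : A))). Qed.

Lemma Fh_gamma z (g : Gamma A) : (forall w, g (wd w) = F w z) ->
  forall p, g p = Fh p z.
Proof.
move=> e; apply: (linear_eq_wd (f := g) (g := lext (fun w => F w z : A))).
- exact: linearP.
- exact: linearP.
by move=> w; rewrite e lext_wd.
Qed.

(* The value at [z] of the form associated with a combination of letters. *)
Definition om p z : C :=
  lext (fun w => (if w is [:: x] then omega x z else 0) : A) p.

Lemma om_letter x z : om (wd [:: x]) z = omega x z.
Proof. exact: (@lext_wd A). Qed.

Lemma om_lin c p q z : om (c *: p + q) z = ratr c * om p z + om q z.
Proof. exact: (lext_is_linear (fun w => (if w is [:: x] then omega x z else 0) : A)). Qed.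

Lemma hasd_lin (f g : C -> C) (c : rat) z d e : hasd f z d -> hasd g z e ->
  hasd (fun t => ratr c * f t + g t) z (ratr c * d + e).
Proof. by move=> hf hg; exact: hasdD (hasdZ _ hf) hg. Qed.

Lemma Fh_concat_hasd p s z : lspan s -> nrm z < 1 -> slit z ->
  hasd (Fh (concat p s)) z (om s z * Fh p z).
Proof.
move=> ls z1 sz.
have hx x : forall p, hasd (Fh (concat p (wd [:: x]))) z (omega x z * Fh p z).
  apply: shalg_ind => [w||c q r hq hr].
  - rewrite concat_wd cats1 Fh_wd; apply: hasd_eq (F_hasd w x z1 sz) _ => t.
    by rewrite Fh_wd.
  - rewrite (linear0' (concat_linearl _)) Fh0 mulr0.
    by apply: hasd_eq (hasd_cst 0 z) _ => t; rewrite Fh0.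
  have := hasd_lin c hq hr; rewrite concat_linearl Fh_lin.
  rewrite mulrDr [omega x z * (_ * _)]mulrCA => h.
  by apply: hasd_eq h _ => t; rewrite Fh_lin.
case: ls => c [d ->].
have om0 : om 0 z = 0.
  exact: (linear0' (lext_is_linear
    (fun w => (if w is [:: x] then omega x z else 0) : A))).
have -> : om (c *: wd [:: la] + d *: wd [:: lb]) z =
    ratr c * omega la z + ratr d * omega lb z.
  by rewrite -[d *: _]addr0 !om_lin !om_letter om0 addr0.
have -> : concat p (c *: wd [:: la] + d *: wd [:: lb]) =
    c *: concat p (wd [:: la]) + (d *: concat p (wd [:: lb]) + 0).
  by rewrite -[d *: wd _]addr0 !concat_linearr (linear0' (concat_linearr _)).
have h0 : hasd (Fh 0) z 0 by apply: hasd_eq (hasd_cst 0 z) _ => t; rewrite Fh0.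
have h := hasd_lin c (hx la p) (hasd_lin d (hx lb p) h0).
have -> : (ratr c * omega la z + ratr d * omega lb z) * Fh p z =
    ratr c * (omega la z * Fh p z) + (ratr d * (omega lb z * Fh p z) + 0) by ring.
by apply: hasd_eq h _ => t; rewrite !Fh_lin.
Qed.

Variables (s : letter -> shalg) (m : C -> C).
Hypothesis ls : forall x, lspan (s x).

(* The coefficient at [w] of L(m(z)) s(L(z)). *)
Definition G w z : C :=
  dec (fun u v => (F u (m z) * Fh (antiext s (wd v)) z : C) : A) w.

(** By the product rule a cut contributes the last letter of its left part, through L(m(z)), and the
    first letter of its right part, through s(L(z)) since s reverses words. Moving that letter
    across the cut pairs the terms, and the relation between the forms makes each pair cancel. *)
Lemma G_hasd w z dm : nrm z < 1 -> slit z -> nrm (m z) < 1 -> slit (m z) ->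
  hasd m z dm -> (forall x, omega x (m z) * dm = - om (s x) z) ->
  hasd (G w) z 0.
Proof.
move=> z1 sz m1 sm hm e.
pose D (u : word) x v : C := F u (m z) * (om (s x) z * Fh (antiext s (wd v)) z).
pose d1 u v : C := if rev u is x :: u' then - D (rev u') x v else 0.
pose d2 u v : C := if v is x :: v' then D u x v' else 0.
have H : hasd (G w) z (\sum_(i < (size w).+1)
    (d1 (take i w) (drop i w) + d2 (take i w) (drop i w))).
  apply: hasd_sum => i; set u := take _ _; set v := drop _ _.
  have hv : hasd (Fh (antiext s (wd v))) z
     (if v is x :: v' then om (s x) z * Fh (antiext s (wd v')) z else 0).
    case: v => [|x v'].
      rewrite antiext_wd /=; apply: hasd_near (hasd_cst 1 z) _ _.
        by rewrite Fh_wd F_nil.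
      have e0 : 0 < 1 - nrm z by rewrite subr_gt0.
      apply: filterS (near_nrm z e0) => t tz; rewrite Fh_wd F_nil //.
      by have := nrmD (t - z) z; rewrite subrK; lra.
    rewrite !antiext_wd; exact: Fh_concat_hasd.
  have hu : hasd (fun t => F u (m t)) z
     (if rev u is x :: u' then omega x (m z) * F (rev u') (m z) * dm else 0).
    case/lastP: (u) => [|u' x] /=.
      rewrite /rev /=; apply: hasd_near (hasd_cst 1 z) _ _.
        by rewrite F_nil.
      have e0 : 0 < 1 - nrm (m z) by rewrite subr_gt0.
      have /cvgCP/(_ _ e0) := hasd_cont hm; apply: filterS => t tz.
      by rewrite F_nil //; have := nrmD (m t - m z) (m z); rewrite subrK; lra.
    rewrite rev_rcons revK; exact: hasd_comp hm (F_hasd u' x m1 sm).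
  have := hasdM hu hv; congr hasd; congr (_ + _); last first.
    by rewrite /d2 /D; case: (v) => [|x v']; rewrite ?mulr0.
  rewrite /d1 /D; case: (rev u) => [|x u']; rewrite ?mul0r //.
  by rewrite [omega _ _ * _]mulrC -[X in X * _]mulrA e; ring.
move: H; congr hasd; rewrite big_split /= big_ord_recl big_ord_recr /=.
rewrite /d1 /d2 take0 drop_size /= add0r addr0 -big_split big1 // => i _ /=.
rewrite /bump add1n (take_nth la) // rev_rcons revK [drop i w](drop_nth la) //=.
by rewrite addNr.
Qed.

Lemma G_gamma (ga : Gamma A -> Gamma A) (g h : Gamma A) w z :
  (forall g p, ga g p = g (antiext s p)) ->
  (forall w, g (wd w) = F w (m z)) -> (forall w, h (wd w) = F w z) ->
  (g * ga h)%g (wd w) = G w z.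
Proof.
move=> gaE gE hE; rewrite [LHS]convol_wd; apply: eq_dec => u v.
by rewrite gE gaE (Fh_gamma hE).
Qed.

End Relation.

(** * Growth at 1 and decay at 0 *)

Section Growth.
Variables (R : realType) (C : complexes R).
Implicit Types (u v w : word) (x y : letter) (z t : C) (p q : shalg).

Lemma pcoef_a_rcons u y n : head la (rcons u y) != lb ->
  pcoef R (rcons u y) n.+1 = n.+1%:R^-1 * last_part R u y n.+1.
Proof.
by move=> h; rewrite pcoef_rcons /head_part; case: (rcons u y) h => [|[] w'] //=;
  rewrite subr0.
Qed.

Lemma head_rcons_a u y : head la (rcons u y) != lb -> head la u != lb.
Proof. by case: u => [|[] u]. Qed.

Lemma pcoef_ge0 w n : head la w != lb -> 0 <= pcoef R w n.
Proof.
have [k] := ubnP (size w); elim: k w n => // k IH w n.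
case/lastP: w => [|u y]; first by rewrite pcoef_nil ler0n.
rewrite size_rcons ltnS => su h; case: n => [|n]; first by rewrite pcoef0 ler0n.
have hu := head_rcons_a h.
rewrite pcoef_a_rcons // mulr_ge0 // /last_part; case: (y); last exact: IH.
by apply: sumr_ge0 => i _; exact: IH.
Qed.

Lemma head_nseq k : head la (nseq k la) != lb. Proof. by case: k. Qed.

Lemma nseqS_rcons (T : Type) k (x : T) : nseq k.+1 x = rcons (nseq k x) x.
Proof. by elim: k => //= k {1}->. Qed.

(** [count id w] is the number of letters a. In the recursion a letter b only divides by n >= 1, so
    deleting it cannot decrease the nonnegative coefficients. *)
Lemma pcoef_le_a w n : head la w != lb ->
  pcoef R w n <= pcoef R (nseq (count id w) la) n.
Proof.
have [k] := ubnP (size w); elim: k w n => // k IH w n.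
case/lastP: w => [|u y] //.
rewrite size_rcons ltnS => su h; have hu := head_rcons_a h.
case: n => [|n].
  by rewrite pcoef0 -size_eq0 size_rcons; apply: pcoef_ge0; exact: head_nseq.
rewrite pcoef_a_rcons // -cats1 count_cat /= addn0 /last_part; case: (y).
  rewrite addn1 nseqS_rcons pcoef_a_rcons -?nseqS_rcons ?head_nseq //.
  by rewrite ler_wpM2l // /last_part; apply: ler_sum => i _; exact: IH.
rewrite addn0; apply: le_trans (IH _ _ su hu).
by rewrite ler_piMl ?pcoef_ge0 // invf_le1 // ler1n.
Qed.

Lemma partial_rC (c : nat -> R) (r : R) N :
  \sum_(i < N) pterm c (rC C r) i = rC C (\sum_(i < N) c i * r ^+ i).
Proof.
by rewrite rmorph_sum; apply: eq_bigr => i _; rewrite rmorphM rmorphXn.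
Qed.

Lemma nrm_rC1 (r : R) : 0 <= r < 1 -> nrm (rC C r) < 1.
Proof. by move=> /andP[r0 r1]; rewrite nrm_rC ger0_norm. Qed.

Lemma pser_real_ge (c : nat -> R) (r : R) N : (forall n, 0 <= c n) -> radius1 c ->
  0 <= r < 1 -> \sum_(i < N) c i * r ^+ i <= ReC (pser c (rC C r)).
Proof.
move=> c0 hc rr; rewrite leNgt; apply/negP; rewrite -subr_gt0 => e0.
set l := pser _ _ in e0 *.
have /cvgCP/(_ _ e0) h := pser_cvg hc (nrm_rC1 rr).
have [n [h1 h2]] := @filter_ex _ _ _ _ (filterI h (nbhs_infty_ge N)).
move: h1; rewrite partial_rC ltNge => /negP; apply; rewrite -/l.
apply: le_trans (ReC_le _); rewrite raddfB /= ReC_rC.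
apply: le_trans (ler_norm _); rewrite lerB //.
rewrite -(subnKC h2) big_split_ord /= lerDl; apply: sumr_ge0 => i _.
by rewrite mulr_ge0 // exprn_ge0; case/andP: rr.
Qed.

Lemma nrm_Sw_le u z : head la u != lb -> nrm z < 1 ->
  nrm (Sw u z) <= nrm (Sw (nseq (count id u) la) (rC C (nrm z))).
Proof.
move=> hu z1; set k := count id u.
have zz : 0 <= nrm z < 1 by rewrite nrm_ge0.
apply: pser_le => //; first exact: radius1_pcoef.
move=> N; apply: le_trans (_ : \sum_(i < N) pcoef R (nseq k la) i * nrm z ^+ i <= _).
  apply: ler_sum => i _; rewrite ler_wpM2r ?exprn_ge0 ?nrm_ge0 //.
  by rewrite ger0_norm ?pcoef_ge0 // pcoef_le_a.
apply: le_trans (pser_real_ge N _ (radius1_pcoef _) zz) _.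
  by move=> n; apply: pcoef_ge0; exact: head_nseq.
exact: le_trans (ler_norm _) (ReC_le _).
Qed.

Lemma slit_right z : 0 < ReC z -> slit z.
Proof. by move=> z0 [_]; rewrite leNgt z0. Qed.

Lemma ReC1B z : ReC (1 - z) = 1 - ReC z.
Proof. by rewrite raddfB /= -(rmorph1 (rC C)) ReC_rC. Qed.

Lemma slit_1B z : nrm z < 1 -> slit (1 - z).
Proof.
move=> z1; apply: slit_right; rewrite ReC1B.
have := le_trans (ler_norm _) (ReC_le z); lra.
Qed.

Lemma hasd_1B z : hasd (fun t => 1 - t) z (-1).
Proof. by have := hasdD (hasd_cst 1 z) (hasdN (hasd_id z)); rewrite add0r. Qed.

Lemma Sw_a z : nrm z < 1 -> Sw [:: la] z = - logC (1 - z).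
Proof.
move=> z1; apply/eqP; rewrite -addr_eq0; apply/eqP.
pose f t := Sw [:: la] t + logC (1 - t).
have n01 : nrm (0 : C) < 1 by rewrite nrm0.
have dlog t : nrm t < 1 -> hasd (fun t => logC (1 - t)) t (- (1 - t)^-1).
  move=> t1; have := hasd_comp (hasd_1B t) (logC_hasd (slit_1B t1)).
  by rewrite mulrN1.
rewrite -/(f z) (const_disc (f := f) _ _ z1).
- by rewrite /f Sw0 add0r subr0 logC1.
- move=> t t1 t0; have := hasdD (Sw_hasd [::] la t1 t0) (dlog t t1).
  by rewrite /omega /head_Sw /= Sw_nil // mulr1 mulr0 subr0 subrr.
by apply: CcvgD; [exact: Sw_cont|exact: hasd_cont (dlog _ n01)].
Qed.

(** The shuffle product of a and a^k is k+1 times a^(k+1). *)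
Lemma Sw_a_pow k z : nrm z < 1 ->
  Sw (nseq k la) z = Sw [:: la] z ^+ k / k`!%:R.
Proof.
move=> z1; elim: k => [|k IH]; first by rewrite Sw_nil // expr0 fact0 divr1.
have e : Sw [:: la] z * Sw (nseq k la) z = k.+1%:R * Sw (nseq k.+1 la) z.
  rewrite -Sh_mul_wd // /Sh [LHS]lext_shw big_seq.
  rewrite (eq_bigr (fun=> Sw (nseq k.+1 la) z)) => [|w hw]; last first.
    have sw : size w = k.+1 by rewrite (size_shuffles hw) /= size_nseq.
    have -> // : w = nseq k.+1 la; rewrite -sw; apply/all_pred1P.
    by rewrite (all_shuffles _ hw) /= all_pred1_nseq ?orbT.
  rewrite -big_seq big_const_seq count_predT size_shuffles_bin size_nseq add1n bin1.
  by rewrite iter_addr_0 mulr_natl.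
have k0 : k.+1%:R != 0 :> C by rewrite pnatr_eq0.
have f0 : k`!%:R != 0 :> C by rewrite pnatr_eq0 -lt0n fact_gt0.
apply: (mulfI k0); rewrite -e IH factS natrM exprS.
move: k0 f0; move: (k.+1%:R : C) (k`!%:R : C) (Sw _ _) (_ ^+ k).
by move=> a b c d a0 b0; field; rewrite a0 b0.
Qed.

Lemma logC_rC (r : R) : 0 < r -> logC (rC C r) = rC C (ln r).
Proof.
move=> r0; have -> : rC C r = pol C r 0.
  by rewrite /pol cos0 sin0 mulr1 mulr0 rmorph0 mulr0 addr0.
by have := @pi_gt0 R => p0; rewrite logC_pol ?rmorph0 ?mulr0 ?addr0 //;
  apply/andP; split; lra.
Qed.

Lemma nrm_nat n : nrm (n%:R : C) = n%:R.
Proof. by rewrite -(rmorph_nat (rC C)) nrm_rC normr_nat. Qed.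

(* All coefficients are at most those of a^k, and L_(a^k) = (-log(1 - z))^k / k!;
   the exponent 2 leaves room for the power of the logarithm. *)
Lemma growth u : head la u != lb -> exists2 K, 0 < K & forall z, nrm z < 1 ->
  nrm (Sw u z) ^+ 2 * (1 - nrm z) <= K.
Proof.
move=> hu; set k := count id u; exists (4 ^+ k); first by rewrite exprn_gt0.
move=> z z1; have zz : 0 <= nrm z < 1 by rewrite nrm_ge0.
set r := nrm z in z1 zz *; have d0 : 0 < 1 - r by rewrite subr_gt0.
(* Half of -log(1 - r): the square of its exponential is 1 / (1 - r), and y^k / k! <= exp y controls
   the k-th power of the logarithm. *)
pose y := - ln (1 - r) / 2.
have y0 : 0 <= y.
  rewrite /y divr_ge0 // oppr_ge0 ln_le0 //; case/andP: zz; lra.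
have e2y : expR y ^+ 2 = (1 - r)^-1.
  by rewrite expr2 -expRD -splitr expRN lnK.
have B : nrm (Sw u z) <= 2 ^+ k * expR y.
  apply: le_trans (nrm_Sw_le hu z1) _; rewrite -/k Sw_a_pow ?nrm_rC1 //.
  rewrite Sw_a ?nrm_rC1 //.
  have -> : 1 - rC C r = rC C (1 - r) by rewrite rmorphB rmorph1.
  rewrite logC_rC //.
  rewrite nrmM nrmV nrmX nrmN nrm_rC nrm_nat.
  have -> : `|ln (1 - r)| = 2 * y.
    by rewrite -normrN ger0_norm; [rewrite /y; field|move: y0; rewrite /y; lra].
  rewrite exprMn -mulrA ler_wpM2l ?exprn_ge0 //.
  case: (k) => [|j]; first by rewrite expr0 fact0 divr1; have := expR_ge1Dx y; lra.
  by have := expR_ge1Dxn j y0; lra.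
apply: le_trans (_ : (2 ^+ k * expR y) ^+ 2 * (1 - r) <= _).
  apply: ler_wpM2r; first exact: ltW.
  by apply: lerXn2r => //; rewrite nnegrE ?nrm_ge0 // mulr_ge0 ?exprn_ge0 // expR_ge0.
rewrite exprMn e2y -mulrA mulVf ?gt_eqF // mulr1 -exprM mulnC exprM.
by have -> : 2 ^+ 2 = 4 :> R by rewrite -natrX.
Qed.

Lemma Sw_a_small w : exists2 K, 0 < K & forall z, nrm z <= 2^-1 ->
  nrm (Sw (la :: w) z) <= K * nrm z.
Proof.
have hc := @radius1_pcoef R (la :: w); have hs := radius1_shift hc.
have h2 : 0 <= (2^-1 : R) < 1 by apply/andP; split; lra.
have [M hM] := geometric_bound_sum (radius1_geometric hs h2).
have M0 : 0 <= M by have := hM 0%N; rewrite big_ord0.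
exists (M + 1); first by lra.
move=> z z2; have z1 : nrm z < 1 by lra.
rewrite /Sw pser_recl // pcoef0 rmorph0 add0r nrmM mulrC ler_wpM2r ?nrm_ge0 //.
apply: le_trans (_ : M <= _); last by lra.
apply: pser_le => // N; apply: le_trans (hM N); apply: ler_sum => i _.
rewrite [leRHS]ger0_norm ?mulr_ge0 ?exprn_ge0 //.
by rewrite ler_wpM2l //; apply: lerXn2r; rewrite ?nnegrE ?nrm_ge0.
Qed.

Lemma Fh_a_small q : exists2 K, 0 < K & forall z, nrm z <= 2^-1 ->
  nrm (Fh (lcons la q) z) <= K * nrm z.
Proof.
move: q; apply: shalg_ind => [w||c p q [K K0 hK] [L L0 hL]].
- have [K K0 hK] := Sw_a_small w; exists K => // z z2.
  by rewrite lcons_wd Fh_wd F_head_a // hK.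
- by exists 1 => // z _; rewrite linear0 Fh0 nrm0 mul1r nrm_ge0.
exists (nrm (ratr c : C) * K + L).
  by rewrite ltr_wpDl // mulr_ge0 ?nrm_ge0 // ltW.
move=> z z2; rewrite linearP Fh_lin; apply: le_trans (nrmD _ _) _.
rewrite mulrDl lerD ?hL // nrmM -mulrA ler_wpM2l ?nrm_ge0 //; exact: hK.
Qed.

End Growth.

(** * Abel summation, its converse and the limit at 0 *)

Section BoundaryValues.
Variables (R : realType) (C : complexes R).
Implicit Types (u v w : word) (c : nat -> R).

Lemma CcvgX (T : Type) (F : set_system T) {FF : Filter F} (f : T -> C) (a : C) n :
  f @ F --> a -> (fun t => f t ^+ n) @ F --> a ^+ n.
Proof.
move=> fa; elim: n => [|n IH].
  by rewrite expr0; exact: Ccvg_cst.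
by rewrite exprS; apply: Ccvg_near (CcvgM fa IH) _; apply: nearW => t; rewrite exprS.
Qed.

Lemma Ccvg_sum_ord (T : Type) (F : set_system T) {FF : Filter F} (N : nat)
    (f : nat -> T -> C) (a : 'I_N -> C) : (forall i : 'I_N, f i @ F --> a i) ->
  (fun t => \sum_(i < N) f i t) @ F --> \sum_(i < N) a i.
Proof.
elim: N a => [|N IH] a h.
  rewrite big_ord0; have h0 : (fun _ : T => 0 : C) @ F --> (0 : C) by exact: Ccvg_cst.
  by refine (Ccvg_near h0 _); apply: nearW => t; rewrite big_ord0.
rewrite big_ord_recr.
refine (Ccvg_near (CcvgD (IH _ (fun i => h (widen_ord (leqnSn N) i))) (h ord_max)) _).
by apply: nearW => t; rewrite big_ord_recr.
Qed.

Lemma partial_cvg (T : Type) (F : set_system T) {FF : Filter F} c N (m : T -> C) :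
  m @ F --> (1 : C) ->
  (fun t => \sum_(i < N) pterm c (m t) i) @ F --> rC C (\sum_(i < N) c i).
Proof.
move=> hm; rewrite rmorph_sum /=.
apply: (@Ccvg_sum_ord T F FF N (fun i t => pterm c (m t) i) (fun i => rC C (c i))) => i.
rewrite -[X in _ --> X]mulr1; apply: CcvgM; first exact: Ccvg_cst.
by rewrite -(expr1n _ i); exact: CcvgX.
Qed.

Lemma sum_le_lim c (l : R) N : (forall n, 0 <= c n) ->
  (fun N => \sum_(i < N) c i) @ \oo --> l -> \sum_(i < N) c i <= l.
Proof.
move=> c0 /cvgRP h; rewrite leNgt; apply/negP; rewrite -subr_gt0 => e0.
have [n [h1 h2]] := @filter_ex _ _ _ _ (filterI (h _ e0) (nbhs_infty_ge N)).
move: h1; rewrite ltNge => /negP; apply.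
apply: le_trans (ler_norm _); rewrite lerB //.
by rewrite -(subnKC h2) big_split_ord /= lerDl; apply: sumr_ge0.
Qed.

(** Nonnegative summable coefficients dominate the tails uniformly on the disc, so [m] may approach
    1 in any manner, even tangentially. *)
Lemma abel (T : Type) (F : set_system T) {FF : Filter F} c (l : R) (m : T -> C) :
  (forall n, 0 <= c n) -> radius1 c -> (fun N => \sum_(i < N) c i) @ \oo --> l ->
  m @ F --> (1 : C) -> (\forall t \near F, nrm (m t) < 1) ->
  (fun t => pser c (m t)) @ F --> rC C l.
Proof.
move=> c0 hc hl hm m1; apply/cvgCP => e e0.
have e4 : 0 < e / 4 by rewrite divr_gt0.
have /cvgRP/(_ _ e4)/filter_ex[N hN] := hl.
have SN := sum_le_lim N c0 hl.
set S := \sum_(i < N) c i in hN SN.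
have lS : l - S < e / 4.
  by move: hN; rewrite distrC ger0_norm // subr_ge0.
have /cvgCP/(_ _ e4) := @partial_cvg T F FF c N m hm.
apply: filterS2 m1 => t mt; rewrite -/S => hP.
set P := \sum_(i < N) _ in hP.
have tail : nrm (pser c (m t) - P) <= l - S.
  have h : (fun n => \sum_(i < n) pterm c (m t) i - P) @ \oo --> pser c (m t) - P.
    by apply: CcvgB; [exact: pser_cvg|exact: Ccvg_cst].
  apply: nrm_lim_le h _; apply: filterS (nbhs_infty_ge N) => n Nn.
  have := sum_le_lim n c0 hl.
  rewrite -(subnKC Nn) !big_split_ord /= -/S -/P addrAC subrr add0r => hn.
  apply: le_trans (nrm_sum _ _ _) _.
  apply: le_trans (_ : \sum_(i < n - N) c (N + i)%N <= _); last by move: hn; lra.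
  apply: ler_sum => i _; rewrite nrm_pterm ger0_norm // ler_piMr //.
  by rewrite exprn_ile1 ?nrm_ge0 // ltW.
have -> : pser c (m t) - rC C l = (pser c (m t) - P) + (P - rC C S) + rC C (S - l).
  by rewrite rmorphB /=; ring.
apply: le_lt_trans (nrmD _ _) _; rewrite nrm_rC distrC ger0_norm ?subr_ge0 //.
by have := nrmD (pser c (m t) - P) (P - rC C S); lra.
Qed.

(* Nonnegative coefficients make this converse of Abel's theorem elementary:
   the limit bounds the partial sums. *)
Lemma tauber (T : Type) (F : set_system T) {FF : ProperFilter F} c (l : R)
    (x : T -> R) : (forall n, 0 <= c n) -> radius1 c ->
  x @ F --> (1 : R) -> (\forall t \near F, 0 <= x t < 1) ->
  (fun t => ReC (pser c (rC C (x t)))) @ F --> l ->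
  (fun N => \sum_(i < N) c i) @ \oo --> l.
Proof.
move=> c0 hc hx x1 hl.
have hm : (fun t => rC C (x t)) @ F --> (1 : C).
  rewrite -(rmorph1 (rC C)); apply/cvgCP => e e0.
  move/cvgRP : hx => /(_ _ e0); apply: filterS => t.
  by rewrite -rmorphB nrm_rC.
have Sl N : \sum_(i < N) c i <= l.
  rewrite leNgt; apply/negP => lS; set S := \sum_(i < N) c i in lS.
  have e0 : 0 < (S - l) / 2 by rewrite divr_gt0 // subr_gt0.
  have pc : (fun t => \sum_(i < N) pterm c (rC C (x t)) i) @ F --> rC C S.
    exact: partial_cvg.
  move/cvgCP : pc => /(_ _ e0) h1.
  move/cvgRP : hl => /(_ _ e0) h2.
  have [t [[h3 h4] h5]] := @filter_ex _ _ _ _ (filterI (filterI h1 h2) x1).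
  have h6 := @pser_real_ge R C c (x t) N c0 hc h5.
  move: h3; rewrite partial_rC -rmorphB nrm_rC -/S.
  move: h4; rewrite !ltr_norml => /andP[_ h7] /andP[h8 _]; lra.
have cv : cvgn (series c).
  apply: (@bounded_series_cvg _ _ l) => //.
have hS : (fun N => \sum_(i < N) c i) @ \oo --> limn (series c).
  have -> : (fun N => \sum_(i < N) c i) = series c.
    by apply/funext => N; rewrite seriesEord.
  exact: cv.
have x1' : \forall t \near F, nrm (rC C (x t)) < 1.
  by apply: filterS x1 => t; exact: nrm_rC1.
have ha : (fun t => pser c (rC C (x t))) @ F --> rC C (limn (series c)).
  exact: abel.
suff <- : limn (series c) = l by [].
have hb : (fun t => ReC (pser c (rC C (x t)))) @ F --> limn (series c).
  apply/cvgRP => e e0; move/cvgCP : ha => /(_ _ e0); apply: filterS => t.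
  apply: le_lt_trans; rewrite -[X in `|_ - X|](@ReC_rC R C) -raddfB.
  exact: ReC_le.
exact: cvg_unique hb hl.
Qed.

Section Asymptotics.
Variables (T : Type) (FF : set_system T).
Context {FFF : ProperFilter FF}.
Variables (m z : T -> C) (r : T -> R) (k B : R).
Hypotheses (k0 : 0 < k) (B0 : 0 < B) (r0 : r @ FF --> (0 : R)).
(** The common setting for both substitutions: |z| is at most of order r while 1 - |m| is at least
    of order r. *)
Hypothesis mz : \forall t \near FF, [/\ 0 < r t, nrm (m t) < 1,
  k * r t <= 1 - nrm (m t) & nrm (z t) <= B * r t].

Lemma near_r_lt (e : R) : 0 < e -> \forall t \near FF, r t < e.
Proof.
move=> e0; move/cvgRP : r0 => /(_ _ e0); apply: filterS => t.
by rewrite subr0 ltr_norml => /andP[].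
Qed.

(* The first factor is O((1 - |m|)^(-1/2)) and the second one O(|z|). *)
Lemma cross_term u q : head la u != lb ->
  (fun t => F u (m t) * Fh (lcons la q) (z t)) @ FF --> (0 : C).
Proof.
move=> hu; have [K K0 hK] := growth C hu; have [L L0 hL] := Fh_a_small C q.
apply/cvgCP => e e0.
(* The square of the product will be at most D r: [K] comes from [growth], [L] from [Fh_a_small],
   and [k], [B] compare 1 - |m| and |z| with r. *)
pose D := K * L ^+ 2 * B ^+ 2 / k.
have D0 : 0 < D by rewrite !(mulr_gt0, exprn_gt0, invr_gt0).
have d1 : 0 < e ^+ 2 / D by rewrite divr_gt0 // exprn_gt0.
have d2 : 0 < 2^-1 / B by rewrite divr_gt0.
apply: filterS3 mz (near_r_lt d1) (near_r_lt d2) => t [rt m1 mk zB] r1 r2.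
rewrite subr0 nrmM F_head_a //.
have z2 : nrm (z t) <= 2^-1.
  by apply: le_trans zB _; rewrite mulrC -ler_pdivlMr // ltW.
have hz := hL _ z2; have ha := hK _ m1.
set a := nrm (Sw u (m t)) in ha *; set b := nrm (Fh _ _) in hz *.
have a0 : 0 <= a by exact: nrm_ge0.
have b0 : 0 <= b by exact: nrm_ge0.
have b1 : b <= L * B * r t.
  by apply: le_trans hz _; rewrite -mulrA ler_wpM2l // ltW.
have a1 : a ^+ 2 * r t <= K / k.
  rewrite ler_pdivlMr // -mulrA [r t * k]mulrC; apply: le_trans ha.
  by rewrite ler_wpM2l ?exprn_ge0.
rewrite -(@ltr_pXn2r _ 2) ?nnegrE ?mulr_ge0 ?(ltW e0) // exprMn.
apply: le_lt_trans (_ : D * r t < _); last first.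
  by rewrite mulrC -ltr_pdivlMr.
apply: le_trans (_ : a ^+ 2 * (L * B * r t) ^+ 2 <= _).
  by rewrite ler_wpM2l ?exprn_ge0 // lerXn2r ?nnegrE // (le_trans b0).
have -> : a ^+ 2 * (L * B * r t) ^+ 2 = a ^+ 2 * r t * (L ^+ 2 * B ^+ 2 * r t) by ring.
have -> : D * r t = K / k * (L ^+ 2 * B ^+ 2 * r t) by rewrite /D; ring.
by rewrite ler_wpM2r // !mulr_ge0 ?exprn_ge0 // ltW.
Qed.

Variable s : letter -> shalg.
Hypothesis sB : forall v, exists q, antiext s (wd (rcons v lb)) = lcons la q.

(** A nonempty right part of a cut ends in b and its image under [s] starts with a, so [cross_term]
    applies; the cut with empty right part is F w (m t). *)
Lemma G_limit (mm : C -> C) w : admissible w -> (forall t, m t = mm (z t)) ->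
  (fun t => G s mm w (z t) - F w (m t)) @ FF --> (0 : C).
Proof.
move=> /andP[hw lw] mE.
pose f (i : nat) t := F (take i w) (m t) * Fh (antiext s (wd (drop i w))) (z t).
have hf (i : 'I_(size w)) : f i @ FF --> (0 : C).
  have [v vE] : exists v, drop i w = rcons v lb.
    have : drop i w != [::] by rewrite -size_eq0 size_drop subn_eq0 -ltnNge.
    have : last lb (drop i w) != la.
      by move: lw; rewrite -{1}(cat_take_drop i w) last_cat; case: (drop i w).
    by case/lastP: (drop i w) => // v [] ; rewrite last_rcons // => _ _; exists v.
  have [q qE] := sB v; rewrite /f vE qE; apply: cross_term.
  by move: (nat_of_ord i) => j; case: (w) hw => // x w'; case: j.
have h : (fun t => \sum_(i < size w) f i t) @ FF --> (0 : C).
  have h' : (fun t => \sum_(i < size w) f i t) @ FF --> \sum_(i < size w) (0 : C).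
    exact: (@Ccvg_sum_ord T FF _ (size w) f (fun=> 0) hf).
  by rewrite [X in _ --> X]big1 in h'.
refine (Ccvg_near h _).
have z1 : \forall t \near FF, nrm (z t) < 1.
  have d2 : 0 < 2^-1 / B by rewrite divr_gt0.
  apply: filterS2 mz (near_r_lt d2) => t [rt _ _ zB] r2.
  apply: le_lt_trans zB _; move: r2; rewrite ltr_pdivlMr // mulrC; lra.
apply: filterS z1 => t z1; rewrite /G /dec big_ord_recr /= take_size drop_size.
rewrite antiext_wd /= Fh_wd F_nil // mulr1 -mE addrK.
by apply: eq_bigr => i _; rewrite /f mE.
Qed.

End Asymptotics.

End BoundaryValues.

(** * The fixed points 1/2 and rho *)

Section HalfPoint.
Variables (R : realType) (C : complexes R).
Implicit Types (u v w : word) (z : C).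

Lemma ReC_lim (T : Type) (F : set_system T) {FF : Filter F} (f : T -> C) (a : C) :
  f @ F --> a -> (fun t => ReC (f t)) @ F --> ReC a.
Proof.
move=> h; apply/cvgRP => e e0; move/cvgCP : h => /(_ _ e0); apply: filterS => t.
rewrite -raddfB; exact: le_lt_trans (ReC_le _).
Qed.

Lemma rC_lim (T : Type) (F : set_system T) {FF : Filter F} (f : T -> R) (a : R) :
  f @ F --> a -> (fun t => rC C (f t)) @ F --> rC C a.
Proof.
move=> h; apply/cvgCP => e e0; move/cvgRP : h => /(_ _ e0); apply: filterS => t.
by rewrite -raddfB nrm_rC.
Qed.

Definition mirror z : C := 1 - z.

Lemma om_sigma x z :
  omega x (mirror z) * (-1) = - om (sigma_letter x) z.
Proof.
rewrite om_letter mulrN1 /mirror; case: x => //=.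
by rewrite opprB addrCA subrr addr0.
Qed.

Lemma seg_rC (x y t : R) : seg (rC C x) (rC C y) t = rC C (x + t * (y - x)).
Proof. by rewrite /seg rmorphD rmorphM rmorphB. Qed.

Lemma mirror_rC (x : R) : mirror (rC C x) = rC C (1 - x).
Proof. by rewrite /mirror rmorphB rmorph1. Qed.

Lemma between_itv (x y t : R) : 0 < x < 1 -> 0 < y < 1 -> 0 <= t <= 1 ->
  0 < x + t * (y - x) < 1.
Proof.
move=> /andP[x0 x1] /andP[y0 y1] /andP[t0 t1].
have -> : x + t * (y - x) = (1 - t) * x + t * y by ring.
have [->|tn0] := eqVneq t 0; first by rewrite subr0 mul1r mul0r addr0 x0.
have tp : 0 < t by rewrite lt_neqAle eq_sym tn0.
have h0 : 0 <= (1 - t) * x by rewrite mulr_ge0 ?(ltW x0) // subr_ge0.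
have h1 : 0 < t * y by rewrite mulr_gt0.
have h2 : (1 - t) * x <= 1 - t by rewrite ler_piMr ?(ltW x1) // subr_ge0.
have h3 : t * y < t by rewrite gtr_pMr.
by apply/andP; split; lra.
Qed.

Lemma G_sigma_const w (x y : R) : 0 < x < 1 -> 0 < y < 1 ->
  G sigma_letter mirror w (rC C x) = G sigma_letter mirror w (rC C y).
Proof.
move=> hx hy; apply: hasd0_const => t ht; rewrite seg_rC.
have /andP[q0 q1] := between_itv hx hy ht.
move: (_ + _) q0 q1 => q q0 q1.
have [p0 p1] : 0 < 1 - q /\ 1 - q < 1 by split; lra.
apply: (@G_hasd R C sigma_letter mirror sigma_lspan w _ (-1)).
- by apply: nrm_rC1; rewrite ltW.
- by apply: slit_right; rewrite ReC_rC.
- by rewrite mirror_rC; apply: nrm_rC1; rewrite ltW.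
- by rewrite mirror_rC; apply: slit_right; rewrite ReC_rC.
- exact: hasd_1B.
- by move=> x'; exact: om_sigma.
Qed.

Lemma sigma_rcons v : exists q, antiext sigma_letter (wd (rcons v lb)) = lcons la q.
Proof.
exists (wd (rev (map negb v))).
by rewrite [LHS]sigmaH_wd map_rcons rev_rcons lcons_wd.
Qed.

(** As t tends to 0, F w (1 - t) tends to the constant. Hence [tauber] yields the convergence of the
    nested sums, and [abel] identifies the constant with their sum. *)
Lemma G_sigma_half w : admissible w -> exists l : R,
  (fun N => \sum_(i < N) pcoef R w i) @ \oo --> l /\
  G sigma_letter mirror w 2^-1 = rC C l.
Proof.
move=> aw; have [hw _] := andP aw.
have hE : 2^-1 = rC C 2^-1 by rewrite fmorphV rmorph_nat.
rewrite hE; set G0 := G _ _ _ _.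
have h12 : 0 < (2^-1 : R) < 1 by apply/andP; split; lra.
have near01 : \forall t \near (0:R)^'+, 0 < t < 1.
  have h1 : \forall t \near (0:R)^'+, 0 < t by exact: nbhs_right_gt.
  have h2 : \forall t \near (0:R)^'+, t < 1 by apply: nbhs_right_lt.
  by apply: filterS2 h1 h2 => t -> ->.
have r0 : (fun t : R => t) @ (0:R)^'+ --> (0 : R).
  exact: cvg_within.
have mz : \forall t \near (0:R)^'+, [/\ 0 < t, nrm (mirror (rC C t)) < 1,
   1 * t <= 1 - nrm (mirror (rC C t)) & nrm (rC C t) <= 1 * t].
  apply: filterS near01 => t /andP[t0 t1]; rewrite mirror_rC !nrm_rC.
  have t0' : 0 <= 1 - t by lra.
  by rewrite (ger0_norm t0') (gtr0_norm t0); split; lra.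
have hG := G_limit (T := R) ltr01 ltr01 r0 mz sigma_rcons aw (mm := mirror) (fun=> erefl).
have hF : (fun t => F w (mirror (rC C t))) @ (0:R)^'+ --> G0.
  have h : (fun t => G0 - (G sigma_letter mirror w (rC C t) - F w (mirror (rC C t))))
     @ (0:R)^'+ --> G0 - 0 by apply: CcvgB; [exact: Ccvg_cst|exact: hG].
  rewrite subr0 in h; refine (Ccvg_near h _); apply: filterS near01 => t ht.
  by rewrite (G_sigma_const w ht h12) opprB addrC subrK.
have hS : (fun t => pser (pcoef R w) (rC C (1 - t))) @ (0:R)^'+ --> G0.
  refine (Ccvg_near hF _); apply: nearW => t; rewrite mirror_rC.
  exact: F_head_a.
have x1 : (fun t : R => 1 - t) @ (0:R)^'+ --> (1 : R).
  rewrite -[X in _ --> X]subr0; apply: cvgB => //; exact: cvg_cst.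
have hl : (fun N => \sum_(i < N) pcoef R w i) @ \oo --> ReC G0.
  apply: (@tauber R C R (0:R)^'+ _ (pcoef R w) (ReC G0) (fun t => 1 - t)) => //.
  - by move=> n; exact: pcoef_ge0.
  - exact: radius1_pcoef.
  - by apply: filterS near01 => t /andP[t0 t1]; apply/andP; split; lra.
  - exact: ReC_lim.
exists (ReC G0); split=> //.
(* [tauber] was applied to the real part; [abel] now shows that the constant itself is real. *)
have hm : (fun t => rC C (1 - t)) @ (0:R)^'+ --> (1 : C).
  rewrite -(rmorph1 (rC C)); exact: rC_lim.
have ha : (fun t => pser (pcoef R w) (rC C (1 - t))) @ (0:R)^'+ --> rC C (ReC G0).
  apply: (@abel R C R (0:R)^'+ _) => //.
  - by move=> n; exact: pcoef_ge0.
  - exact: radius1_pcoef.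
  - by apply: filterS near01 => t /andP[t0 t1]; apply: nrm_rC1; apply/andP; split; lra.
exact: Ccvg_unique hS ha.
Qed.

End HalfPoint.

(** * The relation at the primitive sixth roots of unity *)

Section SixthRoot.
Variables (R : realType) (C : complexes R).
Implicit Types (u v w : word) (z : C).
Notation A := (ratalg C).

Definition cayley z : C := (1 - z)^-1.

Lemma ReC_inv_gt0 z : 0 < ReC z -> 0 < ReC z^-1.
Proof.
move=> z0; have zn : z != 0 by apply: contraTneq z0 => ->; rewrite raddf0 ltxx.
have e : z * z^-1 = rC C 1 by rewrite rmorph1 mulfV.
have e1 := congr1 (@ReC R C) e; have e2 := congr1 (@ImC R C) e.
rewrite ReCM ReC_rC in e1; rewrite ImCM ImC_rC in e2.
have n0 : 0 < nrm z ^+ 2 by rewrite exprn_gt0 // nrm_gt0.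
rewrite -(pmulr_lgt0 _ n0) nrm_sqr.
move: z0 e1 e2; move: (ReC z) (ImC z) (ReC z^-1) (ImC z^-1) => a b c d a0 e1 e2.
have -> : c * (a ^+ 2 + b ^+ 2) = a * (a * c - b * d) + b * (a * d + b * c) by ring.
by rewrite e1 e2 mulr1 mulr0 addr0.
Qed.

Lemma slit_cayley z : nrm z < 1 -> slit (cayley z).
Proof.
move=> z1; apply: slit_right; apply: ReC_inv_gt0; rewrite ReC1B.
by have := le_trans (ler_norm _) (ReC_le z); lra.
Qed.

Lemma om0 z : om 0 z = 0.
Proof.
have := om_lin 0 0 0 z; rewrite scaler0 addr0 rmorph0 mul0r add0r.
by have := om_lin 1 0 0 z; rewrite scaler0 addr0 rmorph1 mul1r => /eqP;
  rewrite -subr_eq subrr => /eqP <-.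
Qed.

Lemma om_tau x z : z != 0 -> 1 - z != 0 ->
  omega x (cayley z) * (1 - z) ^- 2 = - om (tau_letter x) z.
Proof.
move=> z0 z1; rewrite /cayley.
have om2 : om (wd [:: la] + wd [:: lb]) z = omega la z + omega lb z.
  by rewrite -{1}[wd [:: la]]scale1r om_lin !om_letter rmorph1 mul1r.
have omN : om (- wd [:: la]) z = - omega la z.
  by rewrite -scaleN1r -[_ *: _]addr0 om_lin om_letter rmorphN1 mulN1r om0 addr0.
have e (y : C) : 1 - (1 - z)^-1 = - z * (1 - z)^-1 by field.
rewrite /tau_letter; case: x => /=; rewrite ?om2 ?omN /omega /=.
  by rewrite e //; field; rewrite z0 z1.
by rewrite invrK; field.
Qed.

Lemma hasd_cayley z : 1 - z != 0 -> hasd cayley z ((1 - z) ^- 2).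
Proof.
by move=> z1; have := hasd_comp (hasd_1B z) (hasd_inv z1); rewrite mulrN1 opprK.
Qed.

Lemma nrm_cayley z : 1 < nrm (1 - z) -> nrm (cayley z) < 1.
Proof. by move=> h; rewrite /cayley nrmV invf_lt1 // (lt_trans ltr01). Qed.

Lemma G_tau_const w x y :
  (forall t : R, 0 <= t <= 1 ->
     [/\ nrm (seg x y t) < 1, slit (seg x y t) & 1 < nrm (1 - seg x y t)]) ->
  G tau_letter cayley w x = G tau_letter cayley w y.
Proof.
move=> h; apply: hasd0_const => t /h[]; move: (seg _ _ _) => z z1 sz mz.
have n0 : 1 - z != 0 by rewrite -nrm_gt0 (lt_trans ltr01).
apply: (@G_hasd R C tau_letter cayley tau_lspan w z ((1 - z) ^- 2)) => //.
- exact: nrm_cayley.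
- exact: slit_cayley.
- exact: hasd_cayley.
by move=> x'; apply: om_tau => //; exact: slit_neq0.
Qed.

Lemma tau_rcons v : exists q, antiext tau_letter (wd (rcons v lb)) = lcons la q.
Proof.
exists (- antiext tau_letter (wd v)); rewrite -cats1 -concat_wd antiext_concat.
rewrite [antiext _ (wd [:: lb])]tauH_letter; move: (antiext _ _) => q.
have h p : concat (wd [:: la]) p = lcons la p.
  move: p; apply: (@linear_eq_wd _ (concat (wd [:: la])) (lcons la)).
  - exact: concat_linearr.
  - exact: linearP.
  by move=> u; rewrite concat_wd lcons_wd.
rewrite /tau_letter /= linearN /= -h -scaleN1r -[-1 *: wd _]addr0 concat_linearl.
by rewrite (linear0' (concat_linearl _)) addr0 scaleN1r.
Qed.

(** On the ray from 0 through [z] the real part is negative and |1 - t z| >= 1 + t / 4, so the ray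
    stays in the domain and the limit at 0 can be taken along it. *)
Lemma G_tau_zeta w z (l : R) : admissible w ->
  (fun N => \sum_(i < N) pcoef R w i) @ \oo --> l ->
  nrm z < 1 -> ReC z = - 4^-1 -> ImC z != 0 ->
  G tau_letter cayley w z = rC C l.
Proof.
move=> aw hl z1 zr zi; have [hw _] := andP aw.
have rcE (s : R) : ReC (rC C s * z) = - s / 4.
  by rewrite mulrC ReCM_rC zr; field.
have ge1 (s : R) : 0 < s -> 1 + s / 4 <= nrm (1 - rC C s * z).
  move=> s0; have := le_trans (ler_norm _) (ReC_le (1 - rC C s * z)).
  by rewrite ReC1B rcE; lra.
have Gs (s : R) : 0 < s < 1 ->
    G tau_letter cayley w (rC C s * z) = G tau_letter cayley w z.
  move=> /andP[s0 s1]; apply: G_tau_const => t /andP[t0 t1].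
  have -> : seg (rC C s * z) z t = rC C (s + t * (1 - s)) * z.
    by rewrite /seg rmorphD rmorphM rmorphB rmorph1 /=; ring.
  have [q0 q1] : 0 < s + t * (1 - s) /\ s + t * (1 - s) <= 1 by split; nra.
  move: (_ + _) q0 q1 => q q0 q1; split.
  - rewrite nrmM nrm_rC gtr0_norm //; apply: le_lt_trans z1.
    by rewrite ler_piMl ?nrm_ge0.
  - move=> [+ _]; rewrite mulrC ImCM_rC => /eqP.
    by rewrite mulf_eq0 (negbTE zi) /= gt_eqF.
  - by apply: lt_le_trans (ge1 _ q0); lra.
have near01 : \forall t \near (0:R)^'+, 0 < t < 1.
  have h1 : \forall t \near (0:R)^'+, 0 < t by exact: nbhs_right_gt.
  have h2 : \forall t \near (0:R)^'+, t < 1 by apply: nbhs_right_lt.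
  by apply: filterS2 h1 h2 => t -> ->.
have r0 : (fun t : R => t) @ (0:R)^'+ --> (0 : R).
  exact: cvg_within.
(* The constant 1/8 comes from (1 - t / 8) (1 + t / 4) >= 1 on ]0,1[. *)
have mz : \forall t \near (0:R)^'+, [/\ 0 < t, nrm (cayley (rC C t * z)) < 1,
   8^-1 * t <= 1 - nrm (cayley (rC C t * z)) & nrm (rC C t * z) <= 1 * t].
  apply: filterS near01 => t /andP[t0 t1]; have h := ge1 t t0.
  have h0 : 0 < nrm (1 - rC C t * z) by apply: lt_le_trans h; lra.
  split=> //.
  - by apply: nrm_cayley; apply: lt_le_trans h; lra.
  - rewrite /cayley nrmV lerBrDr addrC -lerBrDr -[X in X <= _]mul1r ler_pdivrMr //.
    have h2 : (1 - 8^-1 * t) * (1 + t / 4) <= (1 - 8^-1 * t) * nrm (1 - rC C t * z).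
      by rewrite ler_wpM2l //; lra.
    by apply: le_trans h2; nra.
  - by rewrite nrmM nrm_rC gtr0_norm // mul1r ler_piMr ?ltW.
have k8 : 0 < (8^-1 : R) by rewrite invr_gt0.
have hG := G_limit (T := R) k8 ltr01 r0 mz tau_rcons aw (mm := cayley) (fun=> erefl).
have hF : (fun t => pser (pcoef R w) (cayley (rC C t * z))) @ (0:R)^'+
    --> G tau_letter cayley w z.
  have h : (fun t => G tau_letter cayley w z - (G tau_letter cayley w (rC C t * z)
       - F w (cayley (rC C t * z)))) @ (0:R)^'+ --> G tau_letter cayley w z - 0.
    by apply: CcvgB; [exact: Ccvg_cst|exact: hG].
  rewrite subr0 in h; refine (Ccvg_near h _); apply: filterS near01 => t ht.
  by rewrite (Gs t ht) opprB addrC subrK F_head_a.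
have hm : (fun t => cayley (rC C t * z)) @ (0:R)^'+ --> (1 : C).
  have h : (fun t => (1 - rC C t * z)^-1) @ (0:R)^'+ --> ((1 - rC C 0 * z)^-1 : C).
    apply: CcvgV; first by rewrite rmorph0 mul0r subr0 oner_neq0.
    apply: CcvgB; first exact: Ccvg_cst.
    apply: CcvgM; last exact: Ccvg_cst.
    exact: rC_lim.
  by rewrite rmorph0 mul0r subr0 invr1 in h.
have ha : (fun t => pser (pcoef R w) (cayley (rC C t * z))) @ (0:R)^'+ --> rC C l.
  apply: (@abel R C R (0:R)^'+ _) => //.
  - by move=> n; exact: pcoef_ge0.
  - exact: radius1_pcoef.
  - by apply: filterS mz => t [].
exact: Ccvg_unique hF ha.
Qed.

Definition disc_slit : set C := [set z | nrm z < 1 /\ slit z].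

(** For x = pi / 3, cos(3x) = -1 becomes (c + 1) (2c - 1)^2 = 0 with c = cos x > 0. *)
Lemma cos_sin_pi3 : cos (pi / 3) = 2^-1 :> R /\ sin (pi / 3) ^+ 2 = 3 / 4 :> R.
Proof.
have p0 := @pi_gt0 R; pose x : R := pi / 3.
have c0 : 0 < cos x by apply: cos_gt0_pihalf; apply/andP; split; rewrite /x; lra.
have e1 : cos (x + x + x) = -1 by rewrite -(@cospi R); congr cos; rewrite /x; field.
have e2 := cos2Dsin2 x.
have s2 : sin x ^+ 2 = 1 - cos x ^+ 2 by rewrite -e2 addrC addKr.
have e : (cos x + 1) * (2 * cos x - 1) ^+ 2 = 0.
  rewrite cosD sinD cosD in e1.
  have -> : (cos x + 1) * (2 * cos x - 1) ^+ 2 =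
    4 * cos x ^+ 3 - 3 * cos x + 1 by ring.
  have -> : 4 * cos x ^+ 3 - 3 * cos x =
     cos x ^+ 3 - 3 * cos x * sin x ^+ 2 by rewrite s2; ring.
  by rewrite -[in X in _ + X](opprK 1) -e1; ring.
move/eqP: e; rewrite mulf_eq0 sqrf_eq0 gt_eqF /=; last by lra.
rewrite subr_eq0 => /eqP e; have c : cos x = 2^-1 by lra.
by split; rewrite -/x ?s2 c //; field.
Qed.

Section Boundary.
Variable r : C.
Hypotheses (r1 : nrm r = 1) (mr1 : nrm (1 - r) = 1) (rr : ReC r = 2^-1).

(* A convex part of [disc_slit] on which both forms are bounded, so that
   [F w] is Lipschitz there, by induction on [w]. *)
Definition cap : set C := [set z | nrm z < 1 /\ nrm (z - r) < 4^-1].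

Lemma cap_slit z : cap z -> slit z.
Proof.
move=> [_ h]; apply: slit_right; have := le_lt_trans (ReC_le _) h.
by rewrite raddfB /= rr ltr_norml => /andP[]; lra.
Qed.

Lemma cap_omega z x : cap z -> nrm (omega x z) <= 2.
Proof.
move=> [_ h]; have [h1 h2] : 2^-1 <= nrm z /\ 2^-1 <= nrm (1 - z).
  have := nrmD (r - z) z; have := nrmD (z - r) (1 - z).
  rewrite subrK r1 [z - r + _]addrC addrA subrK mr1 [nrm (r - z)]nrmB.
  by move=> ? ?; split; lra.
have inv2 (a : R) : 2^-1 <= a -> a^-1 <= 2.
  by move=> ha; rewrite invf_ple ?posrE //; lra.
by rewrite /omega; case: x; rewrite nrmV inv2.
Qed.

Lemma cap_seg x y (t : R) : cap x -> cap y -> 0 <= t <= 1 -> cap (seg x y t).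
Proof.
move=> [x1 xr] [y1 yr] ht.
have conv (a b : C) (M : R) : nrm a < M -> nrm b < M ->
    nrm (a + rC C t * (b - a)) < M.
  move=> aM bM; have /andP[t0 t1] := ht.
  have -> : a + rC C t * (b - a) = rC C (1 - t) * a + rC C t * b.
    by rewrite rmorphB rmorph1; ring.
  apply: le_lt_trans (nrmD _ _) _; rewrite !nrmM !nrm_rC.
  have t1' : 0 <= 1 - t by lra.
  rewrite (ger0_norm t0) (ger0_norm t1').
  have [->|tn] := eqVneq t 0; first by rewrite subr0 mul1r mul0r addr0.
  have tp : 0 < t by rewrite lt_neqAle eq_sym tn.
  have h1 : (1 - t) * nrm a <= (1 - t) * M by rewrite ler_wpM2l // ltW.
  have h2 : t * nrm b < t * M by rewrite ltr_pM2l.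
  by have := ler_ltD h1 h2; rewrite -mulrDl subrK mul1r.
split; first exact: conv.
have -> : seg x y t - r = (x - r) + rC C t * ((y - r) - (x - r)).
  by rewrite /seg; ring.
exact: conv.
Qed.

Lemma cap_point : exists z, cap z.
Proof.
exists (rC C (9/10) * r); split.
  by rewrite nrmM r1 nrm_rC ger0_norm; lra.
have -> : rC C (9/10) * r - r = - (rC C (1/10) * r).
  have -> : rC C (1 / 10) = 1 - rC C (9/10).
    by rewrite -(rmorph1 (rC C)) -rmorphB; congr (rC C _); field.
  by ring.
by rewrite nrmN nrmM r1 nrm_rC ger0_norm; lra.
Qed.

Lemma F_lip w : exists2 M : R, 0 < M &
  forall x y, cap x -> cap y -> nrm (F w y - F w x) <= M * nrm (y - x).
Proof.
elim/last_ind: w => [|w c [M M0 hM]].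
  exists 1 => // x y [x1 _] [y1 _].
  by rewrite !F_nil // subrr nrm0 mul1r nrm_ge0.
have [z0 hz0] := cap_point.
(* The form is at most 2, and F w is at most its absolute value at [z0] plus M times the diameter
   2. *)
exists (2 * (nrm (F w z0) + M * 2)).
  by apply: mulr_gt0 => //; apply: ltr_wpDl; [exact: nrm_ge0|rewrite mulr_gt0].
move=> x y hx hy; apply: mean_value => t ht.
have hs := cap_seg hx hy ht; move: (seg x y t) hs => z hz.
have [z1 _] := hz; exists (omega c z * F w z); first exact: F_hasd z1 (cap_slit hz).
rewrite nrmM; apply: ler_pM => //; rewrite ?nrm_ge0 ?cap_omega //.
have := nrmD (F w z - F w z0) (F w z0); rewrite subrK => h.
apply: le_trans h _; rewrite addrC lerD2l; apply: le_trans (hM _ _ hz0 hz) _.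
rewrite ler_pM2l //; have [z01 _] := hz0; have := nrmD z (- z0); rewrite nrmN; lra.
Qed.

Notation W := (within disc_slit (nbhs r)).

(** The radial points (1 - d) r lie in the slit disc arbitrarily close to [r]; this makes limits
    along [W] unique. *)
#[local] Instance W_proper : ProperFilter W.
Proof.
apply: Build_ProperFilter_ex => P; rewrite /within /= => /nearCP[e e0 h].
pose d := Num.min (e / 2) (4^-1 : R).
have d0 : 0 < d by rewrite lt_min; apply/andP; split; lra.
have d4 : d <= 4^-1 by rewrite ge_min lexx orbT.
have de : d <= e / 2 by rewrite ge_min lexx.
exists (rC C (1 - d) * r).
have nz : nrm (rC C (1 - d) * r) < 1.
  by rewrite nrmM r1 nrm_rC ger0_norm; lra.
have dr : nrm (rC C (1 - d) * r - r) = d.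
  have -> : rC C (1 - d) * r - r = - (rC C d * r) by rewrite rmorphB rmorph1; ring.
  by rewrite nrmN nrmM r1 nrm_rC gtr0_norm // mulr1.
apply: h; first by rewrite dr; lra.
split=> //; apply: slit_right; rewrite mulrC ReCM_rC rr; lra.
Qed.

Lemma near_cap : \forall z \near W, cap z.
Proof.
rewrite /prop_near1 /within /=; have e0 : 0 < (4^-1 : R) by rewrite invr_gt0.
by apply: filterS (near_nrm r e0) => z zr [z1 _]; split.
Qed.

(** The Lipschitz bound gives the Cauchy property at [r], and completeness is used for the real and
    imaginary parts separately. *)
Lemma F_lim w : exists l : C, F w @ W --> l.
Proof.
have [M M0 hM] := F_lip w.
have key (e : R) : 0 < e -> exists a, \forall z \near W, nrm (F w z - a) < e.
  move=> e0; have d0 : 0 < e / M / 2 by rewrite !divr_gt0.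
  have n1 : \forall z \near W, cap z /\ nrm (z - r) < e / M / 2.
    by apply: filterS2 near_cap (cvg_within _ (near_nrm r d0)) => z.
  have [z0 [c0 h0]] := @filter_ex _ _ _ _ n1.
  exists (F w z0); apply: filterS n1 => z [cz hz].
  apply: le_lt_trans (hM _ _ c0 cz) _; rewrite mulrC -ltr_pdivlMr //.
  have -> : z - z0 = (z - r) - (z0 - r) by ring.
  by apply: le_lt_trans (nrmD _ _) _; rewrite nrmN; lra.
have real_lim (f : C -> R) : (forall z a, `|f z - f a| <= nrm (z - a)) ->
    exists l : R, (fun z => f (F w z)) @ W --> l.
  move=> hf; apply/cvg_ex; apply/cauchy_cvgP; apply: cauchy_exP => e e0.
  have [a ha] := key e e0; exists (f a); apply: filterS ha => z hz.
  by rewrite -ball_normE /= distrC; apply: le_lt_trans (hf _ _) hz.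
have hRe (z a : C) : `|ReC z - ReC a| <= nrm (z - a) by rewrite -raddfB; exact: ReC_le.
have hIm (z a : C) : `|ImC z - ImC a| <= nrm (z - a) by rewrite -raddfB; exact: ImC_le.
have [a ha] := real_lim (@ReC R C) hRe; have [b hb] := real_lim (@ImC R C) hIm.
exists (rC C a + 'i * rC C b).
have h : (fun z => rC C (ReC (F w z)) + 'i * rC C (ImC (F w z))) @ W
    --> rC C a + 'i * rC C b.
  apply: CcvgD; first exact: rC_lim.
  by apply: CcvgM; [exact: Ccvg_cst|exact: rC_lim].
by refine (Ccvg_near h _); apply: nearW => z; rewrite -C_split.
Qed.

(** This is the point L(r) on the circle of convergence: the shuffle relations hold inside the disc
    and pass to the limit. *)
Lemma gamma_boundary : exists g : Gamma A, forall p, Fh p @ W --> (g p : C).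
Proof.
have /choice[f hf] := F_lim.
have hFh p : Fh p @ W --> (lext (fun w => f w : A) p : C).
  move: p; apply: shalg_ind => [w||c p q hp hq].
  - rewrite lext_wd; refine (Ccvg_near (hf w) _); apply: nearW => z.
    by rewrite Fh_wd.
  - rewrite linear0; have h : (fun=> 0 : C) @ W --> (0 : C) by exact: Ccvg_cst.
    by refine (Ccvg_near h _); apply: nearW => z; rewrite Fh0.
  rewrite (lext_is_linear (fun w => f w : A)) ratalg_scaleE.
  have hc : (fun=> ratr c : C) @ W --> (ratr c : C) by exact: Ccvg_cst.
  have h : (fun z => ratr c * Fh p z + Fh q z) @ W -->
      ratr c * (lext (fun w => f w : A) p : C) + lext (fun w => f w : A) q.
    exact: (CcvgD (CcvgM hc hp) hq).
  by refine (Ccvg_near h _); apply: nearW => z; rewrite Fh_lin.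
have [||g hg] := @gamma_word A f.
- have h : (fun=> 1 : C) @ W --> (1 : C) by exact: Ccvg_cst.
  refine (Ccvg_unique (hf [::]) _); refine (Ccvg_near h _).
  by apply: filterS near_cap => z [z1 _]; rewrite F_nil.
- move=> u v; refine (Ccvg_unique (hFh (shw u v)) _).
  refine (Ccvg_near (CcvgM (hf u) (hf v)) _).
  apply: filterS near_cap => z [z1 _]; have [g hg] := gammaF z1.
  rewrite -(Fh_gamma hg) -!hg -rmorphM /=.
  by rewrite -[wd u * wd v]/(shmul (wd u) (wd v)) shmul_wd.
exists g => p; have -> // : g p = lext (fun w => f w : A) p.
apply: (linear_eq_wd (f := g)); [exact: linearP|exact: linearP|].
by move=> w; rewrite hg lext_wd.
Qed.

End Boundary.

Lemma mul_letter (g h : Gamma A) x :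
  (g * h)%g (wd [:: x]) = g (wd [:: x]) + h (wd [:: x]).
Proof.
by rewrite [LHS]convol_wd dec_cons dec0 !rmorph1 mul1r mulr1 addrC.
Qed.

(** For nonempty [w], [pcoef R w i] is the part of the nested sum with largest index i, so [l] is
    the polyzeta value. *)
Definition has_zeta_values (f : shalg -> C) := forall w, admissible w ->
  exists l : R, (fun N => \sum_(i < N) pcoef R w i) @ \oo --> l /\
  f (wd w) = rC C l.

Lemma half_values (g : Gamma A) : (forall w, g (wd w) = F w 2^-1) ->
  [/\ has_zeta_values (g * gsigma g)%g, (g * gsigma g)%g (wd [:: lb]) = 0 &
     (g * gsigma g)%g (wd [:: la]) = 0].
Proof.
move=> hg; have h2 : mirror (2^-1 : C) = 2^-1.
  by rewrite /mirror; field.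
have n2 : nrm (2^-1 : C) < 1.
  by rewrite nrmV nrm_nat invf_lt1 //; lra.
(* L_a(1/2) = -log(1 - 1/2) cancels L_b(1/2) = log(1/2). *)
have la0 : F [:: la] (2^-1 : C) + F [:: lb] (2^-1 : C) = 0.
  have e : 1 - 2^-1 = 2^-1 :> C by exact: h2.
  by rewrite F_b // F_head_a // Sw_a // e addNr.
have sE x : sigmaH (wd [:: x]) = wd [:: ~~ x] by rewrite sigmaH_wd.
split.
- move=> w aw; have [l [hl e]] := G_sigma_half C aw; exists l; split=> //.
  rewrite -e; apply: G_gamma => //.
  by move=> v; rewrite h2.
- by rewrite mul_letter gsigmaE sE !hg /= addrC.
- by rewrite mul_letter gsigmaE sE !hg.
Qed.

Section Angle.
Variable th : R.
Hypotheses (c2 : cos th = 2^-1) (thpi : - pi < th < pi).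
Let r : C := pol C 1 th.
Let p0 : 0 < (pi : R) := pi_gt0 R.

Lemma sin_sqr_root : sin th ^+ 2 = 3 / 4.
Proof. by have := cos2Dsin2 th; rewrite c2; lra. Qed.

Lemma nrm_root : nrm r = 1. Proof. exact: nrm_pol. Qed.
Lemma ReC_root : ReC r = 2^-1. Proof. by rewrite ReC_pol mul1r. Qed.
Lemma ImC_root : ImC r = sin th. Proof. by rewrite ImC_pol mul1r. Qed.

Lemma mirror_root : 1 - r = pol C 1 (- th).
Proof.
have e : rC C 1 = rC C 2^-1 + rC C 2^-1 by rewrite -rmorphD; congr (rC C _); field.
by rewrite rmorph1 in e; rewrite /r /pol cosN sinN c2 !mul1r rmorphN /= {1}e; ring.
Qed.

Lemma nrm_mirror_root : nrm (1 - r) = 1.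
Proof. by rewrite mirror_root; exact: nrm_pol. Qed.

Lemma cayley_root : cayley r = r.
Proof.
have e : (1 - r) * r = 1.
  rewrite mirror_root polM addNr mulr1 /pol cos0 sin0 !mulr1 mulr0 rmorph0 mulr0 addr0.
  exact: rmorph1.
have n0 : 1 - r != 0 by rewrite -nrm_gt0 nrm_mirror_root.
by apply: (mulfI n0); rewrite /cayley mulfV.
Qed.

(** The points r - q run along the segment from [r] to the starting point r - 3/4 of the ray, of
    real part -1/4; there |r - q|^2 = 1 - q + q^2 and |1 - r + q|^2 = 1 + q + q^2. *)
Lemma disc_path (q : R) : 0 < q < 1 -> [/\ nrm (r - rC C q) < 1,
  slit (r - rC C q) & 1 < nrm (1 - (r - rC C q))].
Proof.
move=> /andP[q0 q1].
have re : ReC (r - rC C q) = 2^-1 - q by rewrite raddfB /= ReC_rC ReC_root.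
have im : ImC (r - rC C q) = sin th by rewrite raddfB /= ImC_rC ImC_root subr0.
have im1 : ImC (1 - (r - rC C q)) = - sin th.
  by rewrite raddfB /= im -(rmorph1 (rC C)) ImC_rC sub0r.
split.
- rewrite -(@ltr_pXn2r _ 2) ?nnegrE ?nrm_ge0 // nrm_sqr re im sin_sqr_root; nra.
- by move=> [e _]; move: sin_sqr_root; rewrite -im e expr0n /=; lra.
- rewrite -(@ltr_pXn2r _ 2) ?nnegrE ?nrm_ge0 // nrm_sqr ReC1B re im1 sqrrN sin_sqr_root.
  nra.
Qed.

(** At [r] both log r and -log(1 - r) equal i th; since tau(a) = a + b and tau(b) = -a, the
    coordinates at a and b become 3 i th and 0. At admissible words the constant is carried from [r]
    to r - 3/4 and from there to 0. *)
Lemma boundary_values (g : Gamma A) :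
  (forall p, Fh p @ within disc_slit (nbhs r) --> (g p : C)) ->
  [/\ has_zeta_values (g * gtau g)%g, (g * gtau g)%g (wd [:: lb]) = 0 &
     (g * gtau g)%g (wd [:: la]) = 'i * rC C (3 * th)].
Proof.
move=> hg; have /andP[tp1 tp2] := thpi.
have comp p (T : Type) (FF : set_system T) (FFF : ProperFilter FF) (x : T -> C) :
    x @ FF --> r -> (\forall t \near FF, disc_slit (x t)) ->
    (fun t => Fh p (x t)) @ FF --> (g p : C).
  move=> xr dx; apply/cvgCP => e e0.
  have /cvgCP/(_ _ e0) := hg p; rewrite /prop_near1 /within /= => /nearCP[d d0 hd].
  move/cvgCP : xr => /(_ _ d0); apply: filterS2 dx => t h1 h2.
  exact: hd.
have PW : ProperFilter (within disc_slit (nbhs r)).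
  by apply: W_proper; [exact: nrm_root|exact: ReC_root].
have sr : slit r by apply: slit_right; rewrite ReC_root; lra.
have sr1 : slit (1 - r) by apply: slit_right; rewrite ReC1B ReC_root; lra.
have nearW1 : \forall z \near within disc_slit (nbhs r), nrm z < 1.
  by apply: filterS (near_cap r) => z [].
have gb : g (wd [:: lb]) = 'i * rC C th :> C.
  have h : (fun z : C => logC z) @ within disc_slit (nbhs r) --> logC r.
    exact: cvg_within_filter (hasd_cont (logC_hasd sr)).
  have <- : logC r = 'i * rC C th.
    by rewrite /r logC_pol ?ln1 ?rmorph0 ?add0r //; apply/andP; split; lra.
  refine (Ccvg_unique (hg _) _); refine (Ccvg_near h _).
  by apply: filterS nearW1 => z z1; rewrite Fh_wd F_b.
have ga : g (wd [:: la]) = 'i * rC C th :> C.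
  have h : (fun z => - logC (1 - z)) @ within disc_slit (nbhs r) --> - logC (1 - r).
    apply: CcvgN.
    exact: cvg_within_filter (hasd_cont (hasd_comp (hasd_1B r) (logC_hasd sr1))).
  have <- : - logC (1 - r) = 'i * rC C th.
    rewrite mirror_root logC_pol ?ln1 ?rmorph0 ?add0r ?rmorphN ?mulrN ?opprK //.
    by apply/andP; split; lra.
  refine (Ccvg_unique (hg _) _); refine (Ccvg_near h _).
  by apply: filterS nearW1 => z z1; rewrite Fh_wd F_head_a // Sw_a.
split; last first.
- rewrite mul_letter gtauE tauH_letter /tau_letter /= linearD /=.
  rewrite ga gb rmorphM rmorph_nat /=.
  by ring.
- by rewrite mul_letter gtauE tauH_letter /tau_letter /= linearN /= ga gb subrr.
(* The convergence of the nested sums is taken from the point 1/2. *)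
move=> w aw; have [l [hl _]] := G_sigma_half C aw; exists l; split=> //.
have near01 : \forall t \near (0:R)^'+, 0 < t < 4^-1.
  have h1 : \forall t \near (0:R)^'+, 0 < t by exact: nbhs_right_gt.
  have h2 : \forall t \near (0:R)^'+, t < 4^-1 by apply: nbhs_right_lt; rewrite invr_gt0.
  by apply: filterS2 h1 h2 => t -> ->.
pose x (t : R) : C := r - rC C t.
have xr : x @ (0:R)^'+ --> r.
  have h : x @ (0:R)^'+ --> r - rC C 0.
    apply: CcvgB; first exact: Ccvg_cst.
    by apply: rC_lim; exact: cvg_within.
  by rewrite rmorph0 subr0 in h.
have dx : \forall t \near (0:R)^'+, disc_slit (x t).
  apply: filterS near01 => t /andP[t0 t1].
  by have [|h1 h2 _] := @disc_path t; [apply/andP; split; lra|split].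
have cr : (fun t => cayley (x t)) @ (0:R)^'+ --> r.
  rewrite -[X in _ --> X]cayley_root.
  apply: CcvgV; first by rewrite -nrm_gt0 nrm_mirror_root.
  by apply: CcvgB => //; exact: Ccvg_cst.
have dcr : \forall t \near (0:R)^'+, disc_slit (cayley (x t)).
  apply: filterS near01 => t /andP[t0 t1].
  have [|h1 h2 h3] := @disc_path t; first by apply/andP; split; lra.
  by split; [exact: nrm_cayley|exact: slit_cayley].
pose z1 := r - rC C (3/4).
have [n1 s1 _] : [/\ nrm z1 < 1, slit z1 & 1 < nrm (1 - z1)].
  by apply: disc_path; apply/andP; split; lra.
have Gz : G tau_letter cayley w z1 = rC C l.
  apply: G_tau_zeta => //.
    by rewrite raddfB /= ReC_rC ReC_root; field.
  rewrite raddfB /= ImC_rC ImC_root subr0; apply/eqP => e.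
  by move: sin_sqr_root; rewrite e expr0n /=; lra.
have Gx : \forall t \near (0:R)^'+, G tau_letter cayley w (x t) = rC C l.
  apply: filterS near01 => t /andP[t0 t1].
  rewrite -Gz; apply: G_tau_const => q /andP[q0 q1].
  have -> : seg (x t) z1 q = r - rC C (t + q * (3/4 - t)).
    by rewrite /seg /x /z1 [rC C (t + _)]rmorphD rmorphM rmorphB /=; ring.
  by apply: disc_path; apply/andP; split; nra.
(* Both [x t] and its image under [cayley] tend to the fixed point [r] inside the slit disc, so each
   factor has a coordinate of [g] or [gtau g] as limit. *)
have hlim : (fun t => G tau_letter cayley w (x t)) @ (0:R)^'+ -->
    ((g * gtau g)%g (wd w) : C).
  rewrite [X in _ --> X]convol_wd /G /dec.
  apply: (@Ccvg_sum_ord R C R _ _ _ (fun i t => F (take i w) (cayley (x t)) *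
    Fh (antiext tau_letter (wd (drop i w))) (x t))
    (fun i => g (wd (take i w)) * gtau g (wd (drop i w)))) => i.
  apply: CcvgM; last exact: comp.
  have h : (fun t => Fh (wd (take i w)) (cayley (x t))) @ (0:R)^'+ -->
    (g (wd (take i w)) : C) by apply: comp.
  by refine (Ccvg_near h _); apply: nearW => t; rewrite Fh_wd.
have hc : (fun=> rC C l) @ (0:R)^'+ --> rC C l by exact: Ccvg_cst.
apply: Ccvg_unique hlim _; refine (Ccvg_near hc _).
by apply: filterS Gx => t ->.
Qed.

End Angle.

End SixthRoot.

(** * Identification with the nested sums *)

Section NestedSums.
Variable (R : realType).
Implicit Types (t : seq nat) (k N m r : nat).

Lemma sum_by_level (V : nmodType) (I : finType) (P : pred I) (l : I -> nat)
    (f : I -> V) M :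
  \sum_(j | P j && (l j < M)%N) f j = \sum_(i < M) \sum_(j | P j && (l j == i)) f j.
Proof.
rewrite (exchange_big_dep predT) //= big_mkcond; apply: eq_bigr => j _.
case: (P j) => /=; last by rewrite big_pred0_eq.
case: ltnP => h; last first.
  by rewrite big1 // => i /eqP e; move: (ltn_ord i); rewrite -e ltnNge h.
rewrite (bigD1 (Ordinal h)) //= big1 ?addr0 // => i /andP[/eqP e].
by case/eqP; apply: val_inj.
Qed.

(** The part of the nested sum with largest index [m]; [N] serves to make the index type finite. *)
Definition nested k t N m : R :=
  \sum_(n : k.-tuple 'I_N | path ltn 0%N [seq val i | i <- n] &&
      (last 0%N [seq val i | i <- n] == m))
    \prod_(j < k) (tnth n j)%:R ^- (nth 0%N t j).+1.

(** With its largest index fixed to [m], a tuple is determined by its other entries, which are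
    sorted by their own largest index i < m. *)
Lemma nested_rcons t r N m : (m < N)%N ->
  nested (size t).+1 (rcons t r) N m =
  m%:R ^- r.+1 * \sum_(i < m) nested (size t) t N i.
Proof.
move=> mN; rewrite /nested; set k := size t; pose o := Ordinal mN.
pose h (n : k.-tuple 'I_N) : k.+1.-tuple 'I_N := [tuple of rcons n o].
pose h' (u : k.+1.-tuple 'I_N) : k.-tuple 'I_N := [tuple of belast (head o u) (behead u)].
have hK n : h' (h n) = n.
  by apply: val_inj => /=; case: (tval n) => //= x s; rewrite belast_rcons.
rewrite (reindex_onto h h') => [|u /andP[_]]; last first.
  case/tupleP: u => x s /eqP /= e; apply: val_inj => /=.
  rewrite [RHS]lastI; congr rcons; apply: val_inj => /=.
  by rewrite -e last_map.
rewrite -sum_by_level mulr_sumr; apply: eq_big => n.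
  by rewrite hK eqxx andbT /= map_rcons rcons_path last_rcons eqxx andbT.
move=> _; rewrite big_ord_recr /= mulrC; congr (_ * _).
  by rewrite (tnth_nth o) /= !nth_rcons size_tuple ltnn eqxx.
apply: eq_bigr => j _.
by rewrite !(tnth_nth o) /= !nth_rcons size_tuple !ltn_ord.
Qed.

Lemma abword_rcons t r : abword (rcons t r) = abword t ++ la :: nseq r lb.
Proof. by rewrite /abword map_rcons -cats1 flatten_cat /= cats0. Qed.

Lemma head_abword t : head la (abword t) != lb.
Proof. by case: t. Qed.

Lemma pcoef_block u r n : head la u != lb ->
  pcoef R (u ++ la :: nseq r lb) n = n%:R ^- r.+1 * \sum_(i < n) pcoef R u i.
Proof.
move=> hu; have hh s : head la (u ++ la :: s) != lb by case: u hu.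
case: n => [|n].
  by rewrite pcoef0 big_ord0 mulr0; case: (u).
elim: r => [|r IH].
  by rewrite cats1 pcoef_a_rcons ?expr1 // -cats1.
have e : u ++ la :: nseq r.+1 lb = rcons (u ++ la :: nseq r lb) lb.
  by rewrite nseqS_rcons rcons_cat.
by rewrite e pcoef_a_rcons -?e // /last_part IH mulrA [in RHS]exprS invfM.
Qed.

(** Both sides obey the same recursion over the last block a b^r: a sum over smaller indices,
    divided by m^(r+1). *)
Lemma nested_pcoef t N m : (m < N)%N -> nested (size t) t N m = pcoef R (abword t) m.
Proof.
elim/last_ind: t m => [|t r IH] m mN.
  rewrite /nested (eq_bigl (fun=> 0%N == m)) => [|n]; last by rewrite tuple0.
  rewrite pcoef_nil eq_sym; case: eqP => _; last by rewrite big_pred0_eq.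
  rewrite (big_pred1 [tuple]) => [|n]; first by rewrite big_ord0.
  by apply/esym/eqP; exact: tuple0.
rewrite size_rcons nested_rcons // abword_rcons pcoef_block ?head_abword //.
by congr (_ * _); apply: eq_bigr => i _; rewrite IH // (ltn_trans _ mN).
Qed.

(** The condition on [N] matters for the empty [t], whose only term has index 0. *)
Lemma psumE (C : complexes R) t (z : C) N : (0 < N)%N ->
  \sum_(n : (size t).-tuple 'I_N | path ltn 0%N [seq val i | i <- n])
    (\prod_(j < size t) (tnth n j)%:R ^- (nth 0%N t j).+1) *
    z ^+ last 0%N [seq val i | i <- n] =
  \sum_(n < N) pterm (pcoef R (abword t)) z n.
Proof.
move=> N0.
rewrite (eq_bigl (fun n : (size t).-tuple 'I_N => path ltn 0%N [seq val i | i <- n] &&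
   (last 0%N [seq val i | i <- n] < N)%N)) => [|n]; last first.
  rewrite -[LHS]andbT; congr andb; apply/esym.
  by case: (tval n) => //= x s; rewrite last_map ltn_ord.
rewrite sum_by_level; apply: eq_bigr => m _.
rewrite /pterm -(nested_pcoef t (ltn_ord m)) rmorph_sum /= mulr_suml.
apply: eq_bigr => n /andP[_ /eqP ->]; congr (_ * _).
rewrite rmorph_prod; apply: eq_bigr => j _.
by rewrite fmorphV rmorphXn rmorph_nat.
Qed.

Lemma word_abword (w : word) : head la w != lb -> exists t, w = abword t.
Proof.
have [n] := ubnP (size w); elim: n w => // n IH [|[] w] // sw _; first by exists [::].
have [k [v [e hv]]] := word_prefix w.
have [|t vE] := IH v _ hv; last by exists (k :: t); rewrite e vE.
by move: sw; rewrite e /= size_cat; lia.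
Qed.

End NestedSums.

(** * Uniqueness of the polylogarithm and zeta morphisms *)

Section Characterizations.
Variables (R : realType) (C : complexes R).
Implicit Types (u v w : word) (z : C) (p q : shalg) (t : seq nat).
Notation A := (ratalg C).

Definition psum t z N : C :=
  \sum_(n : (size t).-tuple 'I_N | path ltn 0%N [seq val i | i <- n])
    (\prod_(j < size t) (tnth n j)%:R ^- (nth 0%N t j).+1) *
    z ^+ last 0%N [seq val i | i <- n].

Lemma Ccvg_lim (T : Type) (FF : set_system T) {FFF : ProperFilter FF}
    (f : T -> C) (l : C) : f @ FF --> l -> lim (f @ FF) = l.
Proof. by move=> h; apply: cvg_lim h; exact: norm_hausdorff. Qed.

Lemma psum_lim t z : nrm z < 1 -> lim (psum t z @ \oo) = Sw (abword t) z.
Proof.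
move=> z1; apply: Ccvg_lim.
refine (Ccvg_near (pser_cvg (@radius1_pcoef R (abword t)) z1) _).
by apply: filterS (nbhs_infty_ge 1) => N N1; rewrite -psumE.
Qed.

Lemma psum1_lim t (l : R) :
  (fun N => \sum_(i < N) pcoef R (abword t) i) @ \oo --> l ->
  lim (psum t 1 @ \oo) = rC C l.
Proof.
move=> hl; apply: Ccvg_lim; refine (Ccvg_near (rC_lim hl) _).
apply: filterS (nbhs_infty_ge 1) => N N1; rewrite [RHS](psumE t (1 : C) N1) rmorph_sum.
by apply: eq_bigr => n _; rewrite /pterm expr1n mulr1.
Qed.

(** The counterpart of [alg_morphism] over the abstract complex numbers. *)
Definition algm (f : shalg -> C) : Prop :=
  [/\ forall (c : rat) p q, f (c *: p + q) = ratr c * f p + f q,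
      f 1 = 1 & {morph f : p q / p * q}].

Lemma algm_gamma (f : shalg -> C) : algm f ->
  exists g : Gamma A, forall p, g p = f p.
Proof.
move=> [fl f1 fM].
have fl' : linear (f : shalg -> A) by move=> c p q; rewrite fl -ratalg_scaleE.
by exists (gamma_of (f := (f : shalg -> A)) fl' f1 fM).
Qed.

Lemma gamma_algm (g : Gamma A) : algm g.
Proof.
split=> [c p q||p q]; [|exact: rmorph1|exact: rmorphM].
by rewrite linearP ratalg_scaleE.
Qed.

Lemma Fh_algm z : nrm z < 1 -> algm (fun p => Fh p z).
Proof.
move=> /gammaF[g hg]; have e := Fh_gamma hg.
have -> : (fun p => Fh p z) = g by apply/funext => p; rewrite e.
exact: gamma_algm.
Qed.

Lemma algm_eq_b (f f' : shalg -> C) : algm f -> algm f' ->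
  (forall t, f (wd (abword t)) = f' (wd (abword t))) ->
  f (wd [:: lb]) = f' (wd [:: lb]) -> f =1 f'.
Proof.
move=> /algm_gamma[g hg] /algm_gamma[g' hg'] e eb p; rewrite -hg -hg'.
have -> // : g = g'; apply: generation_b => [w hw|]; rewrite !(hg, hg') //.
by have [t ->] := word_abword hw.
Qed.

Lemma algm_eq_ab (f f' : shalg -> C) : algm f -> algm f' ->
  (forall t, admissible (abword t) -> f (wd (abword t)) = f' (wd (abword t))) ->
  f (wd [:: lb]) = f' (wd [:: lb]) -> f (wd [:: la]) = f' (wd [:: la]) -> f =1 f'.
Proof.
move=> /algm_gamma[g hg] /algm_gamma[g' hg'] e eb ea p; rewrite -hg -hg'.
have -> // : g = g'; apply: generation_ab => [w aw||]; rewrite !(hg, hg') //.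
have [hw _] := andP aw; have [t wE] := word_abword hw.
by rewrite wE; apply: e; rewrite -wE.
Qed.

Lemma Fh_derivable p z : nrm z < 1 -> slit z -> derivable (Fh p) z 1.
Proof.
move=> z1 sz; suff [d h] : exists d, hasd (Fh p) z d by exact: hasd_derivable h.
move: p; apply: shalg_ind => [w||c p q [d hd] [d' hd']].
- case/lastP: w => [|w x].
    exists 0; apply: hasd_near (hasd_cst 1 z) _ _; first by rewrite Fh_wd F_nil.
    have e0 : 0 < 1 - nrm z by rewrite subr_gt0.
    apply: filterS (near_nrm z e0) => y yz; rewrite Fh_wd F_nil //.
    by have := nrmD (y - z) z; rewrite subrK; lra.
  exists (omega x z * F w z); apply: hasd_eq (F_hasd w x z1 sz) _ => y.
  by rewrite Fh_wd.
- by exists 0; apply: hasd_eq (hasd_cst 0 z) _ => y; rewrite Fh0.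
exists (ratr c * d + d'); apply: hasd_eq (hasd_lin c hd hd') _ => y.
by rewrite Fh_lin.
Qed.

End Characterizations.

(** * Transfer to the concrete complex numbers *)

Section Concrete.
Variable R : realType.

Lemma rect_cplx (a b : R) : real_complex R a + 'i * real_complex R b = Complex a b.
Proof.
rewrite -complexiE; apply/eqP; rewrite eq_complex /=.
by apply/andP; split; apply/eqP; rewrite /=; ring.
Qed.

Lemma real_complex_le (a b : R) : (real_complex R a <= real_complex R b) = (a <= b).
Proof. by rewrite lecE /= eqxx. Qed.

(** Left transparent, since results over this structure are read as statements over [Cplx R] by
    conversion. *)
Definition Cx : complexes R.
Proof.
apply: (@Complexes R (Cplx R) (real_complex R) (@complex.Re R) (@complex.Im R)).
- exact: real_complex_le.
- by move=> r s; rewrite rect_cplx.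
- by move=> r s; rewrite rect_cplx.
- by move=> [a b]; rewrite rect_cplx.
Defined.

Lemma Omega_disc : @Omega R = @disc_slit R Cx.
Proof.
have h (z : Cx) : (`|z| < 1) = (nrm z < 1) by rewrite nrmE -(rmorph1 (rC Cx)) rC_lt.
by apply/seteqP; split=> z [z1 sz]; (split; [|exact: sz]); move: z1; rewrite ?h -?h.
Qed.

Lemma clog_logC (z : Cx) : clog z = logC z.
Proof. exact: (esym (rect_cplx _ _)). Qed.

Lemma rho_pol : rho R = pol Cx 1 (pi / 3).
Proof. by rewrite /pol !mul1r; exact: (esym (rect_cplx _ _)). Qed.

Lemma rho_inv_pol : (rho R)^-1 = pol Cx 1 (- (pi / 3)).
Proof.
have e : pol Cx 1 (pi / 3) * pol Cx 1 (- (pi / 3)) = 1.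
  rewrite polM subrr mulr1 /pol cos0 sin0 !mulr1 mulr0 rmorph0 mulr0 addr0.
  exact: rmorph1.
have n0 : pol Cx 1 (pi / 3) != 0 by rewrite -nrm_gt0 nrm_pol.
by rewrite rho_pol; apply: (mulfI n0); rewrite mulfV.
Qed.

Lemma ipi_rC : ipi R = 'i * rC Cx pi.
Proof. by rewrite -[RHS]add0r -(rmorph0 (rC Cx)); exact: (esym (rect_cplx _ _)). Qed.

Lemma is_polylog_Fh : is_polylog (@Fh R Cx).
Proof.
split=> [h z|z|t z|z]; rewrite Omega_disc => -[z1 sz].
- exact: (@Fh_derivable R Cx).
- exact: (@Fh_algm R Cx).
- rewrite [RHS](@psum_lim R Cx t z z1) Fh_wd F_head_a //; exact: head_abword.
- by rewrite Fh_wd F_b // clog_logC.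
Qed.

(** The choice made by [xget] satisfies [is_polylog] because [Fh] does, and two such families agree
    on [Omega], the algebra being generated by W^+ and b. *)
Lemma polylogE h z : @Omega R z -> polylog h z = @Fh R Cx h z.
Proof.
have [_ m1 t1 b1] : is_polylog (@polylog R).
  by have := xgetPex (fun _ _ => 0) (ex_intro _ _ is_polylog_Fh).
have [_ m2 t2 b2] := is_polylog_Fh.
move=> Oz; have := @algm_eq_b R Cx _ _ (m1 z Oz) (m2 z Oz); apply.
- by move=> t; rewrite t1 // t2.
- by rewrite b1 // b2.
Qed.

(** The point [g] witnesses the existence of a regularised zeta morphism with its own value at a;
    generation by W^++, a and b identifies it with the chosen one. *)
Lemma zetaE (g : Gamma (ratalg Cx)) : has_zeta_values g ->
  g (wd [:: lb]) = 0 -> forall p, zeta (g (wd [:: la]) : Cplx R) p = g p.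
Proof.
move=> hg gb.
have zg : is_zeta (g (wd [:: la]) : Cplx R) (g : shalg -> Cplx R).
  split=> //; first exact: (gamma_algm (C := Cx)).
  move=> t at_; have [l [hl ->]] := hg _ at_.
  exact: (esym (psum1_lim Cx hl)).
have [m1 t1 b1 a1] : is_zeta (g (wd [:: la]) : Cplx R) (zeta (g (wd [:: la]) : Cplx R)).
  by have := xgetPex (fun _ => 0) (ex_intro _ _ zg).
have [m2 t2 b2 a2] := zg.
apply: (@algm_eq_ab R Cx).
- exact: m1.
- exact: m2.
- by move=> t at_; rewrite t1 // t2.
- by rewrite b1 // b2.
- exact: a1.
Qed.

Lemma half_identity (phi : regfun Pvar) :
  zeta_on (0 : Cplx R) phi = polylog_on Kvar (square_reg phi) (1 / 2).
Proof.
have half1 : nrm (2^-1 : Cx) < 1 by rewrite nrmV nrm_nat invf_lt1 //; lra.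
have [g hg] := gammaF half1; have [hz gb ga] := half_values hg.
have Oh : @Omega R (1 / 2).
  rewrite Omega_disc div1r; split=> //; apply: slit_right.
  have -> : 2^-1 = rC Cx 2^-1 by rewrite fmorphV rmorph_nat.
  by rewrite ReC_rC invr_gt0.
have ehh : extends phi (xget 0 [set h | extends phi h]).
  by have := xgetPex 0 (regularP phi).
have [eh inv] : extends (square_reg phi) (xget 0 [set h | extends (square_reg phi) h /\
    right_invariant Kvar h]) /\ right_invariant Kvar (xget 0 [set h |
    extends (square_reg phi) h /\ right_invariant Kvar h]).
  by have := xgetPex 0 (square_extension phi).
rewrite /polylog_on polylogE // /zeta_on; move: eh inv ehh.
move: (xget _ _) (xget _ _) => hh h eh inv ehh.
have z0 := zetaE hz gb; rewrite ga in z0; rewrite [LHS]z0.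
rewrite -(square_value g ehh eh inv) (Fh_gamma hg) div1r.
exact: erefl.
Qed.

(** Taken at th = pi / 3 and th = - pi / 3, where 3 th is pi and - pi, this covers both signs. *)
Lemma sixth_identity (th : R) (psi : regfun Qvar) : cos th = 2^-1 ->
  - pi < th < pi ->
  zeta_on ('i * rC Cx (3 * th) : Cplx R) psi =
  cext (polylog_on Lvar (nabla_reg psi)) (pol Cx 1 th).
Proof.
move=> c2 thpi; have r1 := @nrm_root R Cx th; have rr := @ReC_root R Cx th c2.
have mr1 := @nrm_mirror_root R Cx th c2.
have [g hg] := gamma_boundary r1 mr1 rr.
have [hz gb ga] := boundary_values c2 thpi hg.
have ehh : extends psi (xget 0 [set h | extends psi h]).
  by have := xgetPex 0 (regularP psi).
have [eh inv] : extends (nabla_reg psi) (xget 0 [set h | extends (nabla_reg psi) h /\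
    right_invariant Lvar h]) /\ right_invariant Lvar (xget 0 [set h |
    extends (nabla_reg psi) h /\ right_invariant Lvar h]).
  by have := xgetPex 0 (nabla_extension psi).
rewrite /polylog_on /zeta_on; move: eh inv ehh.
move: (xget _ _) (xget _ _) => hh h eh inv ehh.
have z0 := zetaE hz gb; rewrite ga in z0; rewrite [LHS]z0.
rewrite -(nabla_value g ehh eh inv) /cext; apply/esym.
have PW : ProperFilter (within (@disc_slit R Cx) (nbhs (pol Cx 1 th))) by exact: W_proper.
have e : (fun z => polylog h z) @ within (@disc_slit R Cx) (nbhs (pol Cx 1 th))
    --> (g h : Cx).
  refine (Ccvg_near (hg h) _); rewrite /prop_near1 /within /=.
  by apply: nearW => z Oz; rewrite polylogE // Omega_disc.
rewrite Omega_disc; exact: (@Ccvg_lim R Cx).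
Qed.

End Concrete.

Theorem theorem18 (R : realType) :
  (forall phi : regfun Pvar,
     zeta_on (0 : Cplx R) phi = polylog_on Kvar (square_reg phi) (1 / 2)) /\
  (forall psi : regfun Qvar,
     zeta_on (ipi R) psi = cext (polylog_on Lvar (nabla_reg psi)) (rho R) /\
     zeta_on (- ipi R) psi = cext (polylog_on Lvar (nabla_reg psi)) (rho R)^-1).
Proof.
split=> [phi|psi]; first exact: half_identity.
have [c2 _] := cos_sin_pi3 R; have p0 := @pi_gt0 R.
have i1 : ipi R = 'i * rC (Cx R) (3 * (pi / 3)).
  by rewrite ipi_rC; congr ('i * rC (Cx R) _); field.
have i2 : - ipi R = 'i * rC (Cx R) (3 * - (pi / 3)).
  by rewrite i1 !mulrN rmorphN mulrN.
rewrite rho_inv_pol rho_pol i1 -i1 i2 i1; split; apply: sixth_identity;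
  rewrite ?cosN //; apply/andP; split; lra.
Qed.
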